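(* For every $r\in\mathbb N$ there exists a function $\psi:\mathbb N\to\mathbb N$ with the following property. Let $\mathcal F$ be any germ of singular analytic foliation at $(\mathbb C^2,0)$ and let $S$ be formed by the union of the following curves: (a) all formal isolated separatrices of $\mathcal F$; (b) one non-isolated separatrix attached to each dicritical component of valence one; (c) $r$ non-isolated separatrices attached to each dicritical component of valence three or greater. Then the algebraic multiplicity of $S$ at $0$ and the length of the reduction process of $S$ are both at most $\psi(\mu_0(\mathcal F))$, where $\mu_0(\mathcal F)$ is the Milnor number of $\mathcal F$ (that is, these two data are topologically bounded).
   Context: A germ of analytic foliation $\mathcal F$ at $(\mathbb C^2,0)$ is defined by $\omega=a\,dx+b\,dy$ with $a,b\in\mathbb C\{x,y\}$ without common factor; it is singular if $a(0)=b(0)=0$. Its Milnor number is $\mu_0(\mathcal F)=\dim_{\mathbb C}\mathbb C\{x,y\}/(a,b)$. A separatrix is a germ of formal irreducible curve $\{f=0\}$ with $f$ dividing $\omega\wedge df$. If $E$ is a composition of point blow-ups, $E^*\mathcal F$ is the strict transform foliation. A singularity is reduced if, in suitable formal coordinates, its linear part is $y\,dx-\lambda x\,dy$ with $\lambda\neq0$, $\lambda\notin\mathbb Q^+$, or $x\,dy$ (saddle-node). The minimal reduction of singularities of $\mathcal F$, $E:(\mathcal M,\mathcal D)\to(\mathbb C^2,0)$, $\mathcal D=E^{-1}(0)$, is the minimal composition of point blow-ups ($E$ is the identity if $0$ is reduced) such that all singularities of $E^*\mathcal F$ on $\mathcal D$ are reduced and the strict transforms of all separatrices are smooth, pairwise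 disjoint, transverse to $\mathcal D$ and avoid the corners of $\mathcal D$. A component $D\subset\mathcal D$ is dicritical if it is not invariant by $E^*\mathcal F$; its valence is the number of other components of $\mathcal D$ meeting $D$. A separatrix is attached to a dicritical component $D$ if its strict transform by $E$ meets $D$ (it is then non-isolated); a separatrix attached to no dicritical component is isolated. The length of the reduction process of a curve $S$ is the number of point blow-ups in its minimal desingularization (after which the branches of the strict transform are smooth, disjoint, and transverse to the exceptional divisor away from corners). *)

(* Defs.v *)
From HB Require Import structures.
From mathcomp Require Import all_boot all_order all_algebra.
From mathcomp Require Import finmap.
From mathcomp Require Import boolp classical_sets reals.
From mathcomp Require Import complex.

Set Implicit Arguments.
Unset Strict Implicit.
Unset Printing Implicit Defensive.

Import Order.TTheory GRing.Theory Num.Theory.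
Local Open Scope ring_scope.

(* The ring K[[x,y]]: [f i j] is the coefficient of x^i y^j.                  *)
Record fps2 (K : Type) := FPS2 { coef2 :> nat -> nat -> K }.

Section PowerSeries.
Variable K : fieldType.
Implicit Types f g h u v : fps2 K.

Lemma fps2P f g : (forall i j, f i j = g i j) -> f = g.
Proof.
case: f g => [f] [g] /= fg; congr FPS2.
by apply/funext => i; apply/funext => j; apply: fg.
Qed.

HB.instance Definition _ := gen_eqMixin (fps2 K).
HB.instance Definition _ := gen_choiceMixin (fps2 K).

Definition fps2_const (c : K) : fps2 K :=
  FPS2 (fun i j => if (i == 0)%N && (j == 0)%N then c else 0).
Definition fps2_add f g := FPS2 (fun i j => f i j + g i j).
Definition fps2_opp f := FPS2 (fun i j => - f i j).
Definition fps2_mul f g : fps2 K :=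
  FPS2 (fun n m => \sum_(i < n.+1) \sum_(j < m.+1) f i j * g (n - i)%N (m - j)%N).

Fact fps2_addA : associative fps2_add.
Proof. by move=> f g h; apply: fps2P => i j /=; rewrite addrA. Qed.
Fact fps2_addC : commutative fps2_add.
Proof. by move=> f g; apply: fps2P => i j /=; rewrite addrC. Qed.
Fact fps2_add0 : left_id (fps2_const 0) fps2_add.
Proof. by move=> f; apply: fps2P => i j /=; rewrite if_same add0r. Qed.
Fact fps2_addN : left_inverse (fps2_const 0) fps2_opp fps2_add.
Proof. by move=> f; apply: fps2P => i j /=; rewrite if_same addNr. Qed.

HB.instance Definition _ :=
  GRing.isZmodule.Build (fps2 K) fps2_addA fps2_addC fps2_add0 fps2_addN.

Let trunc N f : {poly {poly K}} := \poly_(i < N) \poly_(j < N) f i j.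

Let coef_trunc N f i j : (i < N)%N -> (j < N)%N -> (trunc N f)`_i`_j = f i j.
Proof. by move=> iN jN; rewrite coef_poly iN coef_poly jN. Qed.

Let coef_mul (P Q : {poly {poly K}}) n m :
  (P * Q)`_n`_m =
  \sum_(i < n.+1) \sum_(j < m.+1) P`_i`_j * Q`_(n - i)`_(m - j).
Proof. by rewrite coefM coef_sum; apply: eq_bigr => i _; rewrite coefM. Qed.

Let mul_trunc N f g n m : (n < N)%N -> (m < N)%N ->
  fps2_mul f g n m = (trunc N f * trunc N g)`_n`_m.
Proof.
move=> nN mN; rewrite coef_mul; apply: eq_bigr => i _; apply: eq_bigr => j _.
rewrite !coef_trunc //.
- exact: leq_ltn_trans (leq_subr _ _) nN.
- exact: leq_ltn_trans (leq_subr _ _) mN.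
- exact: leq_ltn_trans (leq_ord i) nN.
- exact: leq_ltn_trans (leq_ord j) mN.
Qed.

Fact fps2_mulC : commutative fps2_mul.
Proof.
move=> f g; apply: fps2P => n m.
by rewrite !(@mul_trunc (n + m).+1) ?ltnS ?leq_addr ?leq_addl // mulrC.
Qed.

Fact fps2_mulA : associative fps2_mul.
Proof.
move=> f g h; apply: fps2P => n m; set N := (n + m).+1.
have nN : (n < N)%N by rewrite ltnS leq_addr.
have mN : (m < N)%N by rewrite ltnS leq_addl.
transitivity ((trunc N f * (trunc N g * trunc N h))`_n`_m).
  rewrite coef_mul; apply: eq_bigr => i _; apply: eq_bigr => j _.
  rewrite coef_trunc ?(leq_ltn_trans (leq_ord i)) ?(leq_ltn_trans (leq_ord j)) //.
  by rewrite (@mul_trunc N) // (leq_ltn_trans (leq_subr _ _)).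
rewrite mulrA coef_mul; apply: eq_bigr => i _; apply: eq_bigr => j _.
rewrite (@mul_trunc N) ?(leq_ltn_trans (leq_ord i)) ?(leq_ltn_trans (leq_ord j)) //.
by rewrite coef_trunc // (leq_ltn_trans (leq_subr _ _)).
Qed.

Fact fps2_mul1 : left_id (fps2_const 1) fps2_mul.
Proof.
move=> f; apply: fps2P => n m /=.
rewrite big_ord_recl big_ord_recl /= mul1r !subn0.
rewrite big1 => [|j _]; last by rewrite mul0r.
by rewrite addr0 big1 ?addr0 // => i _; rewrite big1 // => j _; rewrite mul0r.
Qed.

Fact fps2_mulDl : left_distributive fps2_mul +%R.
Proof.
move=> f g h; apply: fps2P => n m /=.
rewrite -big_split; apply: eq_bigr => i _ /=.
by rewrite -big_split; apply: eq_bigr => j _; rewrite /= mulrDl.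
Qed.

Fact fps2_1neq0 : fps2_const 1 != 0.
Proof.
apply/eqP => /(congr1 (fun f : fps2 K => f 0%N 0%N)) /= /eqP.
by rewrite oner_eq0.
Qed.

HB.instance Definition _ := GRing.Zmodule_isComNzRing.Build (fps2 K)
  fps2_mulA fps2_mulC fps2_mul1 fps2_mulDl fps2_1neq0.

Definition fps2_unit : {pred fps2 K} := [pred f | `[< exists g, g * f = 1 >]].
Definition fps2_inv f : fps2 K := xget f [set g | g * f = 1].

Fact fps2_mulV : {in fps2_unit, left_inverse 1 fps2_inv *%R}.
Proof. by move=> f /asboolP fU; apply: (xgetPex f fU). Qed.
Fact fps2_unitP f g : g * f = 1 -> fps2_unit f.
Proof. by move=> gf1; apply/asboolP; exists g. Qed.
Fact fps2_inv_out : {in [predC fps2_unit], fps2_inv =1 id}.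
Proof.
move=> f /asboolP fU; rewrite /fps2_inv; case: xgetP => // g _ gf1.
by case: fU; exists g.
Qed.

HB.instance Definition _ := GRing.ComNzRing_hasMulInverse.Build (fps2 K)
  fps2_mulV fps2_unitP fps2_inv_out.

Definition fps2_x : fps2 K := FPS2 (fun i j => ((i == 1) && (j == 0))%N%:R).
Definition fps2_y : fps2 K := FPS2 (fun i j => ((i == 0) && (j == 1))%N%:R).

Definition dx f : fps2 K := FPS2 (fun i j => f i.+1 j *+ i.+1).
Definition dy f : fps2 K := FPS2 (fun i j => f i j.+1 *+ j.+1).

(* f(u,v), for u and v without constant term: then u^i v^j contributes to the
   coefficient of x^n y^m only if i + j <= n + m.                             *)
Definition subst f u v : fps2 K :=
  FPS2 (fun n m => \sum_(i < (n + m).+1) \sum_(j < (n + m).+1)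
          f i j * (u ^+ i * v ^+ j : fps2 K) n m).

Definition divides f g : Prop := exists h, g = h * f.

Definition irreducible_series f : Prop :=
  f \isn't a GRing.unit /\
  forall g h, f = g * h -> g \is a GRing.unit \/ h \is a GRing.unit.

End PowerSeries.

(* 0 if no natural number satisfies P.                                        *)
Definition least (P : nat -> Prop) : nat :=
  xget 0%N [set n | P n /\ forall m, P m -> (n <= m)%N].

Section Curves.
Variable K : fieldType.
Implicit Types (f g : fps2 K) (S : set (fps2 K)).

Definition mult0 f : nat :=
  least (fun n => exists i j, (i + j)%N = n /\ f i j != 0).

Definition passes f : Prop := f 0%N 0%N = 0.
Definition smooth f : Prop := f 1%N 0%N != 0 \/ f 0%N 1%N != 0.

Definition same_curve f g : Prop := divides f g /\ divides g f.

(* A set S of irreducible series stands for the curve whose branches are the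
   {f = 0}, f in S; several elements of S may define the same branch, and
   [branches S s] says that s lists every branch exactly once.                *)
Definition branches S (s : seq (fps2 K)) : Prop :=
  [/\ forall f, f \in s -> S f,
      forall f, S f -> exists2 g, g \in s & same_curve f g &
      forall i j, (i < size s)%N -> (j < size s)%N ->
        same_curve s`_i s`_j -> i = j].

Definition nb_branches S (n : nat) : Prop :=
  exists2 s, branches S s & size s = n.

Definition reduced_equation S (h : fps2 K) : Prop :=
  exists2 s, branches S s & h = \prod_(f <- s) f.

End Curves.

(* The pair w = (a, b) is the form a dx + b dy.                               *)
Definition one_form (K : Type) := (fps2 K * fps2 K)%type.

Section Forms.
Variable K : fieldType.
Implicit Types (f g u v : fps2 K) (w : one_form K).

Definition differential f : one_form K := (dx f, dy f).

(* The coefficient of dx /\ dy in w /\ df.                                    *)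
Definition wedge w f : fps2 K := w.1 * dy f - w.2 * dx f.

Definition invariant_curve w f : Prop := divides f (wedge w f).

Definition transverse f g : Prop := wedge (differential f) g 0%N 0%N != 0.

Definition singular w : Prop := w.1 0%N 0%N = 0 /\ w.2 0%N 0%N = 0.

Definition separatrix w f : Prop :=
  [/\ irreducible_series f, passes f & invariant_curve w f].

Definition pullback u v w : one_form K :=
  (subst w.1 u v * dx u + subst w.2 u v * dx v,
   subst w.1 u v * dy u + subst w.2 u v * dy v).

Definition formal_coordinates u v : Prop :=
  [/\ passes u, passes v & transverse u v].

(* The linear part of w is p y dx + q x dy.                                   *)
Definition has_linear_part w (p q : K) : Prop :=
  singular w /\
  [/\ w.1 1%N 0%N = 0, w.1 0%N 1%N = p, w.2 1%N 0%N = q & w.2 0%N 1%N = 0].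

Definition reduced_singularity w : Prop :=
  exists u v, formal_coordinates u v /\
    ((exists l : K,
        [/\ l != 0, forall c : rat, 0 < c -> l <> ratr c &
            has_linear_part (pullback u v w) 1 (- l)])
     \/ has_linear_part (pullback u v w) 0 1).

End Forms.

Section BlowUps.
Variable K : fieldType.
Implicit Types (f g : fps2 K) (w : one_form K).

(* A direction is a point of the exceptional line of the blow-up of a point:
   [Some c] is the tangent line y = c x and [None] is the line x = 0. At each
   of them we use the coordinates in which the blow-up is
     (x, y) |-> (x, x (y + c))   at [Some c],
     (x, y) |-> (x y, x)         at [None],
   so that the exceptional line is always x = 0.                              *)
Definition direction := option K.

Definition blowup_x (d : direction) : fps2 K :=
  if d is Some _ then fps2_x K else fps2_x K * fps2_y K.
Definition blowup_y (d : direction) : fps2 K :=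
  if d is Some c then fps2_x K * (fps2_y K + fps2_const c) else fps2_x K.

Definition x_order (s : seq (fps2 K)) : nat :=
  least (fun n => exists2 f, f \in s & exists j, f n j != 0).
Definition div_xn (n : nat) f : fps2 K := FPS2 (fun i j => f (i + n)%N j).

Definition strict_transform f (d : direction) : fps2 K :=
  let g := subst f (blowup_x d) (blowup_y d) in div_xn (x_order [:: g]) g.

Definition foliation_transform w (d : direction) : one_form K :=
  let w' := pullback (blowup_x d) (blowup_y d) w in
  let n := x_order [:: w'.1; w'.2] in (div_xn n w'.1, div_xn n w'.2).

(* A point infinitely near 0 is the list of the successive directions leading
   to it, the first one being a direction at 0; [::] is 0 itself.             *)
Definition inpoint := seq direction.
Implicit Types (p q : inpoint) (T : {fset inpoint}) (S : set (fps2 K)).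

Definition curve_at f p : fps2 K := foldl strict_transform f p.
Definition foliation_at w p : one_form K := foldl foliation_transform w p.

(* A composition of point blow-ups E : (M, D) -> (C^2, 0) is given by the set T
   of all the points that are blown up, the order in which distinct points of a
   same surface are blown up being irrelevant. T is empty if E is the identity.
   The components of D are the strict transforms D_p of the exceptional lines of
   the blow-ups of the points p in T.                                         *)
Definition blowup_centers T : Prop :=
  forall p d, rcons p d \in T -> p \in T.

(* q is a point of D = E^-1(0).                                               *)
Definition on_divisor T q : Prop :=
  q \notin T /\ (q = [::] \/ exists p d, q = rcons p d /\ p \in T).

(* Equation at q of D_p: x = 0 at the points of the blow-up of p, and then its
   successive strict transforms; 1 if q is not infinitely near p.             *)
Definition component_at p q : fps2 K :=
  if prefix p q && (p != q) then curve_at (fps2_x K) (drop (size p).+1 q)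
  else 1.

Definition corner T q : Prop :=
  exists p p', [/\ p \in T, p' \in T, p <> p',
    passes (component_at p q) & passes (component_at p' q)].

Definition meets T p p' : Prop :=
  exists q, [/\ on_divisor T q, passes (component_at p q) &
                passes (component_at p' q)].

Definition valence T p : nat :=
  #|` [fset p' in T | (p' != p) && `[< meets T p p' >]]%fset |.

(* The strict transforms of the branches of S through the point q of D are
   smooth, disjoint, transverse to D and avoid the corners of D.              *)
Definition desingularized_at T S q : Prop :=
  forall f, S f -> passes (curve_at f q) ->
  [/\ smooth (curve_at f q),
      forall g, S g -> passes (curve_at g q) -> same_curve f g,
      forall p, p \in T -> passes (component_at p q) ->
        transverse (curve_at f q) (component_at p q) &
      ~ corner T q].

Definition desingularization S T : Prop :=
  blowup_centers T /\ forall q, on_divisor T q -> desingularized_at T S q.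

Definition minimal_desingularization S T : Prop :=
  desingularization S T /\
  forall T', desingularization S T' -> (T `<=` T')%fset.

Definition reduction w T : Prop :=
  desingularization [set f | separatrix w f] T /\
  forall q, on_divisor T q ->
    singular (foliation_at w q) -> reduced_singularity (foliation_at w q).

Definition minimal_reduction w T : Prop :=
  (reduced_singularity w -> T = fset0) /\
  (~ reduced_singularity w ->
     reduction w T /\ forall T', reduction w T' -> (T `<=` T')%fset).

Definition dicritical w T p : Prop :=
  p \in T /\
  ~ (forall q, on_divisor T q -> passes (component_at p q) ->
       invariant_curve (foliation_at w q) (component_at p q)).

Definition attached T p f : Prop :=
  exists q, [/\ on_divisor T q, passes (component_at p q) &
                passes (curve_at f q)].

Definition isolated_separatrix w T f : Prop :=
  separatrix w f /\ forall p, dicritical w T p -> ~ attached T p f.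

(* No separatrix is taken on the dicritical components of valence 0 or 2.     *)
Definition selected_separatrices (r : nat) w T S : Prop :=
  [/\ forall f, S f -> separatrix w f,
      forall f, isolated_separatrix w T f -> exists2 g, S g & same_curve f g &
      forall p, dicritical w T p ->
        nb_branches [set f | S f /\ attached T p f]
          (if valence T p == 1%N then 1%N
           else if (3 <= valence T p)%N then r else 0%N)].

End BlowUps.

Section AnalyticForms.
Variable R : realType.
Implicit Types (f g : fps2 R[i]) (w : one_form R[i]).

Definition convergent f : Prop :=
  exists M rho : R, forall i j, `|f i j| <= (M * rho ^+ (i + j))%:C%C.

Definition analytic_foliation w : Prop :=
  [/\ convergent w.1, convergent w.2 &
      forall g a b, convergent g -> convergent a -> convergent b ->
        w.1 = a * g -> w.2 = b * g -> exists2 h, convergent h & h * g = 1].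

(* The ideal (a, b) of C{x,y}.                                                *)
Definition in_ideal w f : Prop :=
  exists p q, [/\ convergent p, convergent q & f = p * w.1 + q * w.2].

(* n = dim C{x,y}/(a, b): the classes of e_0, ..., e_(n-1) form a basis.      *)
Definition milnor_number w (n : nat) : Prop :=
  exists e : 'I_n -> fps2 R[i], (forall i, convergent (e i)) /\
    forall f, convergent f -> exists! c : 'rV[R[i]]_n,
      in_ideal w (f - \sum_i fps2_const (c 0 i) * e i).

End AnalyticForms.

(* Main.v *)
Require Import Defs.
From mathcomp Require Import all_boot all_order all_algebra.
From mathcomp Require Import finmap boolp classical_sets reals complex.
From mathcomp Require Import zify ring.
Set Implicit Arguments.
Unset Strict Implicit.
Unset Printing Implicit Defensive.
Import Order.TTheory GRing.Theory Num.Theory.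
Local Open Scope ring_scope.

(** Curves and foliations are followed along infinitely near points, where the
exceptional components are x = 0 and possibly y = 0. Let w be the transform of
the foliation at such a point, divided by the equations of the invariant
components: w = y^ey A dx + x^ex B dy. By Noether's inequality the logarithmic
Milnor number dim K[[x,y]]/(A,B) drops under a blow-up. Call a singular point
bad if no exceptional component through it is invariant or if the linear part
of w in (y dx, x dy) vanishes. The weight 2 dim + [exactly one invariant
component] strictly drops from bad points to bad points of the blow-up, and a
nondicritical blow-up of order n has at most n + 2 special points, so the bad
points lying over 0 form a tree bounded in terms of the Milnor number.

At a point that is not bad there is at most one branch of S, up to equality,
and it is smooth and transverse to the invariant components. The only obstacle
is the blow-up of a radial point: minimality of the reduction then makes the
dicritical component have valence one or two, so that S contains at most one
separatrix attached to it. At a dicritical bad point the chosen separatrices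
are at most max(1, r) in number. The branches are tangent to the dicritical
components to an order bounded by the orders met along the tree, which bounds
the number of further blow-ups that separate S from them. *)

(** The measure has to be logarithmic: the plain Milnor number can grow at a nondicritical point of
    order one, for instance from 2 to 3 for y dy + x^2 dx. At a point of order n, with ex, ey in {0,
    1} recording which axes are invariant, A and B have orders at least n - ey and n - ex, so (n -
    ey)(n - ex) is taken off. At bad points this is zero only for n = 1 with exactly one invariant
    component; the bad points above then lie on two, which the extra unit of the weight records, and
    the factor 2 outweighs that unit whenever the drop is positive.

    The obstacle is that the Milnor number does not bound the reduction of the foliation itself: p x
    dy - q y dx has Milnor number 1, while for coprime p, q > 1 its separatrices y^p = c x^q have
    unbounded multiplicity. They are attached to a component of valence two, where nothing is
    selected; hence the exact count of valences at radial points.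

    Codimensions are formal lower bounds, [codim_ge], so that finiteness is never presupposed;
    convergence matters only in the comparison with mu. *)

Lemma coef2M (K : fieldType) (f g : fps2 K) n m : (f * g) n m =
  \sum_(i < n.+1) \sum_(j < m.+1) f i j * g (n - i)%N (m - j)%N.
Proof. by []. Qed.

Lemma substE (K : fieldType) (f u v : fps2 K) n m : subst f u v n m =
  \sum_(i < (n + m).+1) \sum_(j < (n + m).+1) f i j * (u ^+ i * v ^+ j : fps2 K) n m.
Proof. by []. Qed.

(* Keeps [/=] from unfolding the coefficients of products and substitutions. *)
Global Opaque fps2_mul subst.

(** * Power series in two variables *)

Section SeriesBasics.
Variable K : fieldType.
Implicit Types (f g h u v : fps2 K) (c : K) (p q : nat -> {poly K}).

Notation X := (fps2_x K).
Notation Y := (fps2_y K).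

Definition swap f : fps2 K := FPS2 (fun i j => f j i).
Definition rows p : fps2 K := FPS2 (fun i j => (p i)`_j).
(* The homogeneous part of degree n, at x = 1. *)
Definition hpart f n : {poly K} := \poly_(j < n.+1) f (n - j)%N j.
Definition of_hom p : fps2 K := FPS2 (fun i j => (p (i + j)%N)`_j).
(* f(x, x (y + c)) *)
Definition bl c f : fps2 K := rows (fun n => hpart f n \Po ('X + c%:P)).

Lemma coef2D f g i j : (f + g) i j = f i j + g i j. Proof. by []. Qed.
Lemma coef2N f i j : (- f) i j = - f i j. Proof. by []. Qed.
Lemma coef2B f g i j : (f - g) i j = f i j - g i j. Proof. by []. Qed.
Lemma coef2_0 i j : (0 : fps2 K) i j = 0. Proof. by rewrite /= if_same. Qed.
Lemma coef2_1 i j : (1 : fps2 K) i j = ((i == 0) && (j == 0))%N%:R.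
Proof. by rewrite /=; case: ifP. Qed.
Lemma coef2_sum I (r : seq I) (P : pred I) (F : I -> fps2 K) i j :
  (\sum_(k <- r | P k) F k) i j = \sum_(k <- r | P k) F k i j.
Proof. exact: (big_morph (fun f : fps2 K => f i j) (fun f g => coef2D f g i j) (coef2_0 i j)). Qed.

Lemma const1 : fps2_const (1 : K) = 1. Proof. by []. Qed.

Lemma coef2constM c f i j : (fps2_const c * f) i j = c * f i j.
Proof.
rewrite coef2M big_ord_recl [X in _ + X]big1 => [|k _]; last first.
  by rewrite big1 // => l _; rewrite /= mul0r.
rewrite addr0 big_ord_recl [X in _ + X]big1 => [|k _]; last by rewrite /= mul0r.
by rewrite addr0 !subn0.
Qed.

Lemma rowsM p q :
  rows p * rows q = rows (fun n => \sum_(i < n.+1) p i * q (n - i)%N).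
Proof.
apply: fps2P => n m; rewrite coef2M /= coef_sum.
by apply: eq_bigr => i _; rewrite coefM.
Qed.

Lemma coef2XnM k f i j : (X ^+ k * f) i j = if (k <= i)%N then f (i - k)%N j else 0.
Proof.
elim: k f i => [|k IH] f i; first by rewrite expr0 mul1r subn0.
have XM g n m : (X * g) n m = if n is n'.+1 then g n' m else 0.
  rewrite coef2M; case: n => [|n].
    by rewrite big1 // => a _; rewrite big1 // => b _; case: a => -[]//= ?; rewrite mul0r.
  rewrite big_ord_recl big1 => [|b _]; last by rewrite /= mul0r.
  rewrite add0r big_ord_recl big_ord_recl big1 => [|b _]; last first.
    by rewrite /= /bump /= mul0r.
  rewrite big1 => [|a _]; last by rewrite big1 // => b _; rewrite /= /bump /= mul0r.
  by rewrite /= /bump /= mul1r !addr0 subSS !subn0.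
rewrite exprSr -mulrA IH XM; case: ifP => ki; last by rewrite ifF //; lia.
case E: (i - k)%N => [|d]; first by rewrite ifF //; lia.
by rewrite ifT; [congr (f _ _); lia|lia].
Qed.

Lemma coef2XM f i j : (X * f) i j = if i is i'.+1 then f i' j else 0.
Proof. by rewrite -[X]expr1 coef2XnM; case: i => //= i; rewrite subn1. Qed.

Lemma coef_swap f i j : swap f i j = f j i. Proof. by []. Qed.
Lemma swapK : involutive swap. Proof. by case. Qed.
Lemma swapD f g : swap (f + g) = swap f + swap g. Proof. exact: fps2P. Qed.
Lemma swapN f : swap (- f) = - swap f. Proof. exact: fps2P. Qed.
Lemma swapM f g : swap (f * g) = swap f * swap g.
Proof.
apply: fps2P => i j; rewrite [LHS]/= !coef2M exchange_big.
by apply: eq_bigr => a _; apply: eq_bigr => b _.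
Qed.
Lemma swap1 : swap 1 = 1.
Proof. by apply: fps2P => i j; rewrite /= andbC. Qed.
Lemma swapX : swap X = Y. Proof. by apply: fps2P => i j; rewrite /= andbC. Qed.
Lemma swapY : swap Y = X. Proof. by rewrite -swapX swapK. Qed.
Lemma swap0 : swap 0 = 0.
Proof. by apply: fps2P => i j; rewrite /= andbC. Qed.
Lemma swapXn f n : swap (f ^+ n) = swap f ^+ n.
Proof. by elim: n => [|n IH]; rewrite ?swap1 // !exprS swapM IH. Qed.

Lemma coef2YM f i j : (Y * f) i j = if j is j'.+1 then f i j' else 0.
Proof.
have -> : (Y * f) i j = (X * swap f) j i by rewrite -swapY -swapM.
by rewrite coef2XM.
Qed.

Lemma divX_divides f : divides X f <-> forall j, f 0%N j = 0.
Proof.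
split=> [[h ->] j|f0]; first by rewrite mulrC coef2XM.
exists (FPS2 (fun i j => f i.+1 j)); apply: fps2P => i j.
by rewrite mulrC coef2XM; case: i.
Qed.

Lemma coef2_congr f g i j : f = g -> f i j = g i j. Proof. by move=> ->. Qed.

Lemma mulXI n : injective (fun f => X ^+ n * f).
Proof.
move=> f g E; apply: fps2P => i j; move: (coef2_congr (n + i) j E).
by rewrite !coef2XnM leq_addr addKn.
Qed.

Lemma mulYI : injective (fun f => Y * f).
Proof.
move=> f g /= E; apply: (can_inj swapK); apply: (@mulXI 1).
by rewrite /= expr1 -swapY -!swapM E.
Qed.

Lemma div_xnK n f : (forall i j, (i < n)%N -> f i j = 0) -> X ^+ n * div_xn n f = f.
Proof.
move=> fn; apply: fps2P => i j; rewrite coef2XnM; case: ifP => ni /=; first by rewrite subnK.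
by rewrite fn //; lia.
Qed.

Lemma coef_hom f n j : (hpart f n)`_j = if (j <= n)%N then f (n - j)%N j else 0.
Proof. by rewrite coef_poly ltnS. Qed.
Lemma size_hom f n : (size (hpart f n) <= n.+1)%N. Proof. exact: size_poly. Qed.
Lemma homE f i j : (hpart f (i + j))`_j = f i j.
Proof. by rewrite coef_hom leq_addl addnK. Qed.
Lemma hom_inj f g : (forall n, hpart f n = hpart g n) -> f = g.
Proof. by move=> E; apply: fps2P => i j; rewrite -!homE E. Qed.
Lemma homD f g n : hpart (f + g) n = hpart f n + hpart g n.
Proof. by apply/polyP => j; rewrite coefD !coef_hom; case: ifP => _ //; rewrite addr0. Qed.
Lemma homN f n : hpart (- f) n = - hpart f n.
Proof. by apply/polyP => j; rewrite coefN !coef_hom; case: ifP => _ //; rewrite oppr0. Qed.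
Lemma hom0 n : hpart 0 n = 0.
Proof. by apply/polyP => j; rewrite coef_hom coef2_0 coef0 if_same. Qed.

Lemma homM f g n : hpart (f * g) n = \sum_(i < n.+1) hpart f i * hpart g (n - i)%N.
Proof.
apply/polyP => j; rewrite coef_sum coef_hom.
under [RHS]eq_bigr do rewrite coefM.
rewrite exchange_big /=; case: ifP => jn; last first.
  rewrite big1 // => b _; rewrite big1 // => d _; rewrite !coef_hom.
  case: ifP => bd; last by rewrite mul0r.
  by rewrite ifF ?mulr0 //; have := ltn_ord b; have := ltn_ord d; lia.
rewrite coef2M exchange_big /=; apply: eq_bigr => b _.
rewrite -[RHS](big_mkord xpredT (fun d => (hpart f d)`_b * (hpart g (n - d)%N)`_(j - b))).
(* A summand survives only for b <= d <= b + (n - j): below, degree d is too small for a coefficient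
   at b; above, n - d is too small for one at j - b. *)
have bj := ltn_ord b.
rewrite (big_cat_nat (n := b)) /=; [|lia|lia].
rewrite (big_cat_nat (n := (b + (n - j).+1)%N) (m := b)) /=; [|lia|lia].
have -> : \sum_(0 <= d < b) (hpart f d)`_b * (hpart g (n - d)%N)`_(j - b) = 0.
  rewrite big_nat big1 // => d /= db.
  by rewrite coef_hom ifF ?mul0r //; lia.
have -> : \sum_(b + (n - j).+1 <= d < n.+1) (hpart f d)`_b * (hpart g (n - d)%N)`_(j - b) = 0.
  rewrite big_nat big1 // => d /andP[db dn].
  by rewrite [X in _ * X]coef_hom [X in _ * X]ifF ?mulr0 //; lia.
rewrite add0r addr0 [in RHS](_ : \sum_(b <= d < b + (n - j).+1) _ = \sum_(0 + b <= d < b + (n - j).+1) (hpart f d)`_b * (hpart g (n - d)%N)`_(j - b)) // big_addn addKn big_mkord; apply: eq_bigr => a _.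
have an := ltn_ord a.
by rewrite !coef_hom ifT ?[in RHS]ifT; [congr (f _ _ * g _ _); lia|lia|lia].
Qed.

Lemma blE c f n j : bl c f n j = (hpart f n \Po ('X + c%:P))`_j. Proof. by []. Qed.

Lemma blM c f g : bl c (f * g) = bl c f * bl c g.
Proof.
rewrite rowsM; apply: fps2P => n j; rewrite /= homM raddf_sum /=.
by under eq_bigr do rewrite comp_polyM.
Qed.
Lemma blD c f g : bl c (f + g) = bl c f + bl c g.
Proof. by apply: fps2P => n j; rewrite coef2D !blE homD comp_polyD coefD. Qed.
Lemma blN c f : bl c (- f) = - bl c f.
Proof. by apply: fps2P => n j; rewrite coef2N !blE homN raddfN coefN. Qed.
Lemma blB c f g : bl c (f - g) = bl c f - bl c g. Proof. by rewrite blD blN. Qed.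
Lemma bl_inj c : injective (bl c).
Proof.
move=> f g E; apply: hom_inj => n.
have -> : hpart f n = (hpart f n \Po ('X + c%:P)) \Po ('X - c%:P).
  by rewrite -comp_polyA comp_polyD comp_polyX comp_polyC subrK comp_polyXr.
have -> : hpart g n = (hpart g n \Po ('X + c%:P)) \Po ('X - c%:P).
  by rewrite -comp_polyA comp_polyD comp_polyX comp_polyC subrK comp_polyXr.
by congr (_ \Po _); apply/polyP => j; move: (congr1 (fun h : fps2 K => h n j) E).
Qed.

Lemma homX n : hpart X n = (n == 1%N)%:R.
Proof.
apply/polyP => j; have -> : (n == 1%N)%:R = (n == 1%N)%:R%:P :> {poly K} by rewrite polyC_natr.
rewrite coef_hom coefC /=.
by case: n j => [|[|n]] [|[|j]] //=; rewrite ?andbF ?if_same.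
Qed.
Lemma homY n : hpart Y n = if n == 1%N then 'X else 0.
Proof.
apply/polyP => j; rewrite coef_hom /=.
by case: n j => [|[|n]] [|[|j]] //=; rewrite ?coefX ?coef0 //= ?if_same ?andbF ?if_same.
Qed.

Lemma blX c : bl c X = X.
Proof.
apply: fps2P => n j; rewrite blE homX; case: n => [|[|n]] /=;
  by rewrite ?rmorph1 ?rmorph0 ?coef2_1 ?coef0 ?coef1.
Qed.
Lemma blY c : bl c Y = X * (Y + fps2_const c).
Proof.
apply: fps2P => n j; rewrite blE homY coef2XM; case: n => [|[|n]] /=;
  rewrite ?rmorph0 ?coef0 // ?if_same ?addr0 //.
by rewrite comp_polyX coefD coefX coefC.
Qed.
Lemma bl1 c : bl c 1 = 1.
Proof.
by apply: (@mulXI 1); rewrite /= expr1 mulr1 -{1}(blX c) -blM mulr1 blX.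
Qed.
Lemma blXn c f n : bl c (f ^+ n) = bl c f ^+ n.
Proof. by elim: n => [|n IH]; rewrite ?bl1 // !exprS blM IH. Qed.

End SeriesBasics.

(** * Sequences defined by course-of-values recursion *)

Section StrongRecursion.
Variables (A : Type) (a0 : A) (F : nat -> (nat -> A) -> A).

(** The table of the first n values, filled with [a0] beyond. [F n] receives this table as a
    function, and [fixseqE] only asks that it look below n. Quotients and factors of series are
    built coefficient by coefficient in this way. *)
Fixpoint fixaux n : nat -> A :=
  if n is n'.+1 then fun m => if m == n' then F n' (fixaux n') else fixaux n' m
  else fun=> a0.
Definition fixseq n := fixaux n.+1 n.

Lemma fixauxE n m : (m < n)%N -> fixaux n m = fixseq m.
Proof.
elim: n => // n IH; rewrite ltnS leq_eqVlt => /predU1P[->//|mn].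
by rewrite /= ifF ?IH //; apply/eqP; lia.
Qed.

Lemma fixseqE n : (forall u v, (forall m, (m < n)%N -> u m = v m) -> F n u = F n v) ->
  fixseq n = F n fixseq.
Proof. by move=> FP; rewrite {1}/fixseq /= eqxx; apply: FP => m; apply: fixauxE. Qed.

End StrongRecursion.

Lemma leastP (P : nat -> Prop) : (exists n, P n) ->
  P (least P) /\ forall m, P m -> (least P <= m)%N.
Proof.
move=> exP; rewrite /least; case: xgetP => [_ _ //|noP].
have [n Pn] := exP.
case: (@ex_minnP (fun n => `[< P n >])) => [|m /asboolP Pm mmin]; first by exists n; apply/asboolP.
by case: (noP m); split=> // k Pk; apply: mmin; apply/asboolP.
Qed.

Lemma leastE (P : nat -> Prop) n : P n -> (forall m, P m -> (n <= m)%N) -> least P = n.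
Proof.
move=> Pn nP; have [Pl lP] := leastP (ex_intro _ n Pn).
by apply/eqP; rewrite eqn_leq lP // nP.
Qed.

(** * Weierstrass division *)

Section Division.
Variable K : fieldType.
Implicit Types (f g h u v : fps2 K) (c : K).
Notation X := (fps2_x K).

(** On x = 0 the series g starts at y^k, so the coefficient of x^i y^(k+j) in q g contains q i j
    with the nonzero factor g 0 k, and otherwise only earlier rows of q and earlier entries of row
    i. Agreement with h determines q entry by entry; the terms of degree below k in y go to r. *)
Lemma weierstrass_division g k h : (forall j, (j < k)%N -> g 0%N j = 0) -> g 0%N k != 0 ->
  exists q r, h = q * g + r /\ forall i j, (k <= j)%N -> r i j = 0.
Proof.
move=> g0 gk.
pose rowstep i (q : nat -> nat -> K) := fixseq 0 (fun j (s : nat -> K) =>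
  (h i (k + j)%N - \sum_(a < i) \sum_(b < (k + j).+1) q a b * g (i - a)%N (k + j - b)%N
   - \sum_(b < j) s b * g 0%N (k + j - b)%N) / g 0%N k).
pose qs := fixseq (fun=> 0) rowstep; pose q := FPS2 qs.
exists q, (h - q * g); split=> [|i j']; first by rewrite addrC subrK.
move=> /subnKC <-; set j := (j' - k)%N; move: j => {j'} j.
apply/eqP; rewrite coef2B subr_eq0 eq_sym; apply/eqP.
have -> : (q * g) i (k + j)%N = \sum_(a < i) \sum_(b < (k + j).+1) q a b * g (i - a)%N (k + j - b)%N
    + (\sum_(b < j) q i b * g 0%N (k + j - b)%N + q i j * g 0%N k).
  rewrite coef2M big_ord_recr /= subnn; congr (_ + _).
  rewrite -(big_mkord xpredT (fun b => qs i b * g 0%N (k + j - b)%N)).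
  rewrite (big_cat_nat (n := j.+1)) /=; [|lia|lia].
  rewrite [X in _ + X]big_nat [X in _ + X]big1 => [|b /andP[jb bk]]; last first.
    by rewrite [g _ _]g0 ?mulr0 //; lia.
  by rewrite addr0 big_nat_recr //= addnK big_mkord.
have -> : q i j = (h i (k + j)%N - \sum_(a < i) \sum_(b < (k + j).+1) q a b * g (i - a)%N (k + j - b)%N
   - \sum_(b < j) q i b * g 0%N (k + j - b)%N) / g 0%N k.
  have E : qs i = rowstep i qs.
    apply: fixseqE => s t st; rewrite /rowstep; congr fixseq.
    apply/funext => n; apply/funext => w; congr ((_ - _ - _) / _).
    by apply: eq_bigr => a _; apply: eq_bigr => b _; rewrite st.
  rewrite [LHS](_ : _ = rowstep i qs j); last by rewrite -E.
  rewrite /rowstep fixseqE; last first.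
    by move=> s t st; congr ((_ - _) / _); apply: eq_bigr => b _; rewrite st.
  by rewrite -/(rowstep i qs) -E.
by rewrite divfK //; ring.
Qed.

Lemma coef2_00M f g : (f * g) 0%N 0%N = f 0%N 0%N * g 0%N 0%N.
Proof. by rewrite coef2M !big_ord1. Qed.

(** The case k = 0 of Weierstrass division: no degree is left for a remainder, so 1 is a multiple of
    f. *)
Lemma unit_coef f : f \is a GRing.unit <-> f 0%N 0%N != 0.
Proof.
split=> [/unitrP[g [gf _]]|f0].
  move: (coef2_congr 0 0 gf); rewrite coef2_00M coef2_1 /= => /eqP.
  by apply: contraTneq => ->; rewrite mulr0 eq_sym oner_eq0.
have f00 : forall j, (j < 0)%N -> f 0%N j = 0 by [].
have [q [r [E rP]]] := weierstrass_division 1 f00 f0.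
have r0 : r = 0 by apply: fps2P => i j; rewrite rP // coef2_0.
have qf : q * f = 1 by rewrite E r0 addr0.
by apply/unitrP; exists q; split=> //; rewrite mulrC.
Qed.

Definition fps_order f m := (forall d, (d < m)%N -> hpart f d = 0) /\ hpart f m != 0.
Definition vanish f m := forall d, (d < m)%N -> hpart f d = 0.

Lemma vanishP f m : vanish f m <-> forall i j, (i + j < m)%N -> f i j = 0.
Proof.
split=> [fm i j ij|fm d dm]; first by rewrite -homE fm // coef0.
apply/polyP => j; rewrite coef_hom coef0; case: ifP => // jd.
by apply: fm; rewrite subnK.
Qed.

Lemma fps_order_ex f : f <> 0 -> exists m, fps_order f m.
Proof.
move=> f0; have [n fn] : exists n, hpart f n != 0.
  apply: contra_notP f0 => /forallNP fn; apply: hom_inj => n; rewrite hom0.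
  by apply/eqP; apply: contrapT => /negP; apply: fn.
case: (ex_minnP (ex_intro (fun n => hpart f n != 0) n fn)) => m fm mmin.
exists m; split=> // d dm; apply/eqP; apply: contraTT dm => fd.
by rewrite -leqNgt mmin.
Qed.

Lemma vanishM f g m n : vanish f m -> vanish g n -> vanish (f * g) (m + n).
Proof.
move=> fm gn d dmn; rewrite homM big1 // => i _.
have [im|mi] := ltnP i m; first by rewrite fm ?mul0r.
by rewrite gn ?mulr0 //; have := ltn_ord i; lia.
Qed.

Lemma homM_lead f g m n : vanish f m -> vanish g n -> hpart (f * g) (m + n) = hpart f m * hpart g n.
Proof.
move=> fm gn; have mn : (m < (m + n).+1)%N by lia.
rewrite homM (bigD1 (Ordinal mn)) //= addKn big1 ?addr0 // => i im.
have [im'|mi] := ltnP i m; first by rewrite fm ?mul0r.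
have {}im : (i : nat) != m by apply: contraNneq im => E; apply/eqP/val_inj.
by rewrite gn ?mulr0 //; have := ltn_ord i; lia.
Qed.

Lemma fps_orderM f g m n : fps_order f m -> fps_order g n -> fps_order (f * g) (m + n).
Proof.
move=> [fm f0] [gn g0]; split; first exact: vanishM.
by rewrite homM_lead // mulf_neq0.
Qed.

Lemma fps_order_nz f m : fps_order f m -> f <> 0.
Proof. by move=> [_ fm] f0; move: fm; rewrite f0 hom0 eqxx. Qed.

Lemma fps_order_coef f m : fps_order f m -> exists i j, (i + j)%N = m /\ f i j != 0.
Proof.
move=> [_ fm]; apply: contrapT => /forallNP nf; move/eqP: fm; apply.
apply/polyP => j; rewrite coef_hom coef0; case: ifP => // jm.
apply/eqP; apply: contrapT => /negP fj; apply: (nf (m - j)%N); exists j.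
by rewrite subnK.
Qed.

Lemma mult0_order f m : fps_order f m -> mult0 f = m.
Proof.
move=> fm; apply: leastE; first exact: fps_order_coef.
move=> n [i [j [<- fij]]]; rewrite leqNgt; apply: contra fij => ij.
by apply/eqP; apply: (vanishP f m).1 => //; case: fm.
Qed.

Lemma hom00 f : hpart f 0 = (f 0%N 0%N)%:P.
Proof. by apply/polyP => j; rewrite coef_hom coefC; case: j. Qed.

Lemma fps_order_gt0 f m : fps_order f m -> f 0%N 0%N = 0 -> (0 < m)%N.
Proof. by case: m => // -[_]; rewrite hom00 => /[swap] ->; rewrite eqxx. Qed.

Lemma fps_order0 f : f 0%N 0%N != 0 -> fps_order f 0.
Proof. by move=> f0; split=> //; rewrite hom00 polyC_eq0. Qed.

Lemma hom_swap f n j : (j <= n)%N -> (hpart (swap f) n)`_j = (hpart f n)`_(n - j)%N.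
Proof. by move=> jn; rewrite !coef_hom jn leq_subr subKn. Qed.

Lemma hom_swap_eq0 f n : hpart f n = 0 -> hpart (swap f) n = 0.
Proof.
move=> fn; apply/polyP => j; have [jn|nj] := leqP j n; first by rewrite hom_swap // fn !coef0.
by rewrite coef_hom ifF ?coef0 //; lia.
Qed.

Lemma vanish_swap f m : vanish f m -> vanish (swap f) m.
Proof. by move=> fm d /fm/hom_swap_eq0. Qed.

Lemma fps_order_swap f m : fps_order f m -> fps_order (swap f) m.
Proof.
move=> [fm f0]; split; first exact: vanish_swap.
by apply: contraNneq f0 => /hom_swap_eq0; rewrite swapK => ->.
Qed.

Lemma hom_of_hom (p : nat -> {poly K}) d : (size (p d) <= d.+1)%N -> hpart (of_hom p) d = p d.
Proof.
move=> pd; apply/polyP => j; rewrite coef_hom /=; case: ifP => jd; first by rewrite subnK.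
by rewrite nth_default //; apply: leq_trans pd _; lia.
Qed.

(** In [bl c f] the row of index d has degree at most d in y, and nothing else constrains it: each
    row of X^m F, shifted back by c, can serve as a homogeneous part. *)
Lemma blowdown c (F : fps2 K) m : (forall i j, (m + i < j)%N -> F i j = 0) ->
  exists f, bl c f = X ^+ m * F /\ vanish f m.
Proof.
move=> FP.
pose p d := if (d < m)%N then 0 else (\poly_(j < d.+1) F (d - m)%N j) \Po ('X - c%:P).
have sp d : (size (p d) <= d.+1)%N.
  rewrite /p; case: ifP => _; first by rewrite size_poly0.
  by rewrite size_comp_poly2 ?size_XsubC // size_poly.
exists (of_hom p); split=> [|d dm]; last by rewrite hom_of_hom // /p dm.
apply: fps2P => n j; rewrite blE coef2XnM hom_of_hom // /p; case: ifP => mn.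
  by rewrite raddf0 coef0 ifF //; lia.
rewrite -comp_polyA comp_polyB comp_polyX comp_polyC addrK comp_polyXr coef_poly.
by rewrite [RHS]ifT; last (by lia); case: ifP => // nj; rewrite FP //; lia.
Qed.

(* The degree in y of a factor is controlled by that of the product as soon as
   the other factor is y^k up to a constant along x = 0. *)
Lemma factor_degree (F G H : fps2 K) k l : F = G * H ->
  (forall i j, (k + l + i < j)%N -> F i j = 0) ->
  (forall i j, (k + i < j)%N -> G i j = 0) ->
  (forall j, (j < k)%N -> G 0%N j = 0) -> G 0%N k != 0 ->
  forall i j, (l + i < j)%N -> H i j = 0.
Proof.
move=> FE FP GP G0 Gk; elim/ltn_ind => i IH j lij.
have : F i (k + j)%N = 0 by apply: FP; lia.
have kj : (k < (k + j).+1)%N by lia.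
rewrite FE coef2M big_ord_recl /= [X in _ + X]big1 => [|a _]; last first.
  rewrite big1 // => b _; have := ltn_ord a; have := ltn_ord b; rewrite /bump /= => bkj ai.
  have [ab|ba] := ltnP (k + (1 + a)) b; first by rewrite GP ?mul0r.
  by rewrite IH ?mulr0 //; lia.
rewrite addr0 (bigD1 (Ordinal kj)) //= big1 => [|b bk]; last first.
  have {}bk : (b : nat) != k by apply: contraNneq bk => E; apply/eqP/val_inj.
  have [ltbk|lekb] := ltnP b k; first by rewrite G0 ?mul0r.
  by rewrite GP ?mul0r //; lia.
by move/eqP; rewrite addr0 subn0 addKn mulf_eq0 (negPf Gk) => /eqP.
Qed.

End Division.

(** * Strict transforms and branches *)

Section StrictTransforms.
Variable K : fieldType.
Implicit Types (f g h u v : fps2 K) (c : K) (d : direction K).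
Notation X := (fps2_x K).
Notation Y := (fps2_y K).

Lemma coef_YcX c k n m :
  ((Y + fps2_const c) ^+ k : fps2 K) n m = if n == 0%N then (('X + c%:P) ^+ k)`_m else 0.
Proof.
pose p k n : {poly K} := if n == 0%N then ('X + c%:P) ^+ k else 0.
have Yc : Y + fps2_const c = rows (p 1%N).
  apply: fps2P => -[|i] j; rewrite coef2D /p /=; last by rewrite coef0 addr0.
  by rewrite expr1 coefD coefX coefC.
suff -> : (Y + fps2_const c) ^+ k = rows (p k) by rewrite /= /p; case: eqP; rewrite ?coef0.
elim: k => [|k IH].
  by apply: fps2P => -[|i] j; rewrite coef2_1 /p /= ?coef0 // expr0 coef1.
rewrite exprS IH Yc rowsM; apply: fps2P => i j /=; congr (_`_ j).
rewrite big_ord_recl big1 ?addr0 => [|a _]; last by rewrite /p /= mul0r.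
by rewrite subn0 /p /=; case: eqP => _; rewrite ?mulr0 // expr1 exprS.
Qed.

Lemma bl_sum c f n :
  hpart f n \Po ('X + c%:P) = \sum_(j < n.+1) f (n - j)%N j *: ('X + c%:P) ^+ j.
Proof.
rewrite /hpart poly_def raddf_sum /=; apply: eq_bigr => j _.
by rewrite linearZ /= comp_Xn_poly.
Qed.

Lemma subst_some c f : subst f (blowup_x (Some c)) (blowup_y (Some c)) = bl c f.
Proof.
apply: fps2P => n m; rewrite blE bl_sum coef_sum substE exchange_big /= /blowup_x /blowup_y.
have E (i j : nat) : (X ^+ i * (X * (Y + fps2_const c)) ^+ j : fps2 K) n m =
    if (i + j == n)%N then (('X + c%:P) ^+ j)`_m else 0.
  rewrite exprMn mulrA -exprD coef2XnM coef_YcX.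
  case: (ltngtP (i + j)%N n) => [ij|ij|->]; rewrite ?subnn //.
  by rewrite [LHS]ifF //; lia.
rewrite [RHS](big_ord_widen (n + m).+1 (fun j => (f (n - j)%N j *: ('X + c%:P) ^+ j)`_m)); last by lia.
rewrite [RHS]big_mkcond; apply: eq_bigr => j _; rewrite ltnS.
case: leqP => jn.
  have nj : (n - j < (n + m).+1)%N by lia.
  rewrite (bigD1 (Ordinal nj)) //. rewrite /= E subnK // eqxx coefZ big1 ?addr0 // => i inj.
  rewrite E ifF ?mulr0 //; apply: contraNF inj => /eqP E'; apply/eqP/val_inj => /=; lia.
by rewrite big1 // => i _; rewrite E ifF ?mulr0 //; lia.
Qed.

Lemma bl0_swap f n m : bl 0 (swap f) n m = if (m <= n)%N then f m (n - m)%N else 0.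
Proof. by rewrite blE polyC0 addr0 comp_polyXr coef_hom. Qed.

Lemma subst_none f : subst f (@blowup_x K None) (blowup_y None) = bl 0 (swap f).
Proof.
apply: fps2P => n m; rewrite bl0_swap substE /blowup_x /blowup_y.
have E (i j : nat) : ((X * Y) ^+ i * X ^+ j : fps2 K) n m = ((i == m) && (j == n - m)%N && (m <= n)%N)%:R.
  rewrite exprMn mulrC mulrA -exprD coef2XnM.
  have Yi k l r : (Y ^+ k : fps2 K) l r = ((l == 0) && (r == k))%N%:R.
    elim: k l r => [|k IH] l r; first by rewrite expr0 coef2_1.
    by rewrite exprS coef2YM; case: r => [|r]; rewrite ?andbF // IH eqSS.
  by rewrite Yi; case: ifP => ij; [congr (nat_of_bool _)%:R|symmetry; apply: (congr1 (fun b : bool => b%:R) (_ : _ = false))]; lia.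
case: ifP => mn; last first.
  by rewrite big1 // => i _; rewrite big1 // => j _; rewrite E mn andbF mulr0.
have mN : (m < (n + m).+1)%N by lia.
have nN : (n - m < (n + m).+1)%N by lia.
rewrite (bigD1 (Ordinal mN)) //= [X in _ + X]big1 => [|i im]; last first.
  rewrite big1 // => j _; rewrite E (_ : (i == m :> nat) = false) ?mulr0 //.
  by apply: contraNF im => /eqP im; apply/eqP/val_inj.
rewrite addr0 (bigD1 (Ordinal nN)) //= E !eqxx mn mulr1 big1 ?addr0 // => j jn.
rewrite E (_ : (j == n - m :> nat)%N = false) ?andbF ?mulr0 //.
by apply: contraNF jn => /eqP im; apply/eqP/val_inj.
Qed.

(** The chart [None] is the chart [Some 0] after exchanging x and y. Together with [foliation_none],
    this lets statements about a direction be proved for [Some c] only. *)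
Lemma strict_none f : strict_transform f None = strict_transform (swap f) (Some 0).
Proof. by rewrite /strict_transform subst_none subst_some. Qed.

Lemma x_order1 g n : (forall i j, (i < n)%N -> g i j = 0) -> (exists j, g n j != 0) ->
  x_order [:: g] = n.
Proof.
move=> gn g0; apply: leastE; first by exists g => //; rewrite inE.
move=> m [h]; rewrite inE => /eqP -> [j gm].
by rewrite leqNgt; apply: contra gm => mn; rewrite gn.
Qed.

Lemma comp_poly_shift_eq0 (p : {poly K}) c : (p \Po ('X + c%:P) == 0) = (p == 0).
Proof.
apply/eqP/eqP => [E|->]; last by rewrite raddf0.
have -> : p = (p \Po ('X + c%:P)) \Po ('X - c%:P).
  by rewrite -comp_polyA comp_polyD comp_polyX comp_polyC subrK comp_polyXr.
by rewrite E raddf0.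
Qed.

Lemma poly_neq0_coef (p : {poly K}) : p != 0 -> exists j, p`_j != 0.
Proof. by move=> p0; exists (size p).-1; rewrite -/(lead_coef p) lead_coef_eq0. Qed.

Lemma bl_low c f m : vanish f m -> forall i j, (i < m)%N -> bl c f i j = 0.
Proof. by move=> fm i j im; rewrite blE fm // raddf0 coef0. Qed.

Lemma bl_lead c f m : hpart f m != 0 -> exists j, bl c f m j != 0.
Proof. by move=> fm; apply: poly_neq0_coef; rewrite comp_poly_shift_eq0. Qed.

Lemma strict_some c f m : fps_order f m ->
  strict_transform f (Some c) = rows (fun i => hpart f (i + m) \Po ('X + c%:P)).
Proof.
move=> [fm f0]; rewrite /strict_transform subst_some.
by rewrite (x_order1 (bl_low c fm) (bl_lead c f0)).
Qed.

Lemma strict_bl c f m : fps_order f m -> bl c f = X ^+ m * strict_transform f (Some c).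
Proof.
move=> fm; have [fm' f0] := fm; rewrite /strict_transform subst_some.
by rewrite (x_order1 (bl_low c fm') (bl_lead c f0)) div_xnK //; apply: bl_low.
Qed.

Lemma strict_row0 c f m j : fps_order f m ->
  strict_transform f (Some c) 0%N j = (hpart f m \Po ('X + c%:P))`_j.
Proof. by move=> /(strict_some c) ->. Qed.

Lemma strict_degree c f m : fps_order f m ->
  forall i j, (m + i < j)%N -> strict_transform f (Some c) i j = 0.
Proof.
move=> /(strict_some c) -> i j ij /=; rewrite nth_default //.
apply: leq_trans (_ : _ <= (i + m).+1)%N _; last by lia.
rewrite size_comp_poly2 ?size_hom //.
by rewrite -[c]opprK polyCN size_XsubC.
Qed.

Lemma passes_strict_some c f m : fps_order f m ->
  passes (strict_transform f (Some c)) <-> root (hpart f m) c.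
Proof.
move=> fm; rewrite /passes (strict_row0 _ _ fm) -horner_coef0 horner_comp !hornerE /root.
by split=> [->|/eqP].
Qed.

Lemma passes_strict_none f m : fps_order f m ->
  passes (strict_transform f None) <-> (hpart f m)`_m = 0.
Proof.
move=> fm; rewrite strict_none (passes_strict_some _ (fps_order_swap fm)) /root horner_coef0.
by rewrite hom_swap // subn0; split=> [/eqP|->].
Qed.

Definition nzx f := exists j, f 0%N j != 0.
Definition nzy f := exists i, f i 0%N != 0.

Lemma nzx_strict f d : f <> 0 -> nzx (strict_transform f d).
Proof.
wlog [c ->] : f d / exists c, d = Some c.
  case: d => [c|]; first by apply; exists c.
  move=> H f0; rewrite strict_none; apply: H; first by exists 0.
  by move=> /(congr1 (@swap K)); rewrite swapK swap0.
move=> /fps_order_ex[m fm]; have [_ f0] := fm.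
have [j fj] := bl_lead c f0; exists j; rewrite (strict_row0 _ _ fm) //.
Qed.

Lemma strict_some0_x f m i : fps_order f m -> strict_transform f (Some 0) i 0%N = f (i + m)%N 0%N.
Proof.
move=> fm; rewrite (strict_some _ fm) /= polyC0 addr0 comp_polyXr.
by rewrite coef_hom subn0.
Qed.

Lemma strict_none_x f m i : fps_order f m -> strict_transform f None i 0%N = f 0%N (i + m)%N.
Proof. by move=> fm; rewrite strict_none (strict_some0_x _ (fps_order_swap fm)). Qed.

Lemma nzy_strict_some0 f : nzy f -> nzy (strict_transform f (Some 0)).
Proof.
move=> [i fi]; have [m fm] : exists m, fps_order f m.
  by apply: fps_order_ex => f0; move: fi; rewrite f0 coef2_0 eqxx.
exists (i - m)%N; rewrite (strict_some0_x _ fm) subnK // leqNgt; apply: contra fi => im.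
by have [/vanishP -> //] := fm; rewrite addn0.
Qed.

Lemma nzy_strict_none f : nzx f -> nzy (strict_transform f None).
Proof. by rewrite strict_none => fx; apply: nzy_strict_some0. Qed.

Lemma nzx_neq0 f : nzx f -> f <> 0.
Proof. by move=> [j fj] f0; move: fj; rewrite f0 coef2_0 eqxx. Qed.

End StrictTransforms.

(** * Irreducible series and the splitting of the tangent cone *)

Section Branches.
Variable K : fieldType.
Implicit Types (f g h u v : fps2 K) (c : K) (d : direction K).
Notation X := (fps2_x K).

Lemma irreducible_passes f : irreducible_series f -> passes f.
Proof. by case=> /negP fU _; apply/eqP; apply: contra_notT fU => /unit_coef. Qed.

Lemma irreducible_neq0 f : irreducible_series f -> f <> 0.
Proof.
move=> [fU fI] f0; rewrite f0 in fI; have [] := fI 0 0; first by rewrite mulr0.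
all: by move/unit_coef; rewrite coef2_0 eqxx.
Qed.

Lemma irreducible_factor f g h : irreducible_series f -> f = g * h -> passes g -> same_curve f g.
Proof.
move=> [fU fI] fE g0; split; last by exists h; rewrite mulrC.
have [/unit_coef|hU] := fI _ _ fE; first by rewrite g0 eqxx.
by exists h^-1; rewrite fE mulrCA mulVr // mulr1.
Qed.

Lemma same_curve_refl f : same_curve f f.
Proof. by split; exists 1; rewrite mul1r. Qed.

Lemma same_curve_sym f g : same_curve f g -> same_curve g f.
Proof. by case. Qed.

Lemma divides_trans f g h : divides f g -> divides g h -> divides f h.
Proof. by move=> [a ->] [b ->]; exists (b * a); rewrite mulrA. Qed.

Lemma same_curve_trans f g h : same_curve f g -> same_curve g h -> same_curve f h.
Proof. by move=> [fg gf] [gh hg]; split; [apply: divides_trans gh|apply: divides_trans gf]. Qed.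

Lemma vanish_passes f m : (0 < m)%N -> vanish f m -> passes f.
Proof. by move=> m0 /vanishP; apply; rewrite addn0. Qed.

Lemma size_polyM (p q : {poly K}) : p != 0 -> q != 0 ->
  size (p * q)%R = (size p + size q).-1.
Proof. exact: size_mul. Qed.

Lemma size_polyM_leq (p q : {poly K}) : (size (p * q)%R <= (size p + size q).-1)%N.
Proof. exact: size_polyMleq. Qed.

(** Hensel lifting carried out in the blow-up: there f becomes a series in x with polynomial
    coefficients, and the two factors descend as soon as their coefficients of x^n have degree at
    most k + n and m - k + n. *)
Lemma hensel_splitting f m c k (h0 : {poly K}) : vanish f m -> (0 < k < m)%N ->
  hpart f m = ('X - c%:P) ^+ k * h0 -> ~~ root h0 c ->
  exists g h, [/\ f = g * h, passes g & passes h].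
Proof.
move=> fm /andP[k0 km] fE h0c; pose D : {poly K} := ('X - c%:P) ^+ k; rewrite -/D in fE *.
have [[u v] /= uv] : exists u : {poly K} * {poly K}, u.1 * h0 + u.2 * D = 1.
  by apply/Bezout_eq1_coprimepP; rewrite coprimep_expr // coprimep_XsubC.
have D0 : D != 0 by rewrite expf_neq0 // polyXsubC_eq0.
have sD : size D = k.+1 by rewrite size_exp_XsubC.
pose l := (m - k)%N.
(* Comparing coefficients of x^n leaves the equation g_n h0 + D h_n = [rest n]. The Bezout relation
   solves it, and reducing g_n modulo D keeps its degree below k, which in turn bounds the degree of
   h_n. *)
pose rest n (s : nat -> {poly K} * {poly K}) : {poly K} :=
  hpart f (m + n) - \sum_(1 <= a < n) (s a).1 * (s (n - a)%N).2.
pose step n (s : nat -> {poly K} * {poly K}) : {poly K} * {poly K} := if n == 0%N then (D, h0) else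
  let g := (u * rest n s) %% D in (g, (rest n s - g * h0) %/ D).
pose s : nat -> {poly K} * {poly K} := fixseq (0, 0) step.
have sE n : s n = step n s.
  apply: fixseqE => s1 s2 s12; rewrite /step; case: eqP => // n0.
  suff -> : rest n s1 = rest n s2 by [].
  congr (_ - _); rewrite big_nat [RHS]big_nat; apply: eq_bigr => a an.
  by rewrite !s12 //; lia.
pose g n := (s n).1; pose h n := (s n).2.
have g0E : g 0%N = D by rewrite /g sE.
have h0E : h 0%N = h0 by rewrite /h sE.
have gE n : (0 < n)%N -> g n = (u * rest n s) %% D.
  by rewrite /g sE /step; case: n.
have hE n : (0 < n)%N -> D * h n = rest n s - g n * h0.
  move=> n0; have -> : h n = (rest n s - g n * h0) %/ D by rewrite /h /g sE /step; case: n n0.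
  rewrite mulrC divpK // gE //; set r := rest n s.
  have -> : r - (u * r) %% D * h0 = D * (r * v + (u * r) %/ D * h0).
    have -> : (u * r) %% D = u * r - (u * r) %/ D * D.
      by apply/esym/eqP; rewrite subr_eq addrC -divp_eq.
    by rewrite -{1}[r]mulr1 -uv; ring.
  exact: dvdp_mulr.
have sizes n : (size (g n) <= k + n.+1)%N /\ (size (h n) <= l + n.+1)%N.
  elim/ltn_ind: n => n IH; case: (posnP n) => [->|n0].
    rewrite g0E h0E sD; split; first by lia.
    have [->|h00] := eqVneq h0 0; first by rewrite size_poly0.
    have : (size (D * h0)%R <= m.+1)%N by rewrite -fE size_hom.
    by rewrite size_polyM // sD /l; lia.
  have sg : (size (g n) <= k)%N by rewrite gE // -ltnS -sD ltn_modp.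
  split; first by lia.
  have [->|hn0] := eqVneq (h n) 0; first by rewrite size_poly0.
  suff : (size (D * h n)%R <= m + n.+1)%N by rewrite size_polyM // sD /l; lia.
  rewrite hE // /rest -addrA (leq_trans (size_polyD _ _)) // geq_max.
  rewrite (leq_trans (size_hom _ _)) ?addnS //= -opprD size_polyN.
  rewrite (leq_trans (size_polyD _ _)) // geq_max; apply/andP; split.
    rewrite big_nat; apply: (leq_trans (size_sum _ _ _)); apply/bigmax_leqP_seq => a _ an.
    apply: (leq_trans (size_polyM_leq _ _)).
    have [ga ha] := (IH a ltac:(lia), IH (n - a)%N ltac:(lia)).
    by move: ga.1 ha.2; rewrite /g /h /l; lia.
  apply: (leq_trans (size_polyM_leq _ _)).
  by have := (IH 0%N n0).2; rewrite h0E /l; lia.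
pose F := rows (fun i => hpart f (i + m)).
have blF : bl 0 f = X ^+ m * F.
  apply: fps2P => i j; rewrite blE polyC0 addr0 comp_polyXr coef2XnM /=.
  by case: ifP => mi; [rewrite subnK|rewrite fm ?coef0 //; lia].
have FGH : F = rows g * rows h.
  rewrite rowsM; apply: fps2P => i j /=; congr (_`_ j); rewrite addnC.
  case: (posnP i) => [->|i0]; first by rewrite big_ord1 addn0 fE subn0 g0E h0E.
  have -> : hpart f (m + i) = rest i s + \sum_(1 <= a < i) g a * h (i - a)%N by rewrite /rest subrK.
  rewrite -[rest i s](subrK (g i * h0)) -hE //.
  rewrite -(big_mkord xpredT (fun a => g a * h (i - a)%N)) big_nat_recl // subn0.
  rewrite -(big_add1 _ _ 0 i.+1 xpredT (fun a => g a * h (i - a)%N)) /=.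
  case: i i0 => // i _; rewrite [in RHS]big_nat_recr //= subnn g0E h0E.
  by rewrite -addrA [g i.+1 * h0 + _]addrC.
have deg p (q : nat -> {poly K}) : (forall n, size (q n) <= p + n.+1)%N ->
    forall i j, (p + i < j)%N -> rows q i j = 0.
  by move=> qs i j ij /=; rewrite nth_default // (leq_trans (qs i)) //; lia.
have [g' [gE' g'k]] := blowdown 0 (deg _ _ (fun n => (sizes n).1)).
have [h' [hE' h'l]] := blowdown 0 (deg _ _ (fun n => (sizes n).2)).
exists g', h'; split.
- apply: (@bl_inj _ 0); rewrite blM gE' hE' blF FGH.
  by rewrite mulrACA -exprD /l subnKC // ltnW.
- exact: vanish_passes g'k.
- by apply: vanish_passes h'l; rewrite /l; lia.
Qed.

End Branches.

(** * Branches followed along infinitely near points *)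

Section InfinitelyNear.
Variable K : numClosedFieldType.
Implicit Types (f g h u v : fps2 K) (c : K) (d : direction K).
Notation X := (fps2_x K).
Notation Y := (fps2_y K).

(** The intersection number of {f = 0} with the line x = 0 at the origin. *)
Definition yorder f k := (forall j, (j < k)%N -> f 0%N j = 0) /\ f 0%N k != 0.

Lemma coef2_row0M f g n : (f * g) 0%N n = \sum_(j < n.+1) f 0%N j * g 0%N (n - j)%N.
Proof. by rewrite coef2M big_ord1. Qed.

Lemma row0M_lead f g k l : (forall j, (j < k)%N -> f 0%N j = 0) ->
  (forall j, (j < l)%N -> g 0%N j = 0) -> (f * g) 0%N (k + l)%N = f 0%N k * g 0%N l.
Proof.
move=> fk gl; have kl : (k < (k + l).+1)%N by lia.
rewrite coef2_row0M (bigD1 (Ordinal kl)) //= addKn big1 ?addr0 // => i ik.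
have [{}ik|ki] := ltnP i k; first by rewrite fk ?mul0r.
have {}ik : (i : nat) != k by apply: contraNneq ik => E; apply/eqP/val_inj.
by rewrite gl ?mulr0 //; have := ltn_ord i; lia.
Qed.

Lemma row0M_low f g l : (forall j, (j < l)%N -> g 0%N j = 0) ->
  forall j, (j < l)%N -> (f * g) 0%N j = 0.
Proof. by move=> gl j jl; rewrite coef2_row0M big1 // => i _; rewrite gl ?mulr0 //; lia. Qed.

Lemma yorder_ex f : nzx f -> exists k, yorder f k.
Proof.
move=> fx; case: (ex_minnP fx) => k fk kmin; exists k; split=> // j jk.
by apply/eqP; apply: contraTT jk => fj; rewrite -leqNgt kmin.
Qed.

Lemma yorder_unique f k l : yorder f k -> yorder f l -> k = l.
Proof.
move=> [fk f0] [fl f0']; apply/eqP; rewrite eqn_leq; apply/andP; split.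
  by rewrite leqNgt; apply: contra f0' => ?; rewrite fk.
by rewrite leqNgt; apply: contra f0 => ?; rewrite fl.
Qed.

Lemma yorderM f g k l : yorder f k -> yorder g l -> yorder (f * g) (k + l).
Proof.
move=> [fk f0] [gl g0]; split; last by rewrite row0M_lead // mulf_neq0.
move=> j jkl; rewrite coef2_row0M big1 // => i _.
have [{}ik|ki] := ltnP i k; first by rewrite fk ?mul0r.
by rewrite gl ?mulr0 //; have := ltn_ord i; lia.
Qed.

Lemma nzxM f g : nzx (f * g) -> nzx f /\ nzx g.
Proof.
move=> [j fgj]; split; apply: contrapT => /forallNP fN; move: fgj;
  rewrite coef2_row0M big1 ?eqxx // => i _.
  by have /negP := fN i; rewrite negbK => /eqP ->; rewrite mul0r.
by have /negP := fN (j - i)%N; rewrite negbK => /eqP ->; rewrite mulr0.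
Qed.

(** The tangent cone is the line of direction d counted m times; at x = 1, a multiple of x^m becomes
    a constant. *)
Definition pure_cone d f m := if d is Some c
  then exists2 a : K, a != 0 & hpart f m = a *: ('X - c%:P) ^+ m
  else exists2 a : K, a != 0 & hpart f m = a%:P.

(** A root of multiplicity k < m would split f by [hensel_splitting]. A cone without roots is
    constant, that is, a multiple of x^m. *)
Lemma cone_irreducible f m : irreducible_series f -> fps_order f m ->
  exists d, pure_cone d f m.
Proof.
move=> fI fm; have m0 := fps_order_gt0 fm (irreducible_passes fI); have [fv f0] := fm.
have [s1|s1] := leqP (size (hpart f m)) 1.
  exists None, (hpart f m)`_0; last exact: size1_polyC.
  by rewrite -polyC_eq0 -size1_polyC.
have [c fc] : exists c, root (hpart f m) c by apply/closed_rootP; apply: contraL s1 => /eqP ->.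
have [k [h0 h0c fE]] := multiplicity_XsubC (hpart f m) c; rewrite f0 /= in h0c.
have k0 : (0 < k)%N.
  by rewrite lt0n; apply: contraTneq fc => k0; rewrite fE k0 expr0 mulr1.
have h00 : h0 != 0 by apply: contraNneq h0c => ->; rewrite root0.
have sh : (k + size h0 <= m.+1)%N.
  have := size_hom f m; rewrite fE size_polyM // ?expf_neq0 ?polyXsubC_eq0 //.
  by rewrite size_exp_XsubC addnS /= addnC.
have [km|mk] := ltnP k m.
  have [|g [h [fgh gp hp]]] := hensel_splitting fv _ (etrans fE (mulrC _ _)) h0c.
    by rewrite k0.
  have [] := fI.2 _ _ fgh; by move/unit_coef; rewrite ?gp ?hp eqxx.
have sh1 : size h0 = 1%N by have := h00; rewrite -size_poly_gt0; lia.
have kE : k = m by lia.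
exists (Some c), h0`_0; first by rewrite -polyC_eq0 -size1_polyC ?sh1.
by rewrite fE kE [in LHS](size1_polyC (_ : size h0 <= 1)%N) ?sh1 // mul_polyC.
Qed.

Lemma strict_pure c f m : fps_order f m -> pure_cone (Some c) f m ->
  yorder (strict_transform f (Some c)) m.
Proof.
move=> fm [a a0 fE].
have E j : strict_transform f (Some c) 0%N j = a * (j == m)%:R.
  rewrite (strict_row0 _ _ fm) fE comp_polyZ coefZ rmorphXn /= comp_polyB comp_polyX.
  by rewrite comp_polyC addrK coefXn.
by split=> [j jm|]; rewrite E ?eqxx ?mulr1 // ltn_eqF ?mulr0.
Qed.

Lemma pure_passes d d' f m : fps_order f m -> (0 < m)%N -> pure_cone d f m ->
  passes (strict_transform f d') <-> d' = d.
Proof.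
move=> fm m0; case: d => [c|] /= [a a0 fE].
  case: d' => [c'|].
    rewrite (passes_strict_some _ fm) fE rootZ //; case: m m0 {fm fE} => // m _.
    by rewrite root_exp_XsubC; split=> [/eqP->|[->]].
  rewrite (passes_strict_none fm) fE coefZ.
  have -> : (('X - c%:P) ^+ m)`_m = 1.
    by have /monicP := monic_exp m (monicXsubC c); rewrite lead_coefE size_exp_XsubC.
  by split=> //; rewrite mulr1 => /eqP; rewrite (negPf a0).
case: d' => [c'|].
  by rewrite (passes_strict_some _ fm) fE rootC (negPf a0); split.
by rewrite (passes_strict_none fm) fE coefC gtn_eqF.
Qed.

Lemma strict_passes f d : f <> 0 -> passes (strict_transform f d) -> passes f.
Proof.
move=> f0; have [m fm] := fps_order_ex f0.
case: (posnP m) => [m0|m0]; last first.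
  by move=> _; have [fv _] := fm; apply: vanish_passes fv.
rewrite m0 in fm; case: d => [c|].
  by rewrite (passes_strict_some _ fm) hom00 rootC => /eqP.
by rewrite (passes_strict_none fm) hom00 coefC.
Qed.

Lemma irreducible_swap f : irreducible_series f -> irreducible_series (swap f).
Proof.
have U g : g \is a GRing.unit <-> swap g \is a GRing.unit by rewrite !unit_coef.
move=> [fU fI]; split; first by apply/negP => /U; rewrite swapK; apply/negP.
move=> g h E; have [||] := fI (swap g) (swap h); first by rewrite -swapM -E swapK.
  by move=> /U; rewrite swapK; left.
by move=> /U; rewrite swapK; right.
Qed.

Lemma divides_swap f g : divides f g <-> divides (swap f) (swap g).
Proof.
split=> [[h ->]|[h E]]; exists (swap h); first by rewrite swapM.
by rewrite -[g]swapK E swapM swapK.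
Qed.

Lemma same_curve_swap f g : same_curve (swap f) (swap g) -> same_curve f g.
Proof. by move=> [fg gf]; split; apply/divides_swap. Qed.

(** A factorization into nonunits upstairs is made to descend: replacing one factor by its
    Weierstrass polynomial bounds its degree in y, [factor_degree] then bounds the cofactor, and
    [blowdown] turns both into nonunit factors of f. *)
Lemma strict_irreducible f d : irreducible_series f -> passes (strict_transform f d) ->
  irreducible_series (strict_transform f d).
Proof.
wlog [c ->] : f d / exists c, d = Some c.
  case: d => [c|]; first by apply; exists c.
  rewrite strict_none => H fI; apply: H; first by exists 0.
  exact: irreducible_swap.
move=> fI; have f0 := irreducible_neq0 fI; have [m fm] := fps_order_ex f0.
have m0 := fps_order_gt0 fm (irreducible_passes fI).
have [d' fd] := cone_irreducible fI fm.
move=> /[dup] Fp /(pure_passes _ fm m0 fd) dE; rewrite -dE in fd => {d' dE}.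
have Fm := strict_pure fm fd; set F := strict_transform f (Some c) in Fm Fp *.
split; first by apply/negP => /unit_coef; rewrite Fp eqxx.
move=> g h Fgh; apply: contrapT => /not_orP[gU hU].
have {gU}gp : passes g by apply/eqP; apply: contra_notT gU => /unit_coef.
have {hU}hp : passes h by apply/eqP; apply: contra_notT hU => /unit_coef.
have [] := @nzxM g h; first by rewrite -Fgh; exists m; case: Fm.
move=> /yorder_ex[k gk] /yorder_ex[l hl].
have mE : m = (k + l)%N.
  by apply: yorder_unique Fm _; rewrite Fgh; apply: yorderM.
have pos n u : yorder u n -> passes u -> (0 < n)%N.
  by case: n => // -[_ u0] u00; move: u0; rewrite u00 eqxx.
have [k0 l0] := (pos _ _ gk gp, pos _ _ hl hp).
(* [q * g] is the Weierstrass polynomial of g: y^k minus a series of degree below k in y. The factor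
   q is a unit because g and y^k have the same order on x = 0. *)
have [q [r [Yk rk]]] := weierstrass_division (Y ^+ k) gk.1 gk.2.
have coefYk i j : (Y ^+ k : fps2 K) i j = ((i == 0) && (j == k))%N%:R.
  elim: k i j {gk mE k0 Yk rk} => [|k IH] i j; first by rewrite expr0 coef2_1.
  by rewrite exprS coef2YM; case: j => [|j]; rewrite ?andbF // IH eqSS.
have G0 j : (j < k)%N -> (q * g) 0%N j = 0 by apply: row0M_low; case: gk.
have Gk : (q * g) 0%N k = 1.
  by move: (coef2_congr 0 k Yk); rewrite coefYk !eqxx coef2D rk // addr0 => <-.
have q0 : q \is a GRing.unit.
  apply/unit_coef; move: Gk; rewrite -[X in _ _ X = 1]add0n row0M_lead //; last by case: gk.
  by move=> /eqP; apply: contraTneq => ->; rewrite mul0r eq_sym oner_eq0.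
have FE : F = (q * g) * (q^-1 * h) by rewrite mulrACA mulrV // mul1r.
have Gdeg i j : (k + i < j)%N -> (q * g) i j = 0.
  move=> kij; have -> : q * g = Y ^+ k - r by rewrite Yk addrK.
  by rewrite coef2B coefYk rk ?subr0; [rewrite (gtn_eqF (_ : k < j)%N) ?andbF //; lia|lia].
have Fdeg i j : (k + l + i < j)%N -> F i j = 0 by rewrite -mE; apply: (strict_degree c fm).
have Gk0 : (q * g) 0%N k != 0 by rewrite Gk oner_eq0.
have Hdeg := factor_degree FE Fdeg Gdeg G0 Gk0.
have [g' [gE g'k]] := blowdown c Gdeg.
have [h' [hE h'l]] := blowdown c Hdeg.
have fE : f = g' * h'.
  apply: (@bl_inj _ c); rewrite blM gE hE (strict_bl c fm) -/F FE mE.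
  by rewrite exprD mulrACA.
have [] := fI.2 _ _ fE => /unit_coef.
  by rewrite (vanish_passes k0 g'k) eqxx.
by rewrite (vanish_passes l0 h'l) eqxx.
Qed.

(** The transforms have orders m and k, the multiplicities of f and g, on the exceptional line. So
    their quotient satisfies the degree condition of [blowdown] and comes from a quotient of f by g,
    while f is irreducible. *)
Lemma strict_same f g d : irreducible_series f -> irreducible_series g ->
  passes (strict_transform f d) -> passes (strict_transform g d) ->
  divides (strict_transform g d) (strict_transform f d) -> same_curve f g.
Proof.
wlog [c ->] : f g d / exists c, d = Some c.
  case: d => [c|]; first by apply; exists c.
  rewrite !strict_none => H fI gI fp gp fg; apply: same_curve_swap.
  apply: (H (swap f) (swap g) (Some 0)) fp gp fg; first by exists 0.
    exact: irreducible_swap.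
  exact: irreducible_swap.
move=> fI gI; have [m fm] := fps_order_ex (irreducible_neq0 fI).
have [k gk] := fps_order_ex (irreducible_neq0 gI).
have m0 := fps_order_gt0 fm (irreducible_passes fI).
have k0 := fps_order_gt0 gk (irreducible_passes gI).
have [d1 fd] := cone_irreducible fI fm; have [d2 gd] := cone_irreducible gI gk.
move=> /(pure_passes _ fm m0 fd) d1E /(pure_passes _ gk k0 gd) d2E.
rewrite -d1E in fd; rewrite -d2E in gd => {d1 d2 d1E d2E}.
have Fm := strict_pure fm fd; have Gk := strict_pure gk gd.
move=> [u FE]; rewrite mulrC in FE.
have km : (k <= m)%N.
  rewrite leqNgt; apply: contra Fm.2 => mk; rewrite FE mulrC; apply/eqP; exact: row0M_low Gk.1 _ mk.
have Fdeg i j : (k + (m - k) + i < j)%N -> strict_transform f (Some c) i j = 0.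
  by rewrite subnKC //; apply: (strict_degree c fm).
have := factor_degree FE Fdeg (strict_degree c gk) Gk.1 Gk.2.
move=> /(@blowdown _ c)[U [UE _]].
apply: (@irreducible_factor _ f g U) => //; last exact: irreducible_passes.
apply: (@bl_inj _ c); rewrite blM UE (strict_bl c fm) (strict_bl c gk) FE.
by rewrite mulrACA -exprD subnKC.
Qed.

Lemma curve_at_rcons f q d : curve_at f (rcons q d) = strict_transform (curve_at f q) d.
Proof. by rewrite /curve_at foldl_rcons. Qed.

Lemma curve_at_neq0 f q : f <> 0 -> curve_at f q <> 0.
Proof.
move=> f0; elim/last_ind: q => // q d IH; rewrite curve_at_rcons.
exact/nzx_neq0/nzx_strict.
Qed.

Lemma curve_at_passes f q d : f <> 0 -> passes (curve_at f (rcons q d)) -> passes (curve_at f q).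
Proof. by move=> f0; rewrite curve_at_rcons; apply/strict_passes/curve_at_neq0. Qed.

Lemma curve_at_irreducible f q : irreducible_series f -> passes (curve_at f q) ->
  irreducible_series (curve_at f q).
Proof.
move=> fI; elim/last_ind: q => // q d IH /[dup] /(curve_at_passes (irreducible_neq0 fI)) /IH.
by rewrite curve_at_rcons; apply: strict_irreducible.
Qed.

Lemma curve_at_same f g q : irreducible_series f -> irreducible_series g ->
  passes (curve_at f q) -> passes (curve_at g q) ->
  same_curve (curve_at f q) (curve_at g q) -> same_curve f g.
Proof.
move=> fI gI; elim/last_ind: q => // q d IH.
move=> /[dup] /(curve_at_passes (irreducible_neq0 fI)) fq + /[dup] /(curve_at_passes (irreducible_neq0 gI)) gq.
rewrite !curve_at_rcons => fd gd [_ fg]; apply: IH => //.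
by apply: strict_same fd gd fg; apply: curve_at_irreducible.
Qed.

End InfinitelyNear.

(** * Noether's inequality *)

Section Codimension.
Variable K : fieldType.
Implicit Types (f g h u v z : fps2 K) (U V W : fps2 K -> Prop) (c : K).
Notation X := (fps2_x K).
Notation Y := (fps2_y K).
Notation C := (@fps2_const K).

Lemma constD a b : C (a + b) = C a + C b.
Proof. by apply: fps2P => i j /=; case: ifP; rewrite ?addr0. Qed.
Lemma const0 : C 0 = 0. Proof. by []. Qed.
Lemma constN a : C (- a) = - C a.
Proof. by apply: fps2P => i j /=; case: ifP; rewrite ?oppr0. Qed.
Lemma constM a b : C (a * b) = C a * C b.
Proof. by apply: fps2P => i j; rewrite coef2constM /=; case: ifP; rewrite ?mulr0. Qed.

Definition subspace U :=
  U 0 /\ forall a f g, U f -> U g -> U (C a * f + g).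

Lemma subspaceD U f g : subspace U -> U f -> U g -> U (f + g).
Proof. by move=> [_ UD] Uf Ug; rewrite -[f]mul1r; apply: UD. Qed.
Lemma subspaceZ U a f : subspace U -> U f -> U (C a * f).
Proof. by move=> [U0 UD] Uf; rewrite -[_ * _]addr0; apply: UD. Qed.
Lemma subspaceN U f : subspace U -> U f -> U (- f).
Proof. by move=> US Uf; rewrite -mulN1r -(constN 1); apply: subspaceZ. Qed.
Lemma subspaceB U f g : subspace U -> U f -> U g -> U (f - g).
Proof. by move=> US Uf Ug; apply: subspaceD => //; apply: subspaceN. Qed.

Definition lincomb n (a : 'I_n -> K) (e : 'I_n -> fps2 K) := \sum_i C (a i) * e i.

Lemma coef_lincomb n (a : 'I_n -> K) e i j : lincomb a e i j = \sum_k a k * e k i j.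
Proof. by rewrite coef2_sum; apply: eq_bigr => k _; rewrite coef2constM. Qed.

Lemma swap_lincomb n (a : 'I_n -> K) e : swap (lincomb a e) = lincomb a (fun i => swap (e i)).
Proof. by apply: fps2P => i j; rewrite coef_swap !coef_lincomb. Qed.

Lemma subspace_lincomb U n (a : 'I_n -> K) e : subspace U -> (forall i, U (e i)) -> U (lincomb a e).
Proof.
move=> US eU; apply: (big_ind U); first by case: US.
  by move=> f g; apply: subspaceD.
by move=> i _; apply: subspaceZ.
Qed.

(* dim (V + U) / U >= n *)
Definition codim_ge U V n := exists2 e : 'I_n -> fps2 K, forall i, V (e i) &
  forall a, U (lincomb a e) -> forall i, a i = 0.

Lemma codim_geW U U' V V' n : (forall z, U' z -> U z) -> (forall z, V z -> V' z) ->
  codim_ge U V n -> codim_ge U' V' n.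
Proof. by move=> UU VV [e eV eI]; exists e => [i|a /UU]; [apply: VV|apply: eI]. Qed.

Lemma codim_ge_cat U V W a b : subspace V -> (forall z, U z -> V z) -> (forall z, V z -> W z) ->
  codim_ge U V a -> codim_ge V W b -> codim_ge U W (a + b).
Proof.
move=> VS UV VW [e eV eI] [e' eW' eI'].
exists (fun i => match split i with inl j => e j | inr j => e' j end) => [i|s sU].
  by case: split => j; [apply: VW|].
pose s1 j := s (lshift b j); pose s2 j := s (rshift a j).
have E : lincomb s (fun i => match split i with inl j => e j | inr j => e' j end)
    = lincomb s1 e + lincomb s2 e'.
  rewrite /lincomb big_split_ord; congr (_ + _); apply: eq_bigr => i _.
    by case: splitP => [j E|j /= E]; [rewrite (_ : i = j) //; apply/val_inj|have := ltn_ord i; lia].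
  by case: splitP => [j /= E|j /= /addnI E]; [have := ltn_ord j; lia|rewrite (_ : i = j) //; apply/val_inj].
rewrite E in sU.
have s20 : forall i, s2 i = 0.
  apply: eI'; rewrite -[lincomb s2 e'](addKr (lincomb s1 e)) addrC.
  by apply: subspaceB => //; [apply: UV|apply: subspace_lincomb].
have s10 : forall i, s1 i = 0.
  apply: eI; move: sU; rewrite [X in _ + X]big1 ?addr0 // => i _.
  by rewrite s20 const0 mul0r.
by move=> i; rewrite -(splitK i); case: split => j; [apply: s10|apply: s20].
Qed.

Lemma lincomb_lift n (k : 'I_n.+1) (a : 'I_n -> K) e :
  lincomb (fun i => if unlift k i is Some j then a j else 0) e = lincomb a (e \o lift k).
Proof.
rewrite /lincomb (bigD1_ord k) //= unlift_none const0 mul0r add0r.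
by apply: eq_bigr => i _; rewrite liftK.
Qed.

Lemma lincombD n (a b : 'I_n -> K) e : lincomb (fun i => a i + b i) e = lincomb a e + lincomb b e.
Proof. by rewrite /lincomb -big_split; apply: eq_bigr => i _; rewrite constD mulrDl. Qed.
Lemma lincombZ n c (a : 'I_n -> K) e : lincomb (fun i => c * a i) e = C c * lincomb a e.
Proof. by rewrite /lincomb mulr_sumr; apply: eq_bigr => i _; rewrite constM mulrA. Qed.

Definition add_line v U z := exists a, U (z - C a * v).

Lemma subspace_add_line v U : subspace U -> subspace (add_line v U).
Proof.
move=> [U0 UD]; split; first by exists 0; rewrite const0 mul0r subr0.
move=> a f g [b Uf] [b' Ug]; exists (a * b + b').
have -> : C a * f + g - C (a * b + b') * v = C a * (f - C b * v) + (g - C b' * v).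
  by rewrite constD constM; ring.
exact: UD.
Qed.

(** An exchange argument: either omitting the first vector works, or the other vectors satisfy a
    relation modulo U and v with a nonzero coefficient at some i, and then the vector at i is
    omitted instead. *)
Lemma codim_ge_add_line v U V n : subspace U -> codim_ge U V n.+1 -> codim_ge (add_line v U) V n.
Proof.
move=> US [e eV eI]; apply: contrapT => noV.
have [a [[b Ua] [i ai]]] : exists a, add_line v U (lincomb a (e \o lift ord0)) /\ exists i, a i <> 0.
  apply: contra_notP noV => /forallNP H; exists (e \o lift ord0) => [i|a Ua i]; first exact: eV.
  by apply: contrapT => ai; apply: (H a); split=> //; exists i.
apply: noV; exists (e \o lift (lift ord0 i)) => [j|a' [b' Ua']]; first exact: eV.
pose ext (k : 'I_n.+1) (s : 'I_n -> K) (j : 'I_n.+1) : K := if unlift k j is Some j' then s j' else 0.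
have b'0 : b' = 0.
  have /eI/(_ (lift ord0 i)) : U (lincomb
      (fun j => b * ext (lift ord0 i) a' j + (- b') * ext ord0 a j) e).
    rewrite lincombD !lincombZ !lincomb_lift.
    have -> : C b * lincomb a' (e \o lift (lift ord0 i)) + C (- b') * lincomb a (e \o lift ord0) =
      C b * (lincomb a' (e \o lift (lift ord0 i)) - C b' * v)
      + C (- b') * (lincomb a (e \o lift ord0) - C b * v) by rewrite constN; ring.
    by case: (US) => _; apply => //; apply: subspaceZ.
  rewrite /ext unlift_none liftK mulr0 add0r mulNr => /eqP.
  by rewrite oppr_eq0 mulf_eq0 => /orP[/eqP//|/eqP].
move: Ua'; rewrite b'0 const0 mul0r subr0 -lincomb_lift => /eI a'0 j.
by have := a'0 (lift (lift ord0 i) j); rewrite liftK.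
Qed.

Fixpoint add_span (s : seq (fps2 K)) U : fps2 K -> Prop :=
  if s is v :: s' then add_line v (add_span s' U) else U.

Lemma subspace_add_span s U : subspace U -> subspace (add_span s U).
Proof. by move=> US; elim: s => //= v s; apply: subspace_add_line. Qed.

Lemma codim_ge_add_span s U V n : subspace U -> codim_ge U V (size s + n) -> codim_ge (add_span s U) V n.
Proof.
move=> US; elim: s n => //= v s IH n UV.
apply: codim_ge_add_line; first exact: subspace_add_span.
by apply: IH; rewrite addnS.
Qed.

Lemma add_span_map (I : Type) (r : seq I) (F : I -> fps2 K) (a : I -> K) U z :
  U (z - \sum_(i <- r) C (a i) * F i) -> add_span (map F r) U z.
Proof.
elim: r z => [|i r IH] z /=; first by rewrite big_nil subr0.
by rewrite big_cons => Uz; exists (a i); apply: IH; rewrite -addrA -opprD.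
Qed.

Lemma coef_mono a b i j : (X ^+ a * Y ^+ b : fps2 K) i j = ((i == a) && (j == b))%:R.
Proof.
rewrite coef2XnM; have Yb k n m : (Y ^+ k : fps2 K) n m = ((n == 0) && (m == k))%N%:R.
  elim: k n m => [|k IH] n m; first by rewrite expr0 coef2_1.
  by rewrite exprS coef2YM; case: m => [|m]; rewrite ?andbF // IH eqSS.
by rewrite Yb; case: leqP => ai; [congr ((_ && _)%:R); lia|rewrite (ltn_eqF ai)].
Qed.

Definition homogeneous u n := \sum_(b <- iota 0 n.+1) C (u (n - b)%N b) * (X ^+ (n - b) * Y ^+ b).

Lemma coef_homogeneous u n i j : homogeneous u n i j = if (i + j == n)%N then u i j else 0.
Proof.
rewrite coef2_sum; under eq_bigr do rewrite coef2constM coef_mono.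
have [jn|nj] := ltnP j n.+1; last first.
  rewrite big_seq big1 => [|b]; first by rewrite ifF //; lia.
  by rewrite mem_iota => bn; rewrite (gtn_eqF (_ : b < j)%N) ?andbF ?mulr0 //; lia.
rewrite (bigD1_seq j) ?iota_uniq ?mem_iota //= eqxx andbT big1 => [|b bj]; last first.
  by rewrite eq_sym in bj; rewrite (negPf bj) andbF mulr0.
rewrite addr0; case: eqP => E; first by rewrite ifT ?mulr1 ?E //; lia.
by rewrite ifF ?mulr0 //; lia.
Qed.

Lemma vanish_homogeneous u n : vanish u n -> vanish (u - homogeneous u n) n.+1.
Proof.
move=> /vanishP un; apply/vanishP => i j ij; rewrite coef2B coef_homogeneous.
case: eqP => E; first by rewrite subrr.
by rewrite un ?subr0 //; lia.
Qed.

Lemma subspace_vanish n : subspace (fun z => vanish z n).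
Proof.
split=> [d _|a f g /vanishP fn /vanishP gn]; first by rewrite hom0.
by apply/vanishP => i j ij; rewrite coef2D coef2constM fn // gn // mulr0 addr0.
Qed.

(** The binomial coefficient counts the monomials of degree below n. *)
Lemma codim_vanish n : codim_ge (fun z => vanish z n) (fun=> True) 'C(n.+1, 2).
Proof.
elim: n => [|n IH].
  by rewrite (_ : 'C(1, 2) = 0%N) //; exists (fun=> 0) => // a _ [].
rewrite binS bin1 addnC; apply: (codim_ge_cat (subspace_vanish n)) => //.
  by move=> z zn d dn; apply: zn; lia.
exists (fun b : 'I_n.+1 => X ^+ (n - b) * Y ^+ b) => [b|a /vanishP an b].
  by apply/vanishP => i j ij; rewrite coef_mono; case: andP => // -[/eqP iE /eqP jE]; have := ltn_ord b; lia.
have bn := ltn_ord b.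
have := an (n - b)%N b; rewrite subnK // ltnSn => /(_ isT).
rewrite coef_lincomb (bigD1 b) //= coef_mono !eqxx mulr1 big1 ?addr0 // => k kb.
have {}kb : ((b : nat) == k) = false by apply: contraNF kb => /eqP E; apply/eqP/val_inj.
by rewrite coef_mono kb andbF mulr0.
Qed.

(** Bounding the orders of the multipliers makes all elements pull back to multiples of one power of
    x, which is what a comparison with the ideal (F, G) upstairs requires. *)
Definition ideal_at f g a b z := exists u v, [/\ vanish u a, vanish v b & z = u * f + v * g].
Definition in_ideal2 f g z := exists u v, z = u * f + v * g.

Lemma subspace_ideal_at f g a b : subspace (ideal_at f g a b).
Proof.
split; first by exists 0, 0; split; try (by case: (subspace_vanish 0)); rewrite ?mul0r ?addr0 // => d _; rewrite hom0.
move=> s z z' [u [v [ua vb ->]]] [u' [v' [ua' vb' ->]]].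
exists (C s * u + u'), (C s * v + v'); split; last by ring.
  by case: (subspace_vanish a) => _; apply.
by case: (subspace_vanish b) => _; apply.
Qed.

(** Removing the order condition on u costs at most one dimension per monomial of degree below a. *)
Lemma codim_ideal_left f g a b V n : codim_ge (ideal_at f g a b) V ('C(a.+1, 2) + n) ->
  codim_ge (ideal_at f g 0 b) V n.
Proof.
elim: a n => [|a IH] n; first by rewrite (_ : 'C(1, 2) = 0%N).
rewrite binS bin1 => H; apply: (IH n).
pose s := [seq X ^+ (a - k) * Y ^+ k * f | k <- iota 0 a.+1].
have {H} : codim_ge (add_span s (ideal_at f g a.+1 b)) V ('C(a.+1, 2) + n).
  apply: codim_ge_add_span; first exact: subspace_ideal_at.
  by rewrite size_map size_iota addnA [(a.+1 + _)%N]addnC.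
apply: codim_geW => // z [u [v [ua vb ->]]].
apply: (@add_span_map _ _ _ (fun k => u (a - k)%N k)).
exists (u - homogeneous u a), v; split=> //; first exact: vanish_homogeneous.
rewrite /homogeneous mulrBl mulr_suml addrAC; congr (_ - _ + _).
by apply: eq_bigr => k _; rewrite mulrA.
Qed.

Lemma codim_ideal_at f g a b V n : codim_ge (ideal_at f g a b) V ('C(a.+1, 2) + ('C(b.+1, 2) + n)) ->
  codim_ge (in_ideal2 f g) V n.
Proof.
have sw s t x y : forall z, ideal_at s t x y z -> ideal_at t s y x z.
  by move=> z [u [v [us vt ->]]]; exists v, u; split=> //; rewrite addrC.
move=> /codim_ideal_left /(codim_geW (@sw _ _ _ _) (fun=> id)) /codim_ideal_left.
apply: codim_geW => // z [u [v ->]]; exists v, u; split; rewrite 1?addrC //.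
Qed.

Lemma subspace_ideal2 f g : subspace (in_ideal2 f g).
Proof.
split; first by exists 0, 0; rewrite !mul0r addr0.
by move=> b z1 z2 [u1 [v1 ->]] [u2 [v2 ->]]; exists (C b * u1 + u2), (C b * v1 + v2); ring.
Qed.

Lemma ideal2M f g u z : in_ideal2 f g z -> in_ideal2 f g (u * z).
Proof. by move=> [a [b ->]]; exists (u * a), (u * b); ring. Qed.

(** A monomial of degree at least 2 mu has an exponent at least mu in x or in y. *)
Lemma ideal2_vanish f g mu z : in_ideal2 f g (X ^+ mu) -> in_ideal2 f g (Y ^+ mu) ->
  vanish z (mu + mu) -> in_ideal2 f g z.
Proof.
move=> XJ YJ /vanishP zv; pose t := z - X ^+ mu * div_xn mu z.
have tE i j : t i j = if (mu <= i)%N then 0 else z i j.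
  by rewrite coef2B coef2XnM /=; case: leqP => im; rewrite ?subr0 // subnK // subrr.
have -> : z = div_xn mu z * X ^+ mu + swap (div_xn mu (swap t)) * Y ^+ mu.
  have -> : swap (div_xn mu (swap t)) * Y ^+ mu = t.
    have tX : X ^+ mu * div_xn mu (swap t) = swap t.
      apply: div_xnK => i j im; rewrite coef_swap tE.
      by case: leqP => // jm; apply: zv; lia.
    by rewrite -swapX -swapXn -swapM mulrC tX swapK.
  by rewrite /t mulrC addrC subrK.
by apply: (subspaceD (subspace_ideal2 _ _)); apply: ideal2M.
Qed.

Lemma bin2D m n : 'C(m + n, 2) = ('C(m, 2) + 'C(n, 2) + m * n)%N.
Proof.
elim: n => [|n IH]; first by rewrite addn0 muln0 !addn0.
by rewrite addnS !binS !bin1 IH mulnS; lia.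
Qed.

Lemma vanish_bl c f m : vanish f m -> exists F, bl c f = X ^+ m * F.
Proof. by move=> fm; exists (div_xn m (bl c f)); rewrite div_xnK //; apply: bl_low. Qed.

Lemma poly_yorder (p : {poly K}) m : p != 0 -> (size p <= m.+1)%N ->
  exists s, [/\ (s <= m)%N, forall j, (j < s)%N -> p`_j = 0 & p`_s != 0].
Proof.
move=> p0 pm; case: (ex_minnP (poly_neq0_coef p0)) => s ps smin; exists s; split=> //.
  by rewrite -ltnS (leq_trans _ pm) // ltnNge; apply: contra ps => ?; rewrite nth_default.
by move=> j js; apply/eqP; apply: contraTT js => pj; rewrite -leqNgt smin.
Qed.

(* Noether's inequality: the intersection number drops at least by mn when
   passing to the virtual transforms F and G of f and g. The functions of order
   at least m + n - 1 surject onto the local ring upstairs modulo (F, G). *)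
Lemma noether_inequality c f g (F G : fps2 K) m n d :
  vanish f m -> vanish g n -> (0 < m + n)%N -> hpart f m != 0 ->
  bl c f = X ^+ m * F -> bl c g = X ^+ n * G ->
  codim_ge (in_ideal2 F G) (fun=> True) d ->
  codim_ge (in_ideal2 f g) (fun=> True) (m * n + d).
Proof.
move=> fm gn mn f0 FE GE [e _ eI]; pose k := (m + n).-1.
have FE0 j : F 0%N j = (hpart f m \Po ('X + c%:P))`_j.
  by move: (coef2_congr m j FE); rewrite coef2XnM leqnn subnn => <-.
have [s [sm Fs Fs0]] : exists s, [/\ (s <= m)%N, forall j, (j < s)%N -> F 0%N j = 0 & F 0%N s != 0].
  have [||s [sm ps ps0]] := @poly_yorder (hpart f m \Po ('X + c%:P)) m.
  - by rewrite comp_poly_shift_eq0.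
  - by rewrite size_comp_poly2 ?size_hom // -[c]opprK polyCN size_XsubC.
  - by exists s; split=> // [j js|]; rewrite FE0 // ps.
(* Division by F leaves degree below s <= m <= k + 1 in y, so x^k times the remainder descends:
   every class modulo (F, G) is represented by a series of order at least k. *)
have lift z : exists2 h, vanish h k & exists u v, bl c h = X ^+ k * (z - (u * F + v * G)).
  have [q [r [zE rs]]] := weierstrass_division z Fs Fs0.
  have [|h [hE hk]] := @blowdown _ c r k; first by move=> i j ij; apply: rs; rewrite /k in ij; lia.
  by exists h => //; exists q, 0; rewrite hE zE mul0r addr0 addrAC subrr add0r.
have [h hk hE] : exists2 h : 'I_d -> fps2 K, forall i, vanish (h i) k &
    forall i, exists u v, bl c (h i) = X ^+ k * (e i - (u * F + v * G)).
  have [h hP] := choice (fun i => let: ex_intro2 h hk hE := lift (e i) in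
    ex_intro (fun h => vanish h k /\ exists u v, bl c h = X ^+ k * (e i - (u * F + v * G))) h (conj hk hE)).
  by exists h => i; case: (hP i).
have JV z : ideal_at f g n.-1 m.-1 z -> vanish z k.
  move=> [u [v [un vm ->]]]; apply: (subspaceD (subspace_vanish k)).
    by move=> i ik; apply: (vanishM un fm); rewrite /k in ik; lia.
  by move=> i ik; apply: (vanishM vm gn); rewrite /k in ik; lia.
have blJ z : ideal_at f g n.-1 m.-1 z -> exists2 z', in_ideal2 F G z' & bl c z = X ^+ k * z'.
  move=> [u [v [un vm ->]]]; have [u' uE] := vanish_bl c un; have [v' vE] := vanish_bl c vm.
  exists (X ^+ (n.-1 + m - k) * u' * F + X ^+ (m.-1 + n - k) * v' * G); first by do 2 eexists.
  rewrite blD !blM uE vE FE GE.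
  transitivity (X ^+ (n.-1 + m) * u' * F + X ^+ (m.-1 + n) * v' * G); first by rewrite !exprD; ring.
  have {1}-> : (n.-1 + m = k + (n.-1 + m - k))%N by rewrite /k; lia.
  have {1}-> : (m.-1 + n = k + (m.-1 + n - k))%N by rewrite /k; lia.
  by rewrite !exprD; ring.
have : codim_ge (ideal_at f g n.-1 m.-1) (fun z => vanish z k) d.
  exists h => // a /blJ[z' z'J hz']; apply: eI.
  have [u uE] := choice hE; have [v vE] := choice uE.
  have blC b y : bl c (C b * y) = C b * bl c y.
    rewrite blM; congr (_ * _); apply: fps2P => i j; rewrite blE.
    have -> : hpart (C b) i = (if i == 0%N then b else 0)%:P.
      by apply/polyP => l; rewrite coef_hom coefC /=; case: i l => [|i] [|l]; rewrite ?andbF //= ?if_same.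
    by rewrite comp_polyC coefC /=; case: i j => [|i] [|j].
  have -> : lincomb a e = z' + \sum_i C (a i) * (u i * F + v i * G).
    apply: (@mulXI _ k); rewrite mulrDr -hz' /lincomb (big_morph (bl c) (id1 := 0) (blD c)); last first.
      by apply: fps2P => i j; rewrite blE hom0 raddf0 coef0 coef2_0.
    rewrite !mulr_sumr -big_split; apply: eq_bigr => i _ /=; rewrite blC (vE i). ring.
  have IS : subspace (in_ideal2 F G).
    split; first by exists 0, 0; rewrite !mul0r addr0.
    move=> b z1 z2 [u1 [v1 ->]] [u2 [v2 ->]]; exists (C b * u1 + u2), (C b * v1 + v2); ring.
  apply: (subspaceD IS) => //; apply: (big_ind (in_ideal2 F G)); first by case: IS.
    by move=> z1 z2; apply: subspaceD.
  by move=> i _; apply: (subspaceZ _ IS); exists (u i), (v i).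
(* The codimension is at least d + C(m+n,2) for multipliers of orders at least n - 1 and m - 1.
   Freeing them costs at most C(n,2) + C(m,2), which leaves mn + d. *)
move/(codim_ge_cat (subspace_vanish k) JV (fun _ _ => I))/(_ (codim_vanish k)) => H.
apply: (@codim_ideal_at f g n.-1 m.-1).
have E x : 'C(x.-1.+1, 2) = 'C(x, 2) by case: x.
have <- : (d + 'C(k.+1, 2) = 'C(n.-1.+1, 2) + ('C(m.-1.+1, 2) + (m * n + d)))%N; last by [].
by rewrite !E ?prednK // bin2D; lia.
Qed.

End Codimension.

(** * From the analytic Milnor number to formal codimensions *)

Section MilnorNumber.
Variable R : realType.
Local Notation K := R[i].
Implicit Types (f g : fps2 K) (w : one_form K).
Notation X := (fps2_x K).
Notation Y := (fps2_y K).
Notation C := (@fps2_const K).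

Lemma convergent_poly f N : (forall i j, (N <= i + j)%N -> f i j = 0) -> convergent f.
Proof.
move=> fN; exists (\sum_(i < N) \sum_(j < N) complex.Re `|f i j|), 1 => i j.
have pos z : 0 <= complex.Re `|z : K| by rewrite -(@ler0c R) RRe_real ?normr_real.
rewrite expr1n mulr1; have [ij|Nij] := ltnP (i + j) N; last first.
  by rewrite fN // normr0 ler0c; apply: sumr_ge0 => a _; apply: sumr_ge0 => b _; apply: pos.
have iN : (i < N)%N by lia.
have jN : (j < N)%N by lia.
rewrite -[leLHS]RRe_real ?normr_real // lecR.
rewrite (bigD1 (Ordinal iN)) //= (bigD1 (Ordinal jN)) //= -addrA lerDl.
apply: addr_ge0; first by apply: sumr_ge0 => a _; apply: pos.
by apply: sumr_ge0 => a _; apply: sumr_ge0 => b _; apply: pos.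
Qed.

(** The coordinates of the mu + 1 series with respect to mu classes form a matrix with more rows
    than columns, and a left kernel vector is the relation. *)
Lemma milnor_dependent w mu (z : 'I_mu.+1 -> fps2 K) : milnor_number w mu ->
  (forall i, convergent (z i)) ->
  exists a : 'I_mu.+1 -> K, (exists i, a i != 0) /\ in_ideal2 w.1 w.2 (lincomb a z).
Proof.
move=> [e [_ eP]] zC.
have H i : exists c : 'rV[K]_mu, in_ideal w (z i - \sum_j C (c 0 j) * e j).
  by have [c [cE _]] := eP _ (zC i); exists c.
have [c cP] := choice H.
pose M := \matrix_(i, j) c i 0 j.
have kM : kermx M != 0 by rewrite -mxrank_eq0 mxrank_ker subn_eq0 -ltnNge ltnS rank_leq_col.
pose u := nz_row (kermx M).
have uM : u *m M = 0 by apply/sub_kermxP; rewrite nz_row_sub.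
have u0 : u != 0 by rewrite nz_row_eq0.
exists (fun i => u 0 i); split.
  apply: contrapT => /forallNP uN; move/eqP: u0; apply; apply/rowP => i; rewrite mxE.
  by have /negP := uN i; rewrite negbK => /eqP.
have -> : lincomb (fun i => u 0 i) z = lincomb (fun i => u 0 i) (fun i => z i - \sum_j C (c i 0 j) * e j).
  apply/eqP; rewrite -subr_eq0 /lincomb -sumrB.
  under eq_bigr do rewrite -mulrBr opprB addrC subrK mulr_sumr.
  rewrite exchange_big /= big1 // => j _.
  under eq_bigr do rewrite mulrA -constM.
  rewrite -mulr_suml -(big_morph C (@constD _) (const0 _)).
  have -> : \sum_i u 0 i * c i 0 j = (u *m M) 0 j by rewrite mxE; apply: eq_bigr => i _; rewrite mxE.
  by rewrite uM mxE const0 mul0r.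
apply: subspace_lincomb; first exact: subspace_ideal2.
by move=> i; have [p [q [_ _ E]]] := cP i; exists p, q.
Qed.

(** A dependence among 1, x, ..., x^mu is a polynomial in x, hence x^k times a unit with k <= mu.
    This is the bridge to formal series: it puts every series of high order into the formal
    ideal. *)
Lemma milnor_powers w mu : milnor_number w mu ->
  in_ideal2 w.1 w.2 (X ^+ mu) /\ in_ideal2 w.1 w.2 (Y ^+ mu).
Proof.
move=> wmu.
have low (a : 'I_mu.+1 -> K) : (exists i, a i != 0) -> exists k U,
    [/\ (k <= mu)%N, U \is a GRing.unit & lincomb a (fun i => X ^+ i) = X ^+ k * U].
  move=> [i ai]; pose b n := if insub n is Some i then a i else 0.
  have bi : b i != 0 by rewrite /b valK.
  have aE n m : lincomb a (fun i => X ^+ i) n m = if m == 0%N then b n else 0.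
    rewrite coef_lincomb; have Xk (k : 'I_mu.+1) : (X ^+ k : fps2 K) n m = ((n == k) && (m == 0))%N%:R.
      by rewrite -[X ^+ k]mulr1 -[1](expr0 Y) coef_mono.
    case: eqP => m0; last by rewrite big1 // => k _; rewrite Xk (_ : (m == 0%N) = false) ?andbF ?mulr0 //; apply/eqP.
    rewrite /b; case: insubP => [k _ kE|nN].
      rewrite (bigD1 k) // Xk kE eqxx (introT eqP m0) mulr1 big1 => [|l lk]; first by rewrite /= addr0.
      rewrite Xk (_ : (n == l) = false) ?mulr0 //.
      by apply: contraNF lk => /eqP E; apply/eqP/val_inj; rewrite kE.
    rewrite big1 // => k _; rewrite Xk (_ : (n == k) = false) ?mulr0 //.
    by apply: contraNF nN => /eqP ->; apply: ltn_ord.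
  case: (ex_minnP (ex_intro (fun n => b n != 0) _ bi)) => k bk kmin.
  exists k, (div_xn k (lincomb a (fun i => X ^+ i))); split.
  - by apply: leq_trans (kmin _ bi) _; rewrite -ltnS ltn_ord.
  - by apply/unit_coef; rewrite [X in X != 0](aE (0 + k)%N 0%N).
  - rewrite div_xnK // => n m nk; rewrite aE; case: ifP => // _.
    by apply/eqP; apply: contraTT nk => bn; rewrite -leqNgt kmin.
split.
  have [|a [/low[k [U [kmu Uu E]]] aJ]] := milnor_dependent wmu (z := fun i => X ^+ i).
    move=> i; apply: (@convergent_poly _ i.+1) => n m nm; rewrite -[X ^+ i]mulr1 -[1](expr0 Y) coef_mono.
    by case: andP => // -[/eqP ni /eqP m0]; lia.
  have -> : X ^+ mu = (X ^+ (mu - k) * U^-1) * (X ^+ k * U).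
    by rewrite mulrACA mulVr // mulr1 -exprD subnK.
  by apply: ideal2M; rewrite -E.
have [|a [/low[k [U [kmu Uu E]]] aJ]] := milnor_dependent wmu (z := fun i => Y ^+ i).
  move=> i; apply: (@convergent_poly _ i.+1) => n m nm; rewrite -[Y ^+ i]mul1r -[1](expr0 X) coef_mono.
  by case: andP => // -[/eqP n0 /eqP mi]; lia.
have sU : swap U \is a GRing.unit by move/unit_coef: Uu => Uu; apply/unit_coef.
have LE : lincomb a (fun i => Y ^+ i) = swap (lincomb a (fun i => X ^+ i)).
  rewrite swap_lincomb; congr lincomb; apply/funext => i.
  by rewrite swapXn swapX.
have {}E : lincomb a (fun i => Y ^+ i) = Y ^+ k * swap U.
  by rewrite LE E swapM swapXn swapX.
have -> : Y ^+ mu = (Y ^+ (mu - k) * (swap U)^-1) * (Y ^+ k * swap U).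
  by rewrite mulrACA mulVr // mulr1 -exprD subnK.
by apply: ideal2M; rewrite -E.
Qed.

Lemma milnor_vanish w mu z : milnor_number w mu -> vanish z (mu + mu) -> in_ideal2 w.1 w.2 z.
Proof.
move=> /milnor_powers[XJ YJ] zv; apply: (@ideal2_vanish _ _ _ mu _ _ _ zv).
  exact: XJ.
exact: YJ.
Qed.

Lemma codim_le_milnor w mu d : milnor_number w mu ->
  codim_ge (in_ideal2 w.1 w.2) (fun=> True) d -> (d <= mu)%N.
Proof.
move=> wmu wd; rewrite leqNgt; apply/negP => mud.
(* Adding the zero line leaves the ideal unchanged and lowers the count by one, down to mu + 1. *)
have [e _ eI] : codim_ge (in_ideal2 w.1 w.2) (fun=> True) mu.+1.
  move: mud wd => /subnKC <-; elim: (d - mu.+1)%N => [|k IH]; first by rewrite addn0.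
  rewrite addnS => /(codim_ge_add_line 0 (subspace_ideal2 _ _)) H; apply: IH; apply: codim_geW H => // z zJ.
  by exists 0; rewrite mulr0 subr0.
(* Formal representatives need not converge. Their truncations do, and differ from them by series of
   order at least 2 mu, which lie in the ideal. *)
pose t i := FPS2 (fun n m => if (n + m < mu + mu)%N then e i n m else 0).
have [|a [[i ai] aJ]] := milnor_dependent wmu (z := t).
  by move=> i; apply: (@convergent_poly _ (mu + mu)) => n m nm /=; rewrite ltnNge nm.
move/eqP: ai; apply; apply: eI; rewrite -[lincomb a e](subrK (lincomb a t)).
apply: (subspaceD (subspace_ideal2 _ _)) => //; apply: milnor_vanish wmu _.
apply/vanishP => n m nm; rewrite coef2B !coef_lincomb -sumrB big1 // => k _.
by rewrite /= nm subrr.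
Qed.

End MilnorNumber.

(** * Blow-ups of foliations *)

Section Transforms.
Variable K : numClosedFieldType.
Implicit Types (f g h u v : fps2 K) (c : K) (d : direction K) (w : one_form K).
Notation X := (fps2_x K).
Notation Y := (fps2_y K).
Notation C := (@fps2_const K).

Lemma coef_dx f i j : dx f i j = f i.+1 j *+ i.+1. Proof. by []. Qed.
Lemma coef_dy f i j : dy f i j = f i j.+1 *+ j.+1. Proof. by []. Qed.

Lemma dxD f g : dx (f + g) = dx f + dx g.
Proof. by apply: fps2P => i j; rewrite coef2D !coef_dx coef2D mulrnDl. Qed.

Lemma dxM f g : dx (f * g) = dx f * g + f * dx g.
Proof.
apply: fps2P => n m; rewrite coef2D coef_dx !coef2M -sumrMnl.
have E (i : 'I_n.+2) : (\sum_(j < m.+1) f i j * g (n.+1 - i)%N (m - j)%N) *+ n.+1 =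
   (\sum_(j < m.+1) f i j * g (n.+1 - i)%N (m - j)%N) *+ i +
   (\sum_(j < m.+1) f i j * g (n.+1 - i)%N (m - j)%N) *+ (n.+1 - i).
  by rewrite -mulrnDr subnKC // -ltnS ltn_ord.
under eq_bigr do rewrite E.
rewrite big_split /=; congr (_ + _).
  rewrite big_ord_recl mulr0n add0r; apply: eq_bigr => i _.
  rewrite -sumrMnl; apply: eq_bigr => j _; rewrite !lift0 subSS.
  by rewrite mulrnAl.
rewrite big_ord_recr /= subnn mulr0n addr0; apply: eq_bigr => i _.
rewrite -sumrMnl; apply: eq_bigr => j _; rewrite subSn; last by rewrite -ltnS ltn_ord.
by rewrite mulrnAr.
Qed.

Lemma dx_swap f : dx (swap f) = swap (dy f). Proof. by []. Qed.
Lemma dy_swap f : dy (swap f) = swap (dx f). Proof. by []. Qed.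

Lemma dyM f g : dy (f * g) = dy f * g + f * dy g.
Proof. by apply: (can_inj (@swapK K)); rewrite -dx_swap swapM dxM swapD !swapM. Qed.

Lemma dxX : dx X = 1.
Proof. by apply: fps2P => -[|[|i]] [|j]; rewrite coef_dx coef2_1 ?mulr0n ?mul0rn. Qed.
Lemma dyX : dy X = 0.
Proof. by apply: fps2P => i j; rewrite coef_dy coef2_0 /= andbF mul0rn. Qed.
Lemma dxY : dx Y = 0.
Proof. by rewrite -swapX dx_swap dyX swap0. Qed.
Lemma dyY : dy Y = 1.
Proof. by rewrite -swapX dy_swap dxX swap1. Qed.
Lemma dxC c : dx (C c) = 0.
Proof. by apply: fps2P => i j; rewrite coef_dx coef2_0 /= mul0rn. Qed.
Lemma dyC c : dy (C c) = 0.
Proof. by apply: fps2P => i j; rewrite coef_dy coef2_0 /= andbF mul0rn. Qed.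
Lemma dyD f g : dy (f + g) = dy f + dy g.
Proof. by apply: fps2P => i j; rewrite coef2D !coef_dy coef2D mulrnDl. Qed.

Lemma dxXn n : X * dx (X ^+ n) = X ^+ n *+ n.
Proof.
elim: n => [|n IH]; first by rewrite expr0 -const1 dxC mulr0.
by rewrite exprS dxM dxX mul1r mulrDr mulrCA IH mulrS mulrnAr -exprS.
Qed.
Lemma dyXn n : dy (X ^+ n) = 0.
Proof.
elim: n => [|n IH]; first by rewrite expr0 -const1 dyC.
by rewrite exprS dyM dyX mul0r add0r IH mulr0.
Qed.

Lemma hpart_dy f n : hpart (dy f) n = (hpart f n.+1)^`().
Proof.
apply/polyP => j; rewrite coef_hom coef_deriv coef_hom ltnS subSS coef_dy.
by case: ifP; rewrite ?mul0rn.
Qed.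
Lemma hpart_dx f n : hpart (dx f) n + 'X * hpart (dy f) n = hpart f n.+1 *+ n.+1.
Proof.
apply/polyP => j; rewrite hpart_dy coefD coefMn !coef_hom coefXM coef_deriv coef_dx.
case: j => [|j]; first by rewrite !subn0 addr0.
rewrite coef_hom !ltnS subSS; case: (leqP j.+1 n) => jn.
  by rewrite ltnW // -subSn ?subSS // -mulrnDr; congr (f _ _ *+ _); lia.
by rewrite add0r; case: (leqP j n) => jn'; rewrite ?mul0rn //; congr (_ *+ _); lia.
Qed.

Lemma dy_bl c f : dy (bl c f) = X * bl c (dy f).
Proof.
apply: fps2P => n m; rewrite coef_dy coef2XM !blE -coef_deriv deriv_comp.
rewrite derivD derivX derivC addr0 mulr1; case: n => [|n]; last by rewrite blE hpart_dy.
by rewrite hom00 derivC raddf0 coef0.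
Qed.

Lemma row_YcM c f (p : nat -> {poly K}) : (forall i j, f i j = (p i \Po ('X + c%:P))`_j) ->
  forall i j, ((Y + C c) * f) i j = (('X * p i) \Po ('X + c%:P))`_j.
Proof.
move=> fE i j; rewrite comp_polyM comp_polyX [in RHS]mulrDl coefD mul_polyC coefZ -fE coefXM.
rewrite mulrDl coef2D coef2constM coef2YM.
by case: j => [|j] //=; rewrite fE.
Qed.

Lemma dx_bl c f : dx (bl c f) = bl c (dx f) + (Y + C c) * bl c (dy f).
Proof.
apply: fps2P => n m; rewrite coef2D (@row_YcM c _ (hpart (dy f))) // coef_dx !blE.
by rewrite -coefD -comp_polyD hpart_dx raddfMn coefMn.
Qed.

(* The initial part of x a + y b, at x = 1; it vanishes exactly when the
   exceptional line is dicritical. *)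
Definition cone w n := hpart w.1 n + 'X * hpart w.2 n.

Definition form_order w n :=
  [/\ vanish w.1 n, vanish w.2 n & hpart w.1 n != 0 \/ hpart w.2 n != 0].

Definition swap_form w : one_form K := (swap w.2, swap w.1).

Lemma form_order_ex w : w.1 <> 0 \/ w.2 <> 0 -> exists n, form_order w n.
Proof.
move=> w0; have [n wn] : exists n, (hpart w.1 n != 0) || (hpart w.2 n != 0).
  case: w0 => /fps_order_ex[n [_ wn]]; exists n; rewrite wn ?orbT //.
case: (ex_minnP (ex_intro (fun n => (hpart w.1 n != 0) || (hpart w.2 n != 0)) n wn)) => m /orP wm mmin.
exists m; split=> // d dm; apply/eqP; apply: contraTT dm => wd; rewrite -leqNgt mmin // wd ?orbT //.
Qed.

Lemma swap_form_order w n : form_order w n -> form_order (swap_form w) n.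
Proof.
move=> [w1 w2 w0]; split; [exact: vanish_swap|exact: vanish_swap|].
have E f : hpart f n != 0 -> hpart (swap f) n != 0.
  by apply: contraNneq => /hom_swap_eq0; rewrite swapK => ->.
by case: w0 => /E; [right|left].
Qed.

(** The power of the exceptional equation dividing the pulled-back form; the boolean counts as 1, so
    the power is one higher in the dicritical case. *)
Definition div_order w n := (n + (cone w n == 0)%R)%N.

Lemma pullback_some c w : pullback (blowup_x (Some c)) (blowup_y (Some c)) w =
  (bl c w.1 + (Y + C c) * bl c w.2, X * bl c w.2).
Proof.
rewrite /pullback !subst_some /blowup_x /blowup_y dxM dyM dxX dyX dxD dyD dxY dyY dxC dyC.
by congr (_, _); ring.
Qed.

Lemma foliation_none w : foliation_transform w None = foliation_transform (swap_form w) (Some 0).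
Proof.
rewrite /foliation_transform pullback_some.
have -> : pullback (@blowup_x K None) (blowup_y None) w =
  (bl 0 (swap w.2) + (Y + C 0) * bl 0 (swap w.1), X * bl 0 (swap w.1)); last by [].
rewrite /pullback !subst_none /blowup_x /blowup_y dxM dyM dxX dyX dxY dyY const0.
by congr (_, _); ring.
Qed.

Lemma row_pullback1 c w i j :
  (bl c w.1 + (Y + C c) * bl c w.2) i j = (cone w i \Po ('X + c%:P))`_j.
Proof. by rewrite coef2D (@row_YcM c _ (hpart w.2)) // blE -coefD -comp_polyD. Qed.

(** If the cone vanishes, the part of degree n of [w.2] cannot, since otherwise that of [w.1] would
    vanish too; so exactly n + 1 factors x come out. *)
Lemma foliation_some c w n : form_order w n ->
  let w' := foliation_transform w (Some c) in
  X ^+ div_order w n * w'.1 = bl c w.1 + (Y + C c) * bl c w.2 /\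
  X ^+ div_order w n * w'.2 = X * bl c w.2.
Proof.
move=> [w1 w2 w0].
have low1 i j : (i < div_order w n)%N -> (bl c w.1 + (Y + C c) * bl c w.2) i j = 0.
  rewrite row_pullback1 /div_order => ilt; suff -> : cone w i = 0 by rewrite raddf0 coef0.
  have [ilt'|ni] := ltnP i n; first by rewrite /cone w1 // w2 // mulr0 addr0.
  by case: (cone w n =P 0) ilt => // E; rewrite ?addn0 ?addn1 => ?; rewrite (_ : i = n) //; lia.
have low2 i j : (i < div_order w n)%N -> (X * bl c w.2) i j = 0.
  rewrite coef2XM /div_order; case: i => // i ilt; rewrite blE w2 ?raddf0 ?coef0 //.
  by move: ilt; case: eqP => _; rewrite ?addn0 ?addn1; lia.
have ordE : x_order [:: bl c w.1 + (Y + C c) * bl c w.2; X * bl c w.2] = div_order w n.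
  apply: leastE.
    rewrite /div_order; case: eqP => [E|/eqP E].
      exists (X * bl c w.2); first by rewrite !inE eqxx orbT.
      have b0 : hpart w.2 n != 0.
        by case: w0 => // a0; apply: contraNneq a0 => b0; move: E; rewrite /cone b0 mulr0 addr0 => ->.
      by have [j bj] := bl_lead c b0; exists j; rewrite addn1 coef2XM.
    exists (bl c w.1 + (Y + C c) * bl c w.2); first by rewrite !inE eqxx.
    have [|j cj] := @poly_neq0_coef _ (cone w n \Po ('X + c%:P)); first by rewrite comp_poly_shift_eq0.
    by exists j; rewrite row_pullback1 addn0.
  move=> m [f]; rewrite !inE => fE [j fm]; rewrite leqNgt; apply: contra fm => mn.
  by case/orP: fE => /eqP ->; rewrite ?low1 ?low2.
by rewrite /foliation_transform pullback_some /= ordE !div_xnK.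
Qed.

Section Child.
Variables (c : K) (w : one_form K) (n : nat).
Hypothesis wn : form_order w n.
Let w' := foliation_transform w (Some c).

Lemma child1 i j : w'.1 i j = (cone w (i + div_order w n) \Po ('X + c%:P))`_j.
Proof.
have [E _] := foliation_some c wn.
by rewrite -row_pullback1 -E coef2XnM leq_addl addnK.
Qed.

Lemma child2_nondicritical j : cone w n != 0 -> w'.2 0%N j = 0.
Proof.
move=> /negPf c0; have [_ E] := foliation_some c wn.
have := coef2_congr n j E; rewrite /div_order c0 addn0 coef2XnM leqnn subnn coef2XM => ->.
by case: n wn => // m [_ bm _]; rewrite blE bm // raddf0 coef0.
Qed.

Lemma child2_nondicriticalS i j : cone w n != 0 ->
  w'.2 i.+1 j = (hpart w.2 (i + n) \Po ('X + c%:P))`_j.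
Proof.
move=> /negPf c0; have [_ E] := foliation_some c wn.
have := coef2_congr (i.+1 + n) j E.
by rewrite /div_order c0 addn0 coef2XnM leq_addl addnK addSn coef2XM blE.
Qed.

Lemma child2_dicritical i j : cone w n = 0 ->
  w'.2 i j = (hpart w.2 (i + n) \Po ('X + c%:P))`_j.
Proof.
move=> c0; have [_ E] := foliation_some c wn.
have := coef2_congr (i + n.+1) j E.
by rewrite /div_order c0 eqxx addn1 coef2XnM leq_addl addnK addnS coef2XM blE.
Qed.

End Child.

Lemma coef0_shift (p : {poly K}) c : (p \Po ('X + c%:P))`_0 = p.[c].
Proof. by rewrite -horner_coef0 horner_comp !hornerE. Qed.

Lemma coef1_shift (p : {poly K}) c : (p \Po ('X + c%:P))`_1 = p^`().[c].
Proof.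
have := coef_deriv (p \Po ('X + c%:P)) 0.
by rewrite deriv_comp derivD derivX derivC addr0 mulr1 coef0_shift => ->.
Qed.

Lemma factor_powerX f g u n : nzx f -> X ^+ n * g = u * f -> divides f g.
Proof.
move=> fx; elim: n u => [|n IH] u; first by rewrite expr0 mul1r => ->; exists u.
move=> E; have u0 j : u 0%N j = 0.
  apply/eqP; apply: contrapT => /negP uj.
  have [k uk] := yorder_ex (ex_intro _ j uj); have [l fl] := yorder_ex fx.
  by have [_] := yorderM uk fl; rewrite -E exprS -mulrA coef2XM eqxx.
have [v uE] := (divX_divides u).2 u0; apply: (IH v).
by apply: (@mulXI _ 1); rewrite /= expr1 mulrA -exprS E uE; ring.
Qed.

Lemma wedge_swap w f : wedge (swap_form w) (swap f) = - swap (wedge w f).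
Proof. by rewrite /wedge /= dx_swap dy_swap swapD swapN !swapM opprB. Qed.

Lemma invariant_swap w f : invariant_curve w f -> invariant_curve (swap_form w) (swap f).
Proof.
by move=> [h E]; exists (- swap h); rewrite wedge_swap E swapM mulNr.
Qed.

Lemma wedge_bl c w f :
  wedge (bl c w.1 + (Y + C c) * bl c w.2, X * bl c w.2) (bl c f) = X * bl c (wedge w f).
Proof. by rewrite /wedge /= dy_bl dx_bl blB !blM; ring. Qed.

Lemma strict_invariant w f d n : form_order w n -> f <> 0 -> invariant_curve w f ->
  invariant_curve (foliation_transform w d) (strict_transform f d).
Proof.
wlog [c ->] : w f d / exists c, d = Some c.
  case: d => [c|]; first by apply; exists c.
  rewrite strict_none foliation_none => H wn f0 /invariant_swap; apply: H.
  - by exists 0.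
  - exact: swap_form_order.
  - by move=> E; apply: f0; rewrite -[f]swapK E swap0.
move=> wn f0 [h hE]; have [m fm] := fps_order_ex f0.
have [E1 E2] := foliation_some c wn; set w' := foliation_transform w _ in E1 E2 *.
have fE := strict_bl c fm; set F := strict_transform f _ in fE *.
have Fx : nzx F by apply: nzx_strict.
clearbody w' F.
(* The total transform of f is x^m F, and differentiating x^m contributes the term with [*+ m]. It
   is again a multiple of F, and the power of x cancels because x does not divide F. *)
have E : X ^+ (div_order w n).+1 * wedge w' F = (X ^+ 2 * bl c h + X ^+ div_order w n * w'.2 *+ m) * F.
  apply: (@mulXI _ m) => /=.
  have := wedge_bl c w f; rewrite hE blM -E1 -E2 fE /wedge /= dyM dxM dyXn mul0r add0r.
  move=> /(congr1 ( *%R X)) => H.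
  have -> : X ^+ m * ((X ^+ 2 * bl c h + X ^+ div_order w n * w'.2 *+ m) * F) =
      X * (X * (bl c h * (X ^+ m * F))) + X ^+ div_order w n * w'.2 * F * (X ^+ m *+ m).
    by rewrite -(mulr_natr (_ * w'.2)) -(mulr_natr (X ^+ m)); ring.
  rewrite -H -dxXn exprS; ring.
exact: factor_powerX E.
Qed.

End Transforms.

Global Opaque foliation_transform strict_transform.

(** * Invariant branches and invariant components *)

Section Separatrices.
Variable K : numClosedFieldType.
Implicit Types (f g h u v : fps2 K) (c : K) (d : direction K) (w : one_form K).
Notation X := (fps2_x K).
Notation Y := (fps2_y K).
Notation C := (@fps2_const K).

Definition branch w f := [/\ irreducible_series f, passes f & invariant_curve w f].

Definition x_invariant w := forall j, w.2 0%N j = 0.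
Definition y_invariant w := forall i, w.1 i 0%N = 0.

Lemma wedge_row0 w f j : x_invariant w -> wedge w f 0%N j = (w.1 * dy f) 0%N j.
Proof.
move=> wx; rewrite coef2B [X in _ - X]coef2_row0M big1 ?subr0 // => i _.
by rewrite wx mul0r.
Qed.

Lemma yorder_gt0 f n : yorder f n -> passes f -> (0 < n)%N.
Proof. by case: n => // -[_ f0] f00; rewrite f00 eqxx in f0. Qed.

Lemma dy_low f n : yorder f n -> forall j, (j < n.-1)%N -> dy f 0%N j = 0.
Proof. by move=> [fn _] j jn; rewrite coef_dy fn ?mul0rn //; lia. Qed.

(** Compare orders along x = 0: since b vanishes there, the wedge restricts to a times the
    y-derivative of f, of order n - 1, whereas a multiple of f has order at least n. *)
Lemma no_branch_regular_x w f : x_invariant w -> w.1 0%N 0%N != 0 ->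
  passes f -> nzx f -> ~ invariant_curve w f.
Proof.
move=> wx a0 fp /yorder_ex[n fn] [h E]; have n0 := yorder_gt0 fn fp.
have L : (w.1 * dy f) 0%N n.-1 = w.1 0%N 0%N * dy f 0%N n.-1.
  by have := @row0M_lead K w.1 (dy f) 0 n.-1; rewrite add0n; apply=> //; apply: dy_low.
have : wedge w f 0%N n.-1 = 0 by rewrite E (row0M_low h fn.1) // prednK.
rewrite wedge_row0 // L coef_dy prednK // => /eqP; rewrite mulf_eq0 (negPf a0) /= mulrn_eq0.
by rewrite (negPf fn.2) orbF => /eqP n00; move: n0; rewrite n00.
Qed.

Lemma no_branch_regular_y w f : y_invariant w -> w.2 0%N 0%N != 0 ->
  passes f -> nzy f -> ~ invariant_curve w f.
Proof. by move=> wy b0 fp fy /invariant_swap; apply: no_branch_regular_x. Qed.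

Lemma multiplier_row0 w f h n : x_invariant w -> w.1 0%N 0%N = 0 -> passes f -> yorder f n ->
  wedge w f = h * f -> h 0%N 0%N = w.1 0%N 1%N *+ n.
Proof.
move=> wx a0 fp fn E; have n0 := yorder_gt0 fn fp.
have L : (w.1 * dy f) 0%N n = w.1 0%N 1%N * dy f 0%N n.-1.
  rewrite -[in LHS](prednK n0) -add1n row0M_lead //; first by case.
  exact: dy_low.
have L' : (h * f) 0%N n = h 0%N 0%N * f 0%N n.
  by have := @row0M_lead K h f 0 n; rewrite add0n; apply=> //; case: fn.
have := coef2_congr 0 n E; rewrite wedge_row0 // L L' coef_dy prednK // mulrnAr -mulrnAl.
by move=> /(mulIf fn.2) ->.
Qed.

(** If x = 0 is invariant, [w.2 1 0] and the opposite of [w.1 0 1] are the eigenvalues of the vector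
    field b d/dx - a d/dy. Positive rational ratios and two zero eigenvalues are excluded;
    saddle-nodes are allowed. *)
Definition nonresonant w := forall m n, (0 < m)%N -> (0 < n)%N ->
  w.2 1%N 0%N *+ m + w.1 0%N 1%N *+ n != 0.

(** [multiplier_row0] evaluates the cofactor of the branch at the origin along each axis; the two
    values agree only under a resonance. *)
Lemma no_branch_corner w f : x_invariant w -> y_invariant w -> w.1 0%N 0%N = 0 ->
  w.2 0%N 0%N = 0 -> nonresonant w -> passes f -> nzx f -> nzy f -> ~ invariant_curve w f.
Proof.
move=> wx wy a0 b0 wr fp fx fy [h E].
have [n fn] := yorder_ex fx; have [m fm] := @yorder_ex _ (swap f) fy.
have hn := multiplier_row0 wx a0 fp fn E.
have E' : wedge (swap_form w) (swap f) = - swap h * swap f by rewrite wedge_swap E swapM mulNr.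
have := @multiplier_row0 (swap_form w) (swap f) _ m wy b0 fp fm E'.
rewrite coef2N coef_swap hn => /eqP; rewrite eq_sym -subr_eq0 opprK; apply/negP.
exact: wr (yorder_gt0 fm fp) (yorder_gt0 fn fp).
Qed.

Lemma branch_strict w f d n : form_order w n -> branch w f -> passes (strict_transform f d) ->
  branch (foliation_transform w d) (strict_transform f d).
Proof.
move=> wn [fI fp fw] fd; split=> //; first exact: strict_irreducible.
by apply: strict_invariant wn _ fw; apply: irreducible_neq0.
Qed.

Lemma passes_some_direction f : irreducible_series f -> exists d, passes (strict_transform f d).
Proof.
move=> fI; have [m fm] := fps_order_ex (irreducible_neq0 fI).
have [d fd] := cone_irreducible fI fm; exists d.
exact/(pure_passes _ fm (fps_order_gt0 fm (irreducible_passes fI)) fd).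
Qed.

(** The order of the strict transform on the exceptional line is the multiplicity of f. *)
Lemma transverse_strict f d : irreducible_series f -> passes (strict_transform f d) ->
  strict_transform f d 0%N 1%N != 0 -> fps_order f 1 /\ pure_cone d f 1.
Proof.
wlog [c ->] : f d / exists c, d = Some c.
  case: d => [c|]; first by apply; exists c.
  rewrite strict_none => H fI fp f1; have [f1' [a a0 fE]] := H (swap f) (Some 0) (ex_intro _ 0 erefl) (irreducible_swap fI) fp f1.
  split; first by rewrite -[f]swapK; apply: fps_order_swap.
  exists a => //; apply/polyP => j; rewrite coefC.
  have [j1|j1] := leqP j 1; last by rewrite nth_default ?ifF //; [case: j j1 => [|[]]|apply: leq_trans (size_hom _ _) _].
  rewrite -[f]swapK hom_swap // fE expr1 coefZ coefB coefX coefC.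
  by case: j j1 => [|[|]] //= _; rewrite ?subr0 ?mulr0 ?mulr1.
move=> fI fp f1; have [m fm] := fps_order_ex (irreducible_neq0 fI).
have m0 := fps_order_gt0 fm (irreducible_passes fI).
have [d' fd] := cone_irreducible fI fm.
have := fp => /(pure_passes _ fm m0 fd) dE; rewrite -dE in fd.
have [Fm _] := strict_pure fm fd.
suff m1 : m = 1%N by rewrite m1 in fm fd.
apply/eqP; rewrite eqn_leq m0 andbT leqNgt; apply: contra f1 => ?.
by rewrite Fm.
Qed.

Lemma pure_coefs d f : fps_order f 1 -> pure_cone d f 1 ->
  (d <> None -> f 0%N 1%N != 0) /\ (d <> Some 0 -> f 1%N 0%N != 0).
Proof.
move=> _; case: d => [c|] [a a0 fE].
  split=> [_|c0]; first by rewrite -homE fE coefZ expr1 coefB coefX coefC subr0 mulr1.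
  rewrite -homE fE coefZ expr1 coefB coefX coefC sub0r mulrN oppr_eq0 mulf_neq0 //.
  by apply: contra_not_neq c0 => ->.
by split=> // _; rewrite -homE fE coefC.
Qed.

Lemma bl_x_series c (s : fps2 K) : (forall i j, (0 < j)%N -> s i j = 0) -> bl c s = s.
Proof.
move=> s0; apply: fps2P => i j; rewrite blE.
have -> : hpart s i = (s i 0%N)%:P.
  apply/polyP => k; rewrite coef_hom coefC; case: k => [|k]; first by rewrite subn0.
  by rewrite [RHS]/=; case: ifP => // _; apply: s0.
by rewrite comp_polyC coefC; case: j => // j; rewrite /= s0.
Qed.

(* Blowing up along the points of the curve y = s(x): f and y - s(x) both become
   divisible by x^k after k steps, whereas a series in x alone is unchanged. *)
Lemma branch_through_sequence (c : nat -> K) f : irreducible_series f ->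
  (forall k, passes (curve_at f (mkseq (Some \o c) k))) ->
  exists s : fps2 K, [/\ forall i j, (0 < j)%N -> s i j = 0, s 0%N 0%N = 0,
    (forall g, irreducible_series g -> (forall k, passes (curve_at g (mkseq (Some \o c) k))) ->
      same_curve g (Y - s)) & f 0%N 1%N != 0].
Proof.
pose s k : fps2 K := FPS2 (fun i j => if (j == 0%N) && (i != 0%N) then c (k + i.-1)%N else 0).
pose bls k g := iteri k (fun n => bl (c n)) g.
have s0 k i j : (0 < j)%N -> s k i j = 0 by case: j.
have sE k : s k = X * (C (c k) + s k.+1).
  apply: fps2P => -[|i] j; rewrite coef2XM; first by rewrite /= andbF.
  rewrite coef2D; case: j => [|j]; last by rewrite /= andbF addr0.
  by case: i => [|i]; rewrite /= ?addn0 ?addr0 // add0r addnS addSn.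
have blsY k : bls k (Y - s 0%N) = X ^+ k * (Y - s k).
  elim: k => [|k IH]; first by rewrite mul1r.
  rewrite /= -/(bls k _) IH blM blXn blX blB blY bl_x_series; last by move=> i j; apply: s0.
  by rewrite (sE k) exprSr; ring.
have blsM k g h : bls k (g * h) = bls k g * bls k h.
  by elim: k => //= k IH; rewrite -/(bls k _) IH blM.
have blsD k g h : bls k (g + h) = bls k g + bls k h.
  by elim: k => //= k IH; rewrite -/(bls k _) IH blD.
have blsx k g : (forall i j, (0 < j)%N -> g i j = 0) -> bls k g = g.
  by move=> g0; elim: k => //= k IH; rewrite -/(bls k _) IH bl_x_series.
have H g : irreducible_series g -> (forall k, passes (curve_at g (mkseq (Some \o c) k))) ->
    same_curve g (Y - s 0%N).
  move=> gI gp.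
  have blsg k : exists M, (k <= M)%N /\ bls k g = X ^+ M * curve_at g (mkseq (Some \o c) k).
    elim: k => [|k [M [kM IH]]]; first by exists 0%N; rewrite mul1r.
    have gkI := curve_at_irreducible gI (gp k).
    have [m gm] := fps_order_ex (irreducible_neq0 gkI).
    exists (M + m)%N; split.
      by have := fps_order_gt0 gm (gp k); lia.
    rewrite mkseqS curve_at_rcons [bls _ _](_ : _ = bl (c k) (bls k g)) // IH.
    by rewrite blM blXn blX (strict_bl (c k) gm) exprD mulrA.
  have [||q [r [gE r0]]] := @weierstrass_division _ (Y - s 0%N) 1 g.
  - by case=> // _; rewrite coef2B /= subr0.
  - by rewrite coef2B /= subr0 oner_eq0.
  have rr : r = 0.
    apply: fps2P => i j; rewrite coef2_0.
    have [M [kM gM]] := blsg i.+1.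
    have := coef2_congr i j (congr1 (bls i.+1) gE).
    rewrite blsD blsM blsY gM (blsx _ r) // mulrCA coef2D !coef2XnM ltnn.
    by rewrite ifF ?add0r => [<-|] //; lia.
  apply: irreducible_factor (gI) _ _; first by rewrite gE rr addr0 mulrC.
  by rewrite /passes coef2B /= subr0.
move=> fI fp; exists (s 0%N); split=> //; first exact: s0.
have [[u uE] _] := H f fI fp.
have := coef2_congr 0 1 uE; rewrite coef2B coef2_row0M !big_ord_recl big_ord0 /= subr0 addr0.
rewrite (irreducible_passes fI) mulr0 addr0 => /eqP; apply: contraTneq => ->.
by rewrite mulr0 oner_eq0.
Qed.

Definition simple_x w := [/\ x_invariant w, w.1 0%N 0%N = 0 & nonresonant w].

Lemma linear_coefs w : w.1 0%N 0%N = 0 -> w.2 0%N 0%N = 0 ->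
  w.1 0%N 1%N != 0 \/ w.2 1%N 0%N != 0 -> form_order w 1.
Proof.
move=> a0 b0 w0; split.
- by case=> // _; rewrite hom00 a0.
- by case=> // _; rewrite hom00 b0.
- case: w0 => w0; [left|right]; apply: contraNneq w0 => E.
    by rewrite -homE E coef0.
  by rewrite -homE E coef0.
Qed.

Lemma cone1E w c : (cone w 1).[c] = w.1 1%N 0%N + (w.1 0%N 1%N + w.2 1%N 0%N) * c + w.2 0%N 1%N * c ^+ 2.
Proof.
have hE f : hpart f 1 = (f 1%N 0%N)%:P + f 0%N 1%N *: 'X.
  apply/polyP => j; rewrite coef_hom coefD coefZ coefC coefX.
  by case: j => [|[|j]] //=; rewrite ?mulr0 ?addr0 ?add0r ?mulr1.
by rewrite /cone !hE !(hornerD, hornerM, hornerZ, hornerX, hornerC); ring.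
Qed.

Lemma dcone1E w c : (cone w 1)^`().[c] = w.1 0%N 1%N + w.2 1%N 0%N + w.2 0%N 1%N * c *+ 2.
Proof.
have hE f : hpart f 1 = (f 1%N 0%N)%:P + f 0%N 1%N *: 'X.
  apply/polyP => j; rewrite coef_hom coefD coefZ coefC coefX.
  by case: j => [|[|j]] //=; rewrite ?mulr0 ?addr0 ?add0r ?mulr1.
by rewrite /cone !hE !derivE !(hornerD, hornerM, hornerZ, hornerX, hornerC); ring.
Qed.

Lemma hpart1E f c : (hpart f 1).[c] = f 1%N 0%N + f 0%N 1%N * c.
Proof.
have -> : hpart f 1 = (f 1%N 0%N)%:P + f 0%N 1%N *: 'X.
  apply/polyP => j; rewrite coef_hom coefD coefZ coefC coefX.
  by case: j => [|[|j]] //=; rewrite ?mulr0 ?addr0 ?add0r ?mulr1.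
by rewrite !hornerE.
Qed.

End Separatrices.

(** * Uniqueness of the branch at simple and at regular points *)

Section SimplePoints.
Variable K : numClosedFieldType.
Implicit Types (f g h u v : fps2 K) (c : K) (d : direction K) (w : one_form K).

Lemma coef_cone w n j : (cone w n)`_j =
  (if (j <= n)%N then w.1 (n - j)%N j else 0) + (if (0 < j <= n.+1)%N then w.2 (n.+1 - j)%N j.-1 else 0).
Proof.
rewrite /cone coefD coefXM coef_hom; congr (_ + _).
by case: j => [|j] //=; rewrite coef_hom ltnS subSS.
Qed.

Lemma cone_swap w n j : (j <= n.+1)%N -> (cone (swap_form w) n)`_j = (cone w n)`_(n.+1 - j).
Proof.
move=> jn; rewrite !coef_cone /= addrC; congr (_ + _).
  case: j jn => [|j] jn; first by rewrite ifF //; lia.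
  by rewrite /= jn ifT; [congr (w.1 _ _); lia|lia].
case: ifP => jn1; last by rewrite ifF //; lia.
by rewrite ifT; [congr (w.2 _ _); lia|lia].
Qed.

Lemma size_cone w n : (size (cone w n) <= n.+2)%N.
Proof.
apply/leq_sizeP => j nj; rewrite coef_cone !ifF ?addr0 //; lia.
Qed.

Lemma cone_swap_eq0 w n : (cone (swap_form w) n == 0) = (cone w n == 0).
Proof.
have H (v : one_form K) : cone v n = 0 -> cone (swap_form v) n = 0.
  move=> E; apply/polyP => j; rewrite coef0; have [jn|nj] := leqP j n.+1.
    by rewrite cone_swap // E coef0.
  by rewrite nth_default // (leq_trans (size_cone _ _)).
by apply/eqP/eqP => /H //; rewrite /swap_form /= !swapK -surjective_pairing.
Qed.

Lemma div_order_swap w n : div_order (swap_form w) n = div_order w n.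
Proof. by rewrite /div_order cone_swap_eq0. Qed.

Section NondicriticalChild.
Variables (w : one_form K) (n : nat).
Hypotheses (wn : form_order w n) (w0 : cone w n != 0).

Lemma nondicritical_some c : let w' := foliation_transform w (Some c) in
  [/\ x_invariant w', w'.1 0%N 0%N = (cone w n).[c], w'.1 0%N 1%N = (cone w n)^`().[c]
    & w'.2 1%N 0%N = (hpart w.2 n).[c]].
Proof.
have dE : div_order w n = n by rewrite /div_order (negPf w0) addn0.
split.
- by move=> j; apply: child2_nondicritical wn _ w0.
- by rewrite (child1 _ wn) dE coef0_shift.
- by rewrite (child1 _ wn) dE coef1_shift.
- by rewrite (child2_nondicriticalS _ wn) // coef0_shift.
Qed.

End NondicriticalChild.

Lemma coef_none1 w n i : form_order w n ->
  (foliation_transform w None).1 i 0%N = w.2 0%N (i + div_order w n)%N.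
Proof.
move=> wn; rewrite foliation_none (child1 _ (swap_form_order wn)) div_order_swap.
by rewrite polyC0 addr0 comp_polyXr coef_cone /= subn0 addr0.
Qed.

Lemma coef_some0_1 w n i : form_order w n ->
  (foliation_transform w (Some 0)).1 i 0%N = w.1 (i + div_order w n)%N 0%N.
Proof.
move=> wn; rewrite (child1 _ wn) polyC0 addr0 comp_polyXr coef_cone /= subn0 addr0.
by [].
Qed.

Lemma nondicritical_none w n : form_order w n -> cone w n != 0 ->
  let w' := foliation_transform w None in
  [/\ x_invariant w', w'.1 0%N 0%N = w.2 0%N n, w'.1 0%N 1%N = (cone w n)`_n
    & w'.2 1%N 0%N = w.1 0%N n].
Proof.
move=> wn w0; rewrite foliation_none.
have sn := swap_form_order wn.
have s0 : cone (swap_form w) n != 0 by rewrite cone_swap_eq0.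
have [H1 H2 H3 H4] := nondicritical_some sn s0 0.
split=> //.
- by rewrite H2 horner_coef0 coef_cone /= subn0 addr0.
- by rewrite H3 horner_coef0 coef_deriv mulr1n cone_swap // subn1.
- by rewrite H4 horner_coef0 coef_hom subn0.
Qed.

Lemma nonresonant11 w : nonresonant w -> w.1 0%N 1%N + w.2 1%N 0%N != 0.
Proof. by move=> /(_ 1%N 1%N isT isT); rewrite !mulr1n addrC. Qed.

Lemma nonresonant_neq0 w : nonresonant w -> w.1 0%N 1%N != 0 \/ w.2 1%N 0%N != 0.
Proof.
move=> /nonresonant11; have [->|w1] := eqVneq (w.1 0%N 1%N) 0; last by left.
by rewrite add0r; right.
Qed.

Lemma simple_order w : simple_x w -> form_order w 1.
Proof. by move=> [wx a0 /nonresonant_neq0]; apply: linear_coefs. Qed.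

Lemma simple_cone w : simple_x w ->
  forall c, (cone w 1).[c] = w.1 1%N 0%N + (w.1 0%N 1%N + w.2 1%N 0%N) * c.
Proof. by move=> [wx _ _] c; rewrite cone1E wx mul0r addr0. Qed.

Lemma simple_cone_neq0 w : simple_x w -> cone w 1 != 0.
Proof.
move=> ws; have [_ _ /nonresonant11 w0] := ws; apply: contraNneq w0 => E.
have := simple_cone ws 1; have := simple_cone ws 0.
by rewrite E !horner0 mulr0 addr0 mulr1 => <- /esym; rewrite add0r => /eqP.
Qed.

(** As b vanishes on x = 0, the cone has degree one, with a single root c. A resonance (m, n) at
    that point would be a resonance (m + n, n) of w, and one at the corner [None] a resonance (n, m
    + n). So c is again simple and the corner carries no further branch. *)
Lemma simple_direction w : simple_x w -> exists c,
  simple_x (foliation_transform w (Some c)) /\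
  forall f d, branch w f -> nzx f -> passes (strict_transform f d) -> d = Some c.
Proof.
move=> ws; have [wx a0 wr] := ws; have s0 := nonresonant11 wr.
have wn := simple_order ws; have w0 := simple_cone_neq0 ws.
exists (- w.1 1%N 0%N / (w.1 0%N 1%N + w.2 1%N 0%N)); set c := _ / _.
have cE : w.1 1%N 0%N + (w.1 0%N 1%N + w.2 1%N 0%N) * c = 0.
  by rewrite /c mulrCA mulfV // mulr1 subrr.
split.
  have [H1 H2 H3 H4] := nondicritical_some wn w0 c.
  split; [done|by rewrite H2 simple_cone|] => m n m0 n0.
  rewrite H3 H4 dcone1E hpart1E wx !mul0r mul0rn !addr0.
  have := wr (m + n)%N n; rewrite addn_gt0 m0 n0 => /(_ isT isT).
  by rewrite mulrnDr mulrnDl [_ *+ n + _ *+ n]addrC addrA.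
move=> f [c'|] wf fx fd; have [fI fp fw] := branch_strict wn wf fd; have f0 : f <> 0 by apply: irreducible_neq0; case: wf.
  congr Some; apply/eqP; apply: contraT => cc; exfalso.
  have [H1 H2 H3 H4] := nondicritical_some wn w0 c'.
  apply: (no_branch_regular_x H1 _ fp (nzx_strict _ f0) fw).
  rewrite H2 simple_cone //; apply: contra cc => /eqP E; apply/eqP/(mulfI s0)/(addrI (w.1 1%N 0%N)).
  by rewrite E cE.
have [H1 H2 H3 H4] := nondicritical_none wn w0.
apply: False_ind; apply: (no_branch_corner H1 _ _ (H1 0%N) _ fp (nzx_strict _ f0) _ fw).
- by move=> i; rewrite (coef_none1 _ wn) wx.
- by rewrite H2 wx.
- move=> m n m0 n0; rewrite H3 H4 coef_cone /= subSS subnn /=.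
  have := wr n (m + n)%N; rewrite addn_gt0 m0 n0 => /(_ isT isT).
  by apply: contra => /eqP <-; rewrite mulrnDl mulrnDr; apply/eqP; ring.
- exact: nzy_strict_none.
Qed.

Lemma branch_nzx_strict w f d n : form_order w n -> branch w f -> passes (strict_transform f d) ->
  branch (foliation_transform w d) (strict_transform f d) /\ nzx (strict_transform f d).
Proof.
move=> wn wf fd; split; first exact: branch_strict wn wf fd.
by apply: nzx_strict; apply: irreducible_neq0; case: wf.
Qed.

(** All branches other than x = 0 follow the same directions [Some c] forever, and
    [branch_through_sequence] identifies them. Being formal, the argument covers saddle-nodes as
    well. *)
Lemma simple_branches w f g : simple_x w -> branch w f -> nzx f -> branch w g -> nzx g ->
  same_curve f g /\ f 0%N 1%N != 0.
Proof.
move=> ws; pose cs (v : one_form K) : K := xget 0 [set c | simple_x (foliation_transform v (Some c)) /\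
  forall f d, branch v f -> nzx f -> passes (strict_transform f d) -> d = Some c].
have csP (v : one_form K) : simple_x v -> simple_x (foliation_transform v (Some (cs v))) /\
  forall f d, branch v f -> nzx f -> passes (strict_transform f d) -> d = Some (cs v).
  by move=> /simple_direction vc; apply: (@xgetPex _ 0 [set c | simple_x _ /\ _] vc).
pose W k := iter k (fun v : one_form K => foliation_transform v (Some (cs v))) w.
have Ws k : simple_x (W k) by elim: k => //= k IH; case: (csP _ IH).
pose c k := cs (W k).
have H h : branch w h -> nzx h -> forall k, passes (curve_at h (mkseq (Some \o c) k)).
  move=> wh hx k; suff [[]] : branch (W k) (curve_at h (mkseq (Some \o c) k)) /\
    nzx (curve_at h (mkseq (Some \o c) k)) by [].
  elim: k => // k [IH IHx]; rewrite mkseqS curve_at_rcons.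
  have [kI _ _] := IH; have [d dP] := passes_some_direction kI.
  have dE := (csP _ (Ws k)).2 _ _ IH IHx dP; rewrite dE in dP.
  exact: branch_nzx_strict (simple_order (Ws k)) IH dP.
move=> wf fx wg gx; have [fI _ _] := wf; have [gI _ _] := wg.
have [s [_ _ sP f1]] := branch_through_sequence fI (H f wf fx).
split=> //; apply: same_curve_trans (sP f fI (H f wf fx)) _.
by apply: same_curve_sym; apply: sP gI (H g wg gx).
Qed.

(** Blowing up the regular point creates a single singular point on the exceptional line. It is
    simple, with eigenvalues b(0) and - b(0), and its uniqueness statement descends to the leaf. *)
Lemma leaf_transverse w f g : w.2 0%N 0%N != 0 -> branch w f -> branch w g ->
  same_curve f g /\ f 0%N 1%N != 0.
Proof.
move=> b0 wf wg; set a0 := w.1 0%N 0%N.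
have wn : form_order w 0.
  by split=> //; right; rewrite hom00 polyC_eq0.
have coneE : cone w 0 = a0%:P + w.2 0%N 0%N *: 'X.
  by rewrite /cone !hom00 mulrC mul_polyC.
have w0 : cone w 0 != 0.
  by apply: contraNneq b0 => /(congr1 (coefp 1)); rewrite /= coneE coefD coefC coefZ coefX mulr1 add0r coef0 => ->.
pose c := - a0 / w.2 0%N 0%N.
have cE : a0 + w.2 0%N 0%N * c = 0 by rewrite /c mulrCA mulfV // mulr1 subrr.
have coneV x : (cone w 0).[x] = a0 + w.2 0%N 0%N * x.
  by rewrite coneE hornerD hornerC hornerZ hornerX.
have ws : simple_x (foliation_transform w (Some c)).
  have [H1 H2 H3 H4] := nondicritical_some wn w0 c.
  split; [done|by rewrite H2 coneV|] => m n m0 n0.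
  rewrite H3 H4 hom00 hornerC coneE derivD derivC derivZ derivX add0r hornerZ hornerC mulr1.
  by rewrite -mulrnDr mulrn_eq0 negb_or b0 andbT; lia.
have dirE h d : branch w h -> passes (strict_transform h d) -> d = Some c.
  move=> wh hd; have [[hI hp hw] hx] := branch_nzx_strict wn wh hd; case: d hd hI hp hw hx => [c'|] hd hI hp hw hx.
    congr Some; apply/eqP; apply: contraT => cc; exfalso.
    have [H1 H2 _ _] := nondicritical_some wn w0 c'.
    apply: (no_branch_regular_x H1 _ hp hx hw).
    rewrite H2 coneV; apply: contra cc => /eqP E; apply/eqP/(mulfI b0)/(addrI a0).
    by rewrite E cE.
  have [H1 H2 _ _] := nondicritical_none wn w0.
  by exfalso; apply: (no_branch_regular_x H1 _ hp hx hw); rewrite H2.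
have dirP h : branch w h -> passes (strict_transform h (Some c)).
  by move=> wh; have [hI _ _] := wh; have [d hd] := passes_some_direction hI; rewrite -(dirE _ _ wh hd).
have [wf' fx'] := branch_nzx_strict wn wf (dirP _ wf).
have [wg' gx'] := branch_nzx_strict wn wg (dirP _ wg).
have [[_ fg] f1] := simple_branches ws wf' fx' wg' gx'.
have [fI _ _] := wf; have [gI _ _] := wg.
split; first exact: strict_same fI gI (dirP _ wf) (dirP _ wg) fg.
have [fo fpure] := transverse_strict fI (dirP _ wf) f1.
by have [f01 _] := pure_coefs fo fpure; apply: f01.
Qed.

Lemma branch_swap w f : branch w f -> branch (swap_form w) (swap f).
Proof.
by move=> [fI fp fw]; split; [apply: irreducible_swap|apply: fp|apply: invariant_swap].
Qed.

Lemma leaf w f g : w.1 0%N 0%N != 0 \/ w.2 0%N 0%N != 0 -> branch w f -> branch w g ->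
  same_curve f g /\ smooth f.
Proof.
move=> w0 wf wg; have [b0|b0] := eqVneq (w.2 0%N 0%N) 0; last first.
  by have [fg f1] := leaf_transverse b0 wf wg; split=> //; right.
have a0 : w.1 0%N 0%N != 0 by case: w0 => //; rewrite b0 eqxx.
have [fg f1] := @leaf_transverse (swap_form w) _ _ a0 (branch_swap wf) (branch_swap wg).
by split; [apply: same_curve_swap|left].
Qed.

End SimplePoints.

(** * The logarithmic Milnor number *)

Section LogarithmicMilnor.
Variable K : numClosedFieldType.
Implicit Types (f g h u v : fps2 K) (c : K) (d : direction K) (w : one_form K) (ex ey : bool).
Notation X := (fps2_x K).
Notation Y := (fps2_y K).
Notation C := (@fps2_const K).

(* With ex, ey telling whether x = 0, y = 0 count as invariant components,
   w = y^ey (log1 w ey) dx + x^ex (log2 w ex) dy. *)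
Definition log1 w ey := if ey then FPS2 (fun i j => w.1 i j.+1) else w.1.
Definition log2 w ex := if ex then FPS2 (fun i j => w.2 i.+1 j) else w.2.

Definition log_form w ex ey := (ex -> x_invariant w) /\ (ey -> y_invariant w).

Lemma log1E w ex ey : log_form w ex ey -> w.1 = Y ^+ ey * log1 w ey.
Proof.
case: ey => -[_ wy]; last by rewrite expr0 mul1r.
apply: fps2P => i j; rewrite expr1 coef2YM; case: j => // ; exact: wy.
Qed.

Lemma log2E w ex ey : log_form w ex ey -> w.2 = X ^+ ex * log2 w ex.
Proof.
case: ex => -[wx _]; last by rewrite expr0 mul1r.
apply: fps2P => i j; rewrite expr1 coef2XM; case: i => //; exact: wx.
Qed.

Lemma swap_log_form w ex ey : log_form w ex ey -> log_form (swap_form w) ey ex.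
Proof. by case. Qed.

Definition log_codim_ge w ex ey :=
  codim_ge (in_ideal2 (log1 w ey) (log2 w ex)) (fun=> True).

Lemma codim_ge_swap f g n : codim_ge (in_ideal2 f g) (fun=> True) n ->
  codim_ge (in_ideal2 (swap g) (swap f)) (fun=> True) n.
Proof.
move=> [e _ eI]; exists (fun i => swap (e i)) => // a [u [v E]]; apply: eI.
exists (swap v), (swap u); rewrite -[lincomb a e]swapK swap_lincomb E swapD !swapM !swapK.
by rewrite addrC.
Qed.

Lemma log_codim_swap w ex ey n : log_codim_ge w ex ey n -> log_codim_ge (swap_form w) ey ex n.
Proof.
by move=> /codim_ge_swap; rewrite /log_codim_ge /log1 /log2; case: ex; case: ey.
Qed.

Lemma log_codim_swapK w ex ey n : log_codim_ge (swap_form w) ey ex n -> log_codim_ge w ex ey n.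
Proof. by move=> /log_codim_swap; rewrite /swap_form /= !swapK -surjective_pairing. Qed.

Lemma vanish_mulX k f n : vanish (X ^+ k * f) n -> vanish f (n - k).
Proof.
move=> /vanishP fn; apply/vanishP => i j ij; have := fn (k + i)%N j.
by rewrite coef2XnM leq_addr addKn; apply; lia.
Qed.

Lemma vanish_mulY k f n : vanish (Y ^+ k * f) n -> vanish f (n - k).
Proof.
move=> /vanish_swap; rewrite swapM swapXn swapY => /vanish_mulX/vanish_swap.
by rewrite swapK.
Qed.

Lemma hpart_mulX k f n : (k <= n)%N -> hpart (X ^+ k * f) n != 0 -> hpart f (n - k) != 0.
Proof.
move=> kn; apply: contraNneq => E; apply/eqP/polyP => j; rewrite coef_hom coef0 coef2XnM.
case: ifP => // jn; case: ifP => // kj; rewrite -homE.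
have -> : (n - j - k + j = n - k)%N by lia.
by rewrite E coef0.
Qed.

Lemma hpart_mulY k f n : (k <= n)%N -> hpart (Y ^+ k * f) n != 0 -> hpart f (n - k) != 0.
Proof.
move=> kn H; have E : hpart (X ^+ k * swap f) n != 0.
  by apply: contraNneq H => /hom_swap_eq0; rewrite swapM swapXn swapX swapK => ->.
have := hpart_mulX kn E; apply: contraNneq => /hom_swap_eq0 -> //.
Qed.

Lemma noether_inequality' c f g (F G : fps2 K) m n k :
  vanish f m -> vanish g n -> (0 < m + n)%N -> hpart f m != 0 \/ hpart g n != 0 ->
  bl c f = X ^+ m * F -> bl c g = X ^+ n * G ->
  codim_ge (in_ideal2 F G) (fun=> True) k ->
  codim_ge (in_ideal2 f g) (fun=> True) (m * n + k).
Proof.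
move=> fm gn mn [f0|g0] FE GE; first exact: noether_inequality FE GE.
have sw (s t : fps2 K) z : in_ideal2 s t z -> in_ideal2 t s z.
  by move=> [u [v ->]]; exists v, u; rewrite addrC.
move=> /(codim_geW (@sw _ _) (fun _ => id)) H; apply: (codim_geW (@sw _ _) (fun _ => id)).
by rewrite mulnC; apply: noether_inequality GE FE H => //; rewrite addnC.
Qed.

(** The second axis at the new point is the old y = 0 in direction [Some 0] and the old x = 0 in
    direction [None]; in other directions there is none. *)
Definition child_ey ex ey d := if d is Some c then ey && (c == 0) else ex.

Lemma child_log_form w ex ey d n : form_order w n -> log_form w ex ey ->
  log_form (foliation_transform w d) (cone w n != 0) (child_ey ex ey d).
Proof.
move=> wn [wx wy]; split.
  move=> w0; case: d => [c|]; first by case: (nondicritical_some wn w0 c).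
  by case: (nondicritical_none wn w0).
case: d => [c /andP[/wy {}wy /eqP ->]|/= /wx {}wx] i.
  by rewrite (coef_some0_1 _ wn) wy.
by rewrite (coef_none1 _ wn) wx.
Qed.

(** Noether's inequality applies to the logarithmic coefficients; it remains to see that their
    virtual transforms F and G lie in the logarithmic ideal upstairs. G is the new second
    coefficient itself, and F is a combination of the two new coefficients. *)
Lemma log_codim_child w ex ey d n k : form_order w n -> log_form w ex ey ->
  (ex <= n)%N -> (ey <= n)%N -> (ex + ey < n + n)%N ->
  log_codim_ge (foliation_transform w d) (cone w n != 0) (child_ey ex ey d) k ->
  log_codim_ge w ex ey ((n - ey) * (n - ex) + k).
Proof.
wlog [c ->] : w ex ey d / exists c, d = Some c.
  case: d => [c|]; first by apply; exists c.
  move=> H wn wl exn eyn en; rewrite foliation_none -cone_swap_eq0 => Hk.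
  apply: log_codim_swapK; rewrite mulnC; apply: (H _ _ _ (Some 0)) => //.
  - by exists 0.
  - exact: swap_form_order.
  - exact: swap_log_form.
  - by rewrite addnC.
  - by rewrite /child_ey eqxx andbT.
move=> wn wl exn eyn en.
have aE := log1E wl; have bE := log2E wl; have [an bn w0] := wn.
set A := log1 w ey in aE *; set B := log2 w ex in bE *.
have An : vanish A (n - ey) by apply: vanish_mulY; rewrite -aE.
have Bn : vanish B (n - ex) by apply: vanish_mulX; rewrite -bE.
have A0B0 : hpart A (n - ey) != 0 \/ hpart B (n - ex) != 0.
  case: w0 => w0; [left|right].
    by apply: hpart_mulY; rewrite // -aE.
  by apply: hpart_mulX; rewrite // -bE.
have [F FE] := vanish_bl c An; have [G GE] := vanish_bl c Bn.
move=> Hk; apply: (noether_inequality' An Bn _ A0B0 FE GE); first by lia.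
apply: codim_geW Hk => // z.
have [E1 E2] := foliation_some c wn; have := child_log_form (Some c) wn wl.
set w' := foliation_transform w _ in E1 E2 *.
set dl : nat := (cone w n == 0) => wl'.
have nE : div_order w n = (n + dl)%N by [].
have bGE : bl c w.2 = X ^+ n * G.
  by rewrite bE blM blXn blX GE mulrA -exprD subnKC.
have B'E : log2 w' (cone w n != 0) = G.
  have := log2E wl'; set B' := log2 _ _ => w2E.
  apply: (@mulXI _ n.+1) => /=; rewrite w2E nE bGE in E2.
  rewrite [in RHS]exprS -mulrA -E2 mulrA -exprD; congr (_ ^+ _ * _).
  by rewrite /dl; case: eqP => _ /=; lia.
have A'E : X ^+ dl * w'.1 = (Y + C c) ^+ ey * F + (Y + C c) * G.
  apply: (@mulXI _ n) => /=; rewrite mulrA -exprD -nE E1 bGE aE blM blXn blY FE.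
  have -> : X ^+ n = X ^+ ey * X ^+ (n - ey) by rewrite -exprD subnKC.
  by rewrite exprMn; ring.
(* If y = 0 is invariant, a factor y + c has to be removed: for c = 0 it is the equation of the
   surviving component and cancels, otherwise it is a unit. *)
have FJ : exists u v, F = u * log1 w' (child_ey ex ey (Some c)) + v * G.
  have := log1E wl'; set A' := log1 _ _ => w1E.
  move: w1E; rewrite /child_ey; case eyE: ey A'E => /=.
    case: eqP => [c0|/eqP c0] A'E w1E.
      exists (X ^+ dl), (-1); apply: mulYI => /=.
      have := A'E; rewrite w1E c0 const0 addr0 !expr1 => E.
      by rewrite mulrDr mulN1r mulrN mulrCA E; ring.
    have Yc : Y + C c \is a GRing.unit by apply/unit_coef; rewrite coef2D /= add0r.
    exists ((Y + C c)^-1 * X ^+ dl), (-1); rewrite expr0 mul1r in w1E.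
    by rewrite -w1E -mulrA A'E expr1 mulrDr mulrA mulVr // mul1r mulrA mulVr //; ring.
  move=> A'E w1E; exists (X ^+ dl), (- (Y + C c)); rewrite expr0 mul1r in w1E.
  by rewrite -w1E A'E expr0; ring.
have [s [t FE']] := FJ; rewrite B'E => -[u [v ->]].
by exists (u * s), (u * t + v); rewrite FE'; ring.
Qed.

(* Twice the logarithmic Milnor number, plus one if exactly one of the axes is
   an invariant component: this strictly decreases from a bad point to the bad
   points of its blow-up. *)
Definition milnor_weight_le w ex ey n :=
  forall k, log_codim_ge w ex ey k -> (k.*2 + (ex (+) ey) <= n)%N.

Definition bad w ex ey := singular w /\ (ex || ey -> w.1 0%N 1%N = 0 /\ w.2 1%N 0%N = 0).

Lemma codim_ge0 (U V : fps2 K -> Prop) : codim_ge U V 0.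
Proof. by exists (fun=> 0) => [[]|a _ []]. Qed.

Lemma form_order_gt0 w n : form_order w n -> singular w -> (0 < n)%N.
Proof.
move=> [_ _ w0] [a0 b0]; case: n w0 => // [[]]; by rewrite hom00 polyC_eq0 ?a0 ?b0 eqxx.
Qed.

(** At a bad corner the whole linear part vanishes: two coefficients because the axes are invariant,
    the other two by badness. *)
Lemma bad_order w ex ey n : form_order w n -> log_form w ex ey -> bad w ex ey ->
  [/\ (0 < n)%N, ex && ey -> (1 < n)%N & (ex + ey < n + n)%N].
Proof.
move=> wn [wx wy] [ws wb]; have n0 := form_order_gt0 wn ws.
have H : ex && ey -> (1 < n)%N.
  move=> /andP[exT eyT]; case: n wn n0 => [|[|n]] // wn _; exfalso.
  have [a01 b10] := wb ltac:(by rewrite exT).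
  have hE f : f 1%N 0%N = 0 -> f 0%N 1%N = 0 -> hpart f 1 = 0.
    move=> f1 f2; apply/polyP => j; rewrite coef_hom coef0.
    by case: j => [|[|j]] //=; rewrite ?f1 ?f2.
  by have [_ _ []] := wn; rewrite hE ?eqxx //; [apply: wy|apply: wx].
split=> //; case: ex ey H {wx wy wb} => [] [] /=; lia.
Qed.

(** Even with nothing left upstairs, the codimension is at least (n - ey)(n - ex). Bounding n this
    way bounds the number of special directions and the new tangency orders. *)
Lemma milnor_weight_order w ex ey n k : form_order w n -> log_form w ex ey -> bad w ex ey ->
  milnor_weight_le w ex ey k -> (n <= k.+1)%N.
Proof.
move=> wn wl wb /[dup] wk; have [n0 n1 en] := bad_order wn wl wb.
have := log_codim_child (d := Some 0) (k := 0%N) wn wl _ _ en (codim_ge0 _ _).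
move=> H /(_ _ (H _ _)); rewrite addn0 => /(_ ltac:(by case: (ex); lia) ltac:(by case: (ey); lia)).
by case: (ex); case: (ey) => /=; nia.
Qed.

Lemma milnor_weight_child w ex ey d n k : form_order w n -> log_form w ex ey -> bad w ex ey ->
  bad (foliation_transform w d) (cone w n != 0) (child_ey ex ey d) ->
  milnor_weight_le w ex ey k.+1 ->
  milnor_weight_le (foliation_transform w d) (cone w n != 0) (child_ey ex ey d) k.
Proof.
move=> wn wl wb wb' wk m; have [n0 n1 en] := bad_order wn wl wb.
move=> /(log_codim_child wn wl) => /(_ ltac:(by case: (ex); lia) ltac:(by case: (ey); lia) en) /wk.
(* The only case in which (n - ey)(n - ex) vanishes. The cone is then a nonzero monomial, and the
   only singular direction is that of the invariant axis itself, so that two invariant components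
   meet at the new point. *)
case E: ((ex (+) ey) && (n == 1%N)); last first.
  move: E.
  case: (ex) (ey) n1 => [] [] /= n1; rewrite ?addn0 ?addn1 => Hn; case: (_ (+) _) => /=; move: Hn; nia.
move: E => /andP[exy /eqP nE]; suff /negPf -> : ~~ ((cone w n != 0) (+) child_ey ex ey d) by lia.
rewrite nE in wn wb' *; have [[a0 b0] wl1] := wb.
have [a01 b10] := wl1 ltac:(by case: (ex) (ey) exy => [] []).
have coneE c : (cone w 1).[c] = w.1 1%N 0%N + w.2 0%N 1%N * c ^+ 2.
  by rewrite cone1E a01 b10 addr0 mul0r addr0.
have [wx wy] := wl; have [_ _ w0] := wn.
have w0' : w.1 1%N 0%N != 0 \/ w.2 0%N 1%N != 0.
  have hE f : f 1%N 0%N = 0 -> f 0%N 1%N = 0 -> hpart f 1 = 0.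
    move=> f1 f2; apply/polyP => j; rewrite coef_hom coef0.
    by case: j => [|[|j]] //=; rewrite ?f1 ?f2.
  have [a10|] := eqVneq (w.1 1%N 0%N) 0; last by left.
  have [b01|] := eqVneq (w.2 0%N 1%N) 0; last by right.
  by case: w0 => /eqP []; apply: hE.
have c0 : cone w 1 != 0.
  apply/negP => /eqP E; have := coneE 0; have := coneE 1.
  rewrite E !horner0 expr0n mulr0 addr0 expr1n mulr1 => + /esym a10.
  by rewrite a10 add0r => /esym b01; case: w0'; rewrite ?a10 ?b01 eqxx.
rewrite c0 /=; have [[a0' _] _] := wb'.
case: d a0' {wb'} => [c|] a0' /=.
  have [_ H2 _ _] := nondicritical_some wn c0 c; rewrite H2 coneE in a0'.
  case exE: ex exy wx => /=.
    move=> _ wx; move: a0'; rewrite (wx isT) mul0r addr0 => a10.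
    by case: w0'; rewrite ?a10 ?(wx isT) eqxx.
  move=> eyE _; rewrite eyE /=; apply/negPn; move: a0'; rewrite (wy eyE) add0r => /eqP.
  rewrite mulf_eq0 sqrf_eq0 => /orP[/eqP b01|//].
  by case: w0'; rewrite ?b01 ?(wy eyE) eqxx.
have [_ H2 _ _] := nondicritical_none wn c0; rewrite H2 in a0'.
rewrite negbK; case exE: ex exy => //= eyE.
by case: w0'; rewrite ?a0' ?(wy eyE) eqxx.
Qed.

End LogarithmicMilnor.

(* The status of the axis x = 0, or y = 0, at an infinitely near point:
   not in the exceptional divisor, or a component of the given type. *)
Inductive side := Absent | Invariant | Dicritical.

Definition is_inv s := if s is Invariant then true else false.
Definition present s := if s is Absent then false else true.

(** * Invariant and dicritical components through an infinitely near point *)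

Section PointStates.
Variable K : numClosedFieldType.
Implicit Types (f g h u v : fps2 K) (c : K) (d : direction K) (w : one_form K).
Implicit Types (p q z : inpoint K) (sx sy : side).

(* t bounds the tangency order of the foliation with the dicritical
   components through the point. *)
Definition x_side s t w := match s with
  | Absent => True
  | Invariant => x_invariant w
  | Dicritical => exists2 j, (j <= t)%N & w.2 0%N j != 0
  end.
Definition y_side s t w := match s with
  | Absent => True
  | Invariant => y_invariant w
  | Dicritical => exists2 i, (i <= t)%N & w.1 i 0%N != 0
  end.

Definition state w sx sy t := x_side sx t w /\ y_side sy t w.

Lemma state_log_form w sx sy t : state w sx sy t -> log_form w (is_inv sx) (is_inv sy).
Proof. by case: sx => -[wx wy]; case: sy wy. Qed.

Definition child_sx w n := if cone w n == 0 then Dicritical else Invariant.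
Definition child_sy sx sy d := match d with
  | Some c => if c == 0 then sy else Absent
  | None => sx
  end.

Lemma child_sxE w n : is_inv (child_sx w n) = (cone w n != 0).
Proof. by rewrite /child_sx; case: eqP. Qed.
Lemma child_syE sx sy d : is_inv (child_sy sx sy d) = child_ey (is_inv sx) (is_inv sy) d.
Proof. by case: d => [c|] //=; case: eqP; rewrite ?andbT ?andbF. Qed.

(** In the dicritical case the coefficient of y^n in b vanishes as well, being the top coefficient
    of the cone; this matches the additional factor x divided out. *)
Lemma row_bound w n j : form_order w n -> w.2 0%N j != 0 -> (div_order w n <= j)%N.
Proof.
move=> [_ /vanishP bn _] bj; have nj : (n <= j)%N.
  by rewrite leqNgt; apply: contra bj => jn; apply/eqP/bn.
rewrite /div_order; case: eqP => [E|]; rewrite ?addn0 ?addn1 // ltn_neqAle nj andbT.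
apply: contra bj => /eqP <-; have := coef_cone w n n.+1; rewrite E coef0 ltnn add0r leqnn /=.
by rewrite subnn => /esym ->.
Qed.

Lemma col_bound w n i : form_order w n -> w.1 i 0%N != 0 -> (div_order w n <= i)%N.
Proof.
by move=> /swap_form_order wn wi; rewrite -div_order_swap; apply: row_bound wn _.
Qed.

(** On a new dicritical line b restricts to a nonzero polynomial of degree at most n, so the
    tangency order is at most n. On an older component it does not increase, since [div_order w n]
    is subtracted. *)
Lemma child_state w sx sy t d n : form_order w n -> state w sx sy t ->
  state (foliation_transform w d) (child_sx w n) (child_sy sx sy d) (maxn t n).
Proof.
move=> wn [wx wy]; split.
  rewrite /child_sx; case: eqP => [E|/eqP w0] /=; last first.
    by case: d => [c|]; [case: (nondicritical_some wn w0 c)|case: (nondicritical_none wn w0)].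
  wlog [c ->] : w wn E d {wx wy} / exists c, d = Some c.
    case: d => [c|]; first by apply=> //; exists c.
    rewrite foliation_none => H; apply: H; [exact: swap_form_order| |by exists 0].
    by apply/eqP; rewrite cone_swap_eq0; apply/eqP.
  have b0 : hpart w.2 n != 0.
    have [_ _ [a0|//]] := wn; apply: contraNneq a0 => b0.
    by move: E; rewrite /cone b0 mulr0 addr0 => ->.
  have [||s [sn _ ps]] := @poly_yorder _ (hpart w.2 n \Po ('X + c%:P)) n.
  - by rewrite comp_poly_shift_eq0.
  - by rewrite size_comp_poly2 ?size_hom // -[c]opprK polyCN size_XsubC.
  - exists s; first by rewrite leq_max sn orbT.
    by rewrite (child2_dicritical _ wn).
case: d => [c|] /=; last first.
  case: sx wx => //= [wx i|[j jt wj]]; first by rewrite (coef_none1 _ wn) wx.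
  have jN := row_bound wn wj; exists (j - div_order w n)%N; first by rewrite leq_max; lia.
  by rewrite (coef_none1 _ wn) subnK.
case: eqP => // ->; case: sy wy => //= [wy i|[i it wi]]; first by rewrite (coef_some0_1 _ wn) wy.
have iN := col_bound wn wi; exists (i - div_order w n)%N; first by rewrite leq_max; lia.
by rewrite (coef_some0_1 _ wn) subnK.
Qed.

(* [ycomp q]: besides the last exceptional line x = 0, a second component of
   the divisor passes through q; it is then y = 0. *)
Definition comps q : bool * bool := foldl (fun s d =>
  (true, if d is Some c then s.2 && (c == 0) else s.1)) (false, false) q.
Definition ycomp q := (comps q).2.

Lemma ycomp_rcons q d : ycomp (rcons q d) =
  if d is Some c then ycomp q && (c == 0) else q != [::].
Proof.
rewrite /ycomp /comps foldl_rcons /=; case: d => // ; case/lastP: q => // q d.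
by rewrite foldl_rcons /= -size_eq0 size_rcons.
Qed.

Lemma foliation_at_rcons w q d :
  foliation_at w (rcons q d) = foliation_transform (foliation_at w q) d.
Proof. by rewrite /foliation_at foldl_rcons. Qed.

Definition consistent w q sx sy t :=
  [/\ state (foliation_at w q) sx sy t, present sx = (q != [::]) & present sy = ycomp q].

Lemma child_consistent w q sx sy t d n : form_order (foliation_at w q) n ->
  consistent w q sx sy t -> consistent w (rcons q d)
    (child_sx (foliation_at w q) n) (child_sy sx sy d) (maxn t n).
Proof.
move=> wn [ws px py]; split; first by rewrite foliation_at_rcons; apply: child_state.
  by rewrite -size_eq0 size_rcons /child_sx; case: ifP.
by rewrite ycomp_rcons; case: d => [c|] //=; case: eqP; rewrite ?andbT ?andbF.
Qed.

Lemma child_nonzero w d n : form_order w n ->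
  (foliation_transform w d).1 <> 0 \/ (foliation_transform w d).2 <> 0.
Proof.
wlog [c ->] : w d / exists c, d = Some c.
  case: d => [c|]; first by apply; exists c.
  by rewrite foliation_none => H /swap_form_order; apply: H; exists 0.
move=> wn; have [c0|c0] := eqVneq (cone w n) 0.
  right=> E; have b0 : hpart w.2 n != 0.
    have [_ _ [a0|//]] := wn; apply: contraNneq a0 => b0.
    by move: c0; rewrite /cone b0 mulr0 addr0 => ->.
  have [|j /eqP] := @poly_neq0_coef _ (hpart w.2 n \Po ('X + c%:P)).
    by rewrite comp_poly_shift_eq0.
  by apply; rewrite -(@child2_dicritical _ c _ _ wn 0) // E coef2_0.
left=> E; have [|j /eqP] := @poly_neq0_coef _ (cone w n \Po ('X + c%:P)).
  by rewrite comp_poly_shift_eq0.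
apply; have := child1 c wn 0 j; rewrite E coef2_0 /div_order (negPf c0) addn0.
by move=> <-.
Qed.

Lemma foliation_at_order w q : w.1 <> 0 \/ w.2 <> 0 -> exists n, form_order (foliation_at w q) n.
Proof.
move=> w0; elim/last_ind: q => [|q d [n IH]]; first exact: form_order_ex.
by rewrite foliation_at_rcons; apply/form_order_ex/child_nonzero/IH.
Qed.

Lemma separatrix_at w f q : w.1 <> 0 \/ w.2 <> 0 -> separatrix w f -> passes (curve_at f q) ->
  branch (foliation_at w q) (curve_at f q).
Proof.
move=> w0 [fI fp fw]; elim/last_ind: q => [//|q d IH] fq.
have {}IH := IH (curve_at_passes (irreducible_neq0 fI) fq).
have [n wn] := foliation_at_order q w0.
rewrite foliation_at_rcons curve_at_rcons in fq *.
exact: branch_strict wn IH fq.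
Qed.

Lemma nzx_at f q d : f <> 0 -> nzx (curve_at f (rcons q d)).
Proof. by move=> f0; rewrite curve_at_rcons; apply/nzx_strict/curve_at_neq0. Qed.

Lemma nzx_at' f q : f <> 0 -> q != [::] -> nzx (curve_at f q).
Proof. by case/lastP: q => // q d f0 _; apply: nzx_at. Qed.

Lemma nzy_at f q : f <> 0 -> ycomp q -> nzy (curve_at f q).
Proof.
move=> f0; elim/last_ind: q => // q [c|] IH; rewrite ycomp_rcons curve_at_rcons.
  by move=> /andP[/IH fy /eqP ->]; apply: nzy_strict_some0.
by move=> q0; apply: nzy_strict_none; apply: nzx_at'.
Qed.

Lemma strict_mul f g d : f <> 0 -> g <> 0 ->
  strict_transform (f * g) d = strict_transform f d * strict_transform g d.
Proof.
wlog [c ->] : f g d / exists c, d = Some c.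
  case: d => [c|]; first by apply; exists c.
  rewrite !strict_none swapM => H f0 g0; apply: H; first by exists 0.
    by move=> E; apply: f0; rewrite -[f]swapK E swap0.
  by move=> E; apply: g0; rewrite -[g]swapK E swap0.
move=> /fps_order_ex[m fm] /fps_order_ex[n gn].
apply: (@mulXI _ (m + n)) => /=; rewrite -(strict_bl c (fps_orderM fm gn)) blM.
by rewrite (strict_bl c fm) (strict_bl c gn) mulrACA -exprD.
Qed.

Lemma divides_passes_at f g q : f <> 0 -> g <> 0 -> divides f g ->
  passes (curve_at f q) -> passes (curve_at g q).
Proof.
move=> f0 g0 [h E]; have h0 : h <> 0 by move=> h0; apply: g0; rewrite E h0 mul0r.
have -> : curve_at g q = curve_at h q * curve_at f q.
  rewrite E; elim/last_ind: q => // q d IH; rewrite !curve_at_rcons IH.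
  by rewrite strict_mul //; apply: curve_at_neq0.
by rewrite /passes coef2_00M => ->; rewrite mulr0.
Qed.

(** If f met x = 0 to an order above t + 1, its x-derivative would be a unit, and the cofactor
    equation on x = 0 would force b to vanish there to an order above t. *)
Lemma tangency_x w f t : branch w f -> smooth f -> nzx f -> x_side Dicritical t w ->
  exists2 j, (j <= t.+1)%N & f 0%N j != 0.
Proof.
move=> [fI fp [h E]] fs /yorder_ex[n fn] [s st bs]; exists n; last by case: fn.
rewrite leqNgt; apply/negP => tn.
have f1 : f 1%N 0%N != 0 by case: fs => //; rewrite fn.1 ?eqxx //; lia.
have [k bk] := yorder_ex (ex_intro (fun j => w.2 0%N j != 0) s bs).
have ks : (k <= s)%N by rewrite leqNgt; apply: contra bs => sk; apply/eqP/bk.1.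
have : (w.2 * dx f) 0%N k = w.2 0%N k * dx f 0%N 0%N.
  by have := @row0M_lead K w.2 (dx f) k 0; rewrite addn0; apply=> //; case: bk.
have -> : w.2 * dx f = w.1 * dy f - h * f by rewrite -E /wedge; ring.
rewrite coef2B (row0M_low _ (dy_low fn)); last by lia.
rewrite (row0M_low _ fn.1); last by lia.
rewrite subr0 coef_dx mulr1n => /esym/eqP; rewrite mulf_eq0 (negPf f1) orbF.
by apply/negP; case: bk.
Qed.

Lemma smooth_swap f : smooth f -> smooth (swap f).
Proof. by case; [right|left]. Qed.

Lemma tangency_y w f t : branch w f -> smooth f -> nzy f -> y_side Dicritical t w ->
  exists2 i, (i <= t.+1)%N & f i 0%N != 0.
Proof.
by move=> /branch_swap wf /smooth_swap fs fy wy; apply: (tangency_x wf fs fy wy).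
Qed.

End PointStates.

(** * The tree of bad points *)

Section Recursion.
Variable K : numClosedFieldType.
(* [live q]: q is blown up by the reduction of the foliation, or q = 0 if 0 is
   already reduced. *)
Variables (w0 : one_form K) (S : set (fps2 K)) (live : inpoint K -> Prop) (R : nat).
Implicit Types (f g : fps2 K) (c : K) (d : direction K) (p q z : inpoint K) (sx sy : side) (w : one_form K).

Hypothesis w0_neq0 : w0.1 <> 0 \/ w0.2 <> 0.
Hypothesis S_sep : forall f, S f -> separatrix w0 f.

(** The condition of [desingularized_at] expressed at q alone, so that it can be tested before a set
    of centers is chosen; [desingularized_atP] relates the two. *)
Definition desingularized q := forall f, S f -> passes (curve_at f q) ->
  [/\ smooth (curve_at f q), forall g, S g -> passes (curve_at g q) -> same_curve f g,
      q != [::] -> curve_at f q 0%N 1%N != 0 & ~~ ycomp q].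

Definition reach q := forall p d, prefix (rcons p d) q -> live p.

Definition presimple w sx sy := [/\ singular w, is_inv sx || is_inv sy &
  w.1 0%N 1%N != 0 \/ w.2 1%N 0%N != 0].

Definition one_transverse_branch q sx sy := (is_inv sx && is_inv sy ->
    forall f, S f -> ~ passes (curve_at f q)) /\
  forall f g, S f -> S g -> passes (curve_at f q) -> passes (curve_at g q) ->
    [/\ same_curve f g, smooth (curve_at f q), is_inv sx -> curve_at f q 0%N 1%N != 0
      & is_inv sy -> curve_at f q 1%N 0%N != 0].

(** The three facts about the reduction that the recursion uses. They are hypotheses because they
    are obtained differently when 0 is already reduced. *)
Hypothesis not_live_desingularized : forall q, reach q -> ~ live q -> desingularized q.
Hypothesis presimple_branch : forall q sx sy t, reach q -> live q -> consistent w0 q sx sy t ->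
  presimple (foliation_at w0 q) sx sy -> one_transverse_branch q sx sy.
Hypothesis dicritical_branches : forall q n, reach q -> live q -> singular (foliation_at w0 q) ->
  form_order (foliation_at w0 q) n -> cone (foliation_at w0 q) n = 0 ->
  exists2 L : seq (fps2 K), (size L <= R)%N & forall f c, S f -> c != 0 ->
    (hpart (foliation_at w0 q).2 n).[c] != 0 -> passes (curve_at f (rcons q (Some c))) ->
    exists2 g, g \in L & S g /\ same_curve f g.

(** Bounds for the multiplicity of f at q and for its intersection numbers with the components
    through q. *)
Definition coef_bound f q B := [/\ exists i j, (i + j <= B)%N /\ curve_at f q i j != 0,
  q != [::] -> exists2 j, (j <= B)%N & curve_at f q 0%N j != 0
  & ycomp q -> exists2 i, (i <= B)%N & curve_at f q i 0%N != 0].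

(** The second list contains the centers over q of the minimal desingularization of S. The third
    bound is what is passed down to the parent of q. *)
Definition bounded_over q B :=
  [/\ exists2 L : seq (fps2 K), (size L <= B)%N & forall f, S f -> passes (curve_at f q) ->
        exists2 g, g \in L & S g /\ same_curve f g,
      exists2 L : seq (inpoint K), (size L <= B)%N & forall z, prefix q z ->
        (forall p, prefix q p -> prefix p z -> ~ desingularized p) -> z \in L
    & forall f, S f -> passes (curve_at f q) -> coef_bound f q B].

Lemma S_neq0 f : S f -> f <> 0.
Proof. by move=> /S_sep[fI _ _]; apply: irreducible_neq0. Qed.

Lemma S_branch f q : S f -> passes (curve_at f q) -> branch (foliation_at w0 q) (curve_at f q).
Proof. by move=> /S_sep; apply: separatrix_at. Qed.

Lemma coef_boundW f q B B' : (B <= B')%N -> coef_bound f q B -> coef_bound f q B'.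
Proof.
move=> BB [[i [j [ij fij]]] fx fy]; split.
- by exists i, j; split=> //; apply: leq_trans BB.
- by move=> /fx[k kB fk]; exists k => //; apply: leq_trans BB.
- by move=> /fy[k kB fk]; exists k => //; apply: leq_trans BB.
Qed.

Lemma bounded_overW q B B' : (B <= B')%N -> bounded_over q B -> bounded_over q B'.
Proof.
move=> BB [[L LB LP] [L' LB' LP'] cP]; split.
- by exists L => //; apply: leq_trans BB.
- by exists L' => //; apply: leq_trans BB.
- by move=> f Sf fq; apply: coef_boundW BB _; apply: cP.
Qed.

Lemma bounded_over_none q : (forall f, S f -> ~ passes (curve_at f q)) -> bounded_over q 0.
Proof.
move=> noS; split; first by exists [::] => // f Sf /noS; case.
  exists [::] => // z qz /(_ q (prefix_refl q) qz); case=> f Sf /noS; case => //.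
by move=> f Sf /noS; case.
Qed.

Lemma one_class q B : (0 < B)%N ->
  (forall f g, S f -> S g -> passes (curve_at f q) -> passes (curve_at g q) -> same_curve f g) ->
  exists2 L : seq (fps2 K), (size L <= B)%N & forall f, S f -> passes (curve_at f q) ->
        exists2 g, g \in L & S g /\ same_curve f g.
Proof.
move=> B0 same; have [[f [Sf fq]]|noS] := pselect (exists f, S f /\ passes (curve_at f q)).
  exists [:: f] => // g Sg gq; exists f; rewrite ?inE //; split=> //; exact: same.
by exists [::] => // f Sf fq; case: noS; exists f.
Qed.

Lemma bounded_over_desingularized q : desingularized q -> bounded_over q 1.
Proof.
move=> qD; split.
- apply: one_class => // f g Sf Sg fq gq; by have [_ + _ _] := qD f Sf fq; apply.
- by exists [::] => // z qz /(_ q (prefix_refl q) qz).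
- move=> f Sf fq; have [fs _ fx /negPf yq] := qD f Sf fq; split; rewrite ?yq //.
    by case: fs => ?; [exists 1%N, 0%N|exists 0%N, 1%N].
  by move=> /fx; exists 1%N.
Qed.

Lemma desingularized_none q : (forall f, S f -> ~ passes (curve_at f q)) -> desingularized q.
Proof. by move=> noS f Sf /noS. Qed.

Lemma prefix_rconsP q z : prefix q z -> z = q \/ exists d, prefix (rcons q d) z.
Proof.
move=> /prefixP[[|d s] ->]; first by left; rewrite cats0.
by right; exists d; rewrite -cat_rcons prefix_prefix.
Qed.

(** Only the contact with y = 0 remains to be undone. A blow-up lowers it by one at the point
    [Some 0], and every other new point is already desingularized. *)
Lemma desingularization_of_smooth_branch q B : q != [::] ->
  (forall f g, S f -> S g -> passes (curve_at f q) -> passes (curve_at g q) -> same_curve f g) ->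
  (forall f, S f -> passes (curve_at f q) -> curve_at f q 0%N 1%N != 0) ->
  (forall f, S f -> passes (curve_at f q) -> ycomp q ->
     exists2 i, (i <= B)%N & curve_at f q i 0%N != 0) ->
  exists2 L : seq (inpoint K), (size L <= B.+1)%N & forall z, prefix q z ->
    (forall p, prefix q p -> prefix p z -> ~ desingularized p) -> z \in L.
Proof.
elim: B q => [|B IH] q q0 same trans bnd.
  exists [::] => // z qz /(_ q (prefix_refl q) qz); case=> f Sf fq; split.
  - by right; apply: trans.
  - by move=> g Sg gq; apply: same.
  - by move=> _; apply: trans.
  - apply/negP => /(bnd f Sf fq)[[] // _]; by rewrite fq eqxx.
have [yq|yq] := boolP (ycomp q); last first.
  exists [::] => // z qz /(_ q (prefix_refl q) qz); case=> f Sf fq; split=> //.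
  - by right; apply: trans.
  - by move=> g Sg gq; apply: same.
  - by move=> _; apply: trans.
have pure f d : S f -> passes (curve_at f q) -> passes (curve_at f (rcons q d)) ->
    fps_order (curve_at f q) 1 /\ curve_at f (rcons q d) 0%N 1%N != 0.
  move=> Sf fq fd; have [fI _ _] := S_branch Sf fq.
  have fo : fps_order (curve_at f q) 1.
    split; first by case=> // _; rewrite hom00 fq.
    by apply: contraNneq (trans f Sf fq) => E; rewrite -homE E coef0.
  split=> //; rewrite curve_at_rcons in fd *.
  have [d' fd'] := cone_irreducible fI fo.
  have dE := fd; move/(pure_passes _ fo isT fd'): dE => dE; rewrite -dE in fd'.
  case: d dE fd fd' => [c|] dE fd fd'; first by have [] := strict_pure fo fd'.
  have := trans f Sf fq; rewrite -homE; have [a a0 ->] := fd'.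
  by rewrite coefC eqxx.
pose e := Some 0 : direction K.
have qe0 : rcons q e != [::] by rewrite -size_eq0 size_rcons.
have same' f g : S f -> S g -> passes (curve_at f (rcons q e)) ->
    passes (curve_at g (rcons q e)) -> same_curve f g.
  move=> Sf Sg /(curve_at_passes (S_neq0 Sf)) fq /(curve_at_passes (S_neq0 Sg)) gq.
  exact: same.
have trans' f : S f -> passes (curve_at f (rcons q e)) -> curve_at f (rcons q e) 0%N 1%N != 0.
  by move=> Sf fe; have [] := pure f e Sf (curve_at_passes (S_neq0 Sf) fe) fe.
have bnd' f : S f -> passes (curve_at f (rcons q e)) -> ycomp (rcons q e) ->
    exists2 i, (i <= B)%N & curve_at f (rcons q e) i 0%N != 0.
  move=> Sf fe _; have fq := curve_at_passes (S_neq0 Sf) fe.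
  have [i iB fi] := bnd f Sf fq yq; have [fo _] := pure f e Sf fq fe.
  case: i iB fi => [|i] iB fi; first by rewrite fq eqxx in fi.
  by exists i => //; rewrite curve_at_rcons (strict_some0_x _ fo) addn1.
have [L LB LP] := IH (rcons q e) qe0 same' trans' bnd'.
exists (q :: L) => // z /prefix_rconsP[->|[d dz]] zP; first by rewrite inE eqxx.
rewrite inE; apply/orP; right; have [dE|de] := eqVneq d e.
  rewrite dE in dz; apply: LP => // p ep pz; apply: zP => //.
  by apply: prefix_trans ep; rewrite -cats1 prefix_prefix.
exfalso; apply: (zP (rcons q d)) => //; first by rewrite -cats1 prefix_prefix.
move=> f Sf fd; have fq := curve_at_passes (S_neq0 Sf) fd.
have [fo fd1] := pure f d Sf fq fd; split=> //.
- by right.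
- by move=> g Sg gd; apply: same => //; apply: curve_at_passes gd; apply: S_neq0.
- rewrite ycomp_rcons; case: d de {dz} fd fd1 => [c|] de fd fd1.
    by rewrite yq /=; apply: contra de => /eqP ->.
  exfalso; have [fI _ _] := S_branch Sf fq; rewrite curve_at_rcons in fd fd1.
  have [_ [a a0 E]] := transverse_strict fI fd fd1.
  by have := trans f Sf fq; rewrite -homE E coefC eqxx.
Qed.

(** One blow-up makes the branch transverse to the last exceptional line, with contact at most B
    with the other component. The centers are then q and at most B + 1 further points. *)
Lemma bounded_over_smooth q B : q != [::] ->
  (forall f g, S f -> S g -> passes (curve_at f q) -> passes (curve_at g q) ->
     same_curve f g /\ smooth (curve_at f q)) ->
  (forall f, S f -> passes (curve_at f q) -> coef_bound f q B) ->
  bounded_over q B.+2.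
Proof.
move=> q0 same bnd; split.
- by apply: one_class => // f g Sf Sg fq gq; have [] := same f g Sf Sg fq gq.
- have [[h [Sh hq]]|noS] := pselect (exists f, S f /\ passes (curve_at f q)); last first.
    exists [::] => // z qz /(_ q (prefix_refl q) qz); case=> f Sf fq; case: noS; by exists f.
  have [hI _ _] := S_branch Sh hq.
  have [e he] := passes_some_direction hI; rewrite -curve_at_rcons in he.
  have [ho hpure] : fps_order (curve_at h q) 1 /\ pure_cone e (curve_at h q) 1.
    have [_ hs] := same h h Sh Sh hq hq.
    have ho : fps_order (curve_at h q) 1.
      split; first by case=> // _; rewrite hom00 hq.
      by case: hs; apply: contraNneq => E; rewrite -homE E coef0.
    split=> //; have [d hd] := cone_irreducible hI ho.
    have := he; rewrite curve_at_rcons; move/(pure_passes _ ho isT hd) => eE.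
    by rewrite eE.
  have samedir f d : S f -> passes (curve_at f (rcons q d)) ->
      [/\ d = e, same_curve f h & fps_order (curve_at f q) 1 /\ pure_cone e (curve_at f q) 1].
    move=> Sf fd; have fq := curve_at_passes (S_neq0 Sf) fd.
    have [fh fs] := same f h Sf Sh fq hq.
    have := divides_passes_at (S_neq0 Sf) (S_neq0 Sh) fh.1 fd.
    rewrite curve_at_rcons; move/(pure_passes _ ho isT hpure) => dE; split=> //.
    have [fI _ _] := S_branch Sf fq.
    have fo : fps_order (curve_at f q) 1.
      split; first by case=> // _; rewrite hom00 fq.
      by case: fs; apply: contraNneq => E; rewrite -homE E coef0.
    split=> //; have [d' fd'] := cone_irreducible fI fo.
    by move: fd; rewrite curve_at_rcons; move/(pure_passes _ fo isT fd') => d'E; rewrite -dE d'E.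
  have transe f : S f -> passes (curve_at f (rcons q e)) -> curve_at f (rcons q e) 0%N 1%N != 0.
    move=> Sf fe; have [_ _ [fo fp]] := samedir f e Sf fe; rewrite curve_at_rcons.
    case: (e) fp => [c|] fp; first by have [] := strict_pure fo fp.
    rewrite strict_none; have fo' := fps_order_swap fo.
    suff fp' : pure_cone (Some 0) (swap (curve_at f q)) 1 by have [] := strict_pure fo' fp'.
    have [a a0 fE] := fp; exists a => //; apply/polyP => j.
    have [j1|j1] := leqP j 1; last first.
      by rewrite nth_default ?(leq_trans (size_hom _ _)) // expr1 coefZ coefB coefX coefC; case: j j1 => [|[|j]] //= _; rewrite subrr mulr0.
    rewrite hom_swap // fE expr1 coefZ coefB coefX !coefC.
    by case: j j1 => [|[|]] //= _; rewrite ?subr0 ?mulr0 ?mulr1.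
  have qe0 : rcons q e != [::] by rewrite -size_eq0 size_rcons.
  have same' f g : S f -> S g -> passes (curve_at f (rcons q e)) ->
      passes (curve_at g (rcons q e)) -> same_curve f g.
    move=> Sf Sg /(curve_at_passes (S_neq0 Sf)) fq /(curve_at_passes (S_neq0 Sg)) gq.
    by have [] := same f g Sf Sg fq gq.
  have bnd' f : S f -> passes (curve_at f (rcons q e)) -> ycomp (rcons q e) ->
      exists2 i, (i <= B)%N & curve_at f (rcons q e) i 0%N != 0.
    move=> Sf fe; have fq := curve_at_passes (S_neq0 Sf) fe.
    have [_ bx byy] := bnd f Sf fq; have [_ _ [fo _]] := samedir f e Sf fe.
    rewrite curve_at_rcons ycomp_rcons; case: (e) => [c /andP[/byy[i iB fi] /eqP ->]|/bx[i iB fi]].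
      case: i iB fi => [|i] iB fi; first by rewrite fq eqxx in fi.
      by exists i; [apply: ltnW|rewrite (strict_some0_x _ fo) addn1].
    case: i iB fi => [|i] iB fi; first by rewrite fq eqxx in fi.
    by exists i; [apply: ltnW|rewrite (strict_none_x _ fo) addn1].
  have [L LB LP] := desingularization_of_smooth_branch qe0 same' transe bnd'.
  exists (q :: L) => // z /prefix_rconsP[->|[d dz]] zP; first by rewrite inE eqxx.
  rewrite inE; apply/orP; right; have [dE|de] := eqVneq d e.
    rewrite dE in dz; apply: LP => // p ep pz; apply: zP => //.
    by apply: prefix_trans ep; rewrite -cats1 prefix_prefix.
  exfalso; apply: (zP (rcons q d)) => //; first by rewrite -cats1 prefix_prefix.
  by move=> f Sf fd; have [dE _ _] := samedir f d Sf fd; rewrite dE eqxx in de.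
- by move=> f Sf fq; apply: coef_boundW (bnd f Sf fq); lia.
Qed.

Lemma side_x_bound q f sx t : S f -> passes (curve_at f q) -> smooth (curve_at f q) ->
  x_side sx t (foliation_at w0 q) -> present sx = (q != [::]) ->
  (is_inv sx -> curve_at f q 0%N 1%N != 0) ->
  q != [::] -> exists2 j, (j <= t.+1)%N & curve_at f q 0%N j != 0.
Proof.
move=> Sf fq fs wx px fx q0; rewrite q0 in px; case: sx px wx fx => // _ wx fx.
  by exists 1%N => //; apply: fx.
by apply: (tangency_x (S_branch Sf fq) fs _ wx); apply: nzx_at' (S_neq0 Sf) q0.
Qed.

Lemma side_y_bound q f sy t : S f -> passes (curve_at f q) -> smooth (curve_at f q) ->
  y_side sy t (foliation_at w0 q) -> present sy = ycomp q ->
  (is_inv sy -> curve_at f q 1%N 0%N != 0) ->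
  ycomp q -> exists2 i, (i <= t.+1)%N & curve_at f q i 0%N != 0.
Proof.
move=> Sf fq fs wy py fy yq; rewrite yq in py; case: sy py wy fy => // _ wy fy.
  by exists 1%N => //; apply: fy.
by apply: (tangency_y (S_branch Sf fq) fs _ wy); apply: nzy_at (S_neq0 Sf) yq.
Qed.

Lemma smooth_coef_bound f q B : (0 < B)%N -> smooth (curve_at f q) ->
  (q != [::] -> exists2 j, (j <= B)%N & curve_at f q 0%N j != 0) ->
  (ycomp q -> exists2 i, (i <= B)%N & curve_at f q i 0%N != 0) -> coef_bound f q B.
Proof. by move=> B0 fs fx fy; split=> //; case: fs => ?; [exists 1%N, 0%N|exists 0%N, 1%N]. Qed.

(** The leaf through q is the only branch. An invariant component would be that leaf and leave
    nothing for S; otherwise the leaf is smooth and meets the dicritical components to order at most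
    t + 1. *)
Lemma bounded_over_regular q sx sy t : q != [::] -> consistent w0 q sx sy t ->
  ~ singular (foliation_at w0 q) -> bounded_over q t.+3.
Proof.
move=> q0 [[wx wy] px py] wr.
have w_neq0 : (foliation_at w0 q).1 0%N 0%N != 0 \/ (foliation_at w0 q).2 0%N 0%N != 0.
  have [a0|] := eqVneq ((foliation_at w0 q).1 0%N 0%N) 0; last by left.
  have [b0|] := eqVneq ((foliation_at w0 q).2 0%N 0%N) 0; last by right.
  by case: wr.
have noS : is_inv sx || is_inv sy -> bounded_over q t.+3.
  move=> inv; apply: (bounded_overW (leq0n _)); apply: bounded_over_none => f Sf fq.
  have [_ _ fw] := S_branch Sf fq; case sxE: sx inv wx py => /= [||] inv wx py.
  - case: sy inv wy py => //= _ wy /esym yq.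
    case: w_neq0 => [|b0]; first by rewrite wy eqxx.
    by apply: no_branch_regular_y wy b0 fq (nzy_at (S_neq0 Sf) yq) fw.
  - case: w_neq0 => [a0|]; last by rewrite wx eqxx.
    by apply: no_branch_regular_x wx a0 fq (nzx_at' (S_neq0 Sf) q0) fw.
  - case: sy inv wy py => //= _ wy /esym yq.
    case: w_neq0 => [|b0]; first by rewrite wy eqxx.
    by apply: no_branch_regular_y wy b0 fq (nzy_at (S_neq0 Sf) yq) fw.
have [/noS //|/norP[/negPf xi /negPf yi]] := boolP (is_inv sx || is_inv sy).
have lf f g : S f -> S g -> passes (curve_at f q) -> passes (curve_at g q) ->
    same_curve f g /\ smooth (curve_at f q).
  move=> Sf Sg fq gq; have [fg fs] := leaf w_neq0 (S_branch Sf fq) (S_branch Sg gq).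
  split=> //; have [[fI _ _] [gI _ _]] := (S_sep Sf, S_sep Sg).
  exact: curve_at_same fI gI fq gq fg.
apply: bounded_over_smooth => // f Sf fq; have [_ fs] := lf f f Sf Sf fq fq.
apply: smooth_coef_bound => //.
  by apply: side_x_bound wx px _ => //; rewrite xi.
by apply: side_y_bound wy py _ => //; rewrite yi.
Qed.

Lemma bounded_over_presimple q sx sy t : reach q -> live q -> q != [::] ->
  consistent w0 q sx sy t -> presimple (foliation_at w0 q) sx sy -> bounded_over q t.+3.
Proof.
move=> rq lq q0 cq wp; have [none one] := presimple_branch rq lq cq wp.
have [[wx wy] px py] := cq.
apply: bounded_over_smooth => // [f g Sf Sg fq gq|f Sf fq].
  by have [] := one f g Sf Sg fq gq.
have [_ fs fx fy] := one f f Sf Sf fq fq; apply: smooth_coef_bound => //.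
  exact: side_x_bound wx px fx.
exact: side_y_bound wy py fy.
Qed.

(** On the new exceptional line f has order equal to its multiplicity m below, so m <= B. The
    contact below with a component is m if the branch is not tangent to it, and m plus the contact
    upstairs otherwise. *)
Lemma coef_bound_parent f q d B : S f -> passes (curve_at f (rcons q d)) ->
  coef_bound f (rcons q d) B -> coef_bound f q (B + B).
Proof.
move=> Sf fd [_ fx fy]; have fq := curve_at_passes (S_neq0 Sf) fd.
have [fI _ _] := S_branch Sf fq; have [m fm] := fps_order_ex (irreducible_neq0 fI).
have m0 := fps_order_gt0 fm fq; have [d' fd'] := cone_irreducible fI fm.
rewrite curve_at_rcons in fd fx fy; have dE := fd; move/(pure_passes _ fm m0 fd'): dE => dE.
rewrite -dE in fd' => {d' dE}.
have [j jB fj] := fx ltac:(by rewrite -size_eq0 size_rcons).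
have mB : (m <= B)%N.
  apply: leq_trans jB; rewrite leqNgt; apply: contra fj => jm.
  case: d {fd fx fy} fd' => [c|] fd'; first by rewrite (strict_pure fm fd').1.
  have fm' := fps_order_swap fm.
  rewrite strict_none (strict_row0 _ _ fm') polyC0 addr0 comp_polyXr hom_swap; last exact: ltnW.
  by have [a a0 ->] := fd'; rewrite coefC subn_eq0 leqNgt jm.
have [i [k [ik fik]]] := fps_order_coef fm.
split; first by exists i, k; split=> //; lia.
  case: d fd fd' fx fy fj => [c|] fd fd' fx fy fj q0.
    exists m; first by lia.
    have [a a0 E] := fd'; rewrite -homE add0n E coefZ mulf_neq0 //.
    have /monicP : ('X - c%:P) ^+ m \is monic by apply: monic_exp; apply: monicXsubC.
    by rewrite lead_coefE size_exp_XsubC => ->; rewrite oner_eq0.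
  have [|n nB fn] := fy; first by rewrite ycomp_rcons.
  by exists (n + m)%N; [lia|rewrite -(strict_none_x _ fm)].
move=> yq; case: d fd fd' fx fy fj => [c|] fd fd' fx fy fj; last first.
  exists m; first by lia.
  by have [a a0 E] := fd'; rewrite -homE addn0 E coefC.
have [c0|c0] := eqVneq c 0; last first.
  exists m; first by lia.
  have [a a0 E] := fd'; rewrite -homE addn0 E coefZ mulf_neq0 //.
  by rewrite -horner_coef0 horner_exp !hornerE expf_neq0 // oppr_eq0.
have [|n nB fn] := fy; first by rewrite ycomp_rcons yq c0 eqxx.
by exists (n + m)%N; [lia|move: fn; rewrite c0 (strict_some0_x _ fm)].
Qed.

(** [Ld] holds the special directions, and [L0] represents the branches leaving in all others. B + 1
    covers the bound B over [Ld] and the bound 1 at a desingularized point; [coef_bound_parent]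
    doubles it. *)
Lemma bounded_over_children q B (Ld : seq (direction K)) (L0 : seq (fps2 K)) :
  (forall d, d \in Ld -> bounded_over (rcons q d) B) ->
  (forall d, d \notin Ld -> desingularized (rcons q d)) ->
  (forall f d, S f -> d \notin Ld -> passes (curve_at f (rcons q d)) ->
     exists2 g, g \in L0 & S g /\ same_curve f g) ->
  bounded_over q (size L0 + size Ld * B + (B.+1 + B.+1)).
Proof.
move=> dB dD d0.
have [L LB LP] : exists2 L : seq (fps2 K), (size L <= size Ld * B)%N & forall d f, d \in Ld ->
    S f -> passes (curve_at f (rcons q d)) -> exists2 g, g \in L & S g /\ same_curve f g.
  elim: (Ld) dB => [|d s IH] dB; first by exists [::].
  have [|L LB LP] := IH; first by move=> e es; apply: dB; rewrite inE es orbT.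
  have [[L1 LB1 LP1] _ _] := dB d (mem_head _ _).
  exists (L1 ++ L); first by rewrite size_cat mulSn leq_add.
  move=> e f; rewrite inE => /predU1P[->|es] Sf fe.
    by have [g gL1 fg] := LP1 f Sf fe; exists g; rewrite // mem_cat gL1.
  by have [g gL fg] := LP e f es Sf fe; exists g; rewrite // mem_cat gL orbT.
have [Z ZB ZP] : exists2 Z : seq (inpoint K), (size Z <= size Ld * B)%N & forall d z, d \in Ld ->
    prefix (rcons q d) z -> (forall p, prefix (rcons q d) p -> prefix p z -> ~ desingularized p) -> z \in Z.
  elim: (Ld) dB => [|d s IH] dB; first by exists [::].
  have [|Z ZB ZP] := IH; first by move=> e es; apply: dB; rewrite inE es orbT.
  have [_ [L1 LB1 LP1] _] := dB d (mem_head _ _).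
  exists (L1 ++ Z); first by rewrite size_cat mulSn leq_add.
  move=> e z; rewrite inE => /predU1P[->|es] dz zP; rewrite mem_cat.
    by rewrite LP1.
  by rewrite (ZP e) ?orbT.
split.
- exists (L0 ++ L); first by rewrite size_cat; lia.
  move=> f Sf fq; have [fI _ _] := S_branch Sf fq.
  have [d fd] := passes_some_direction fI; rewrite -curve_at_rcons in fd.
  have [dL|dL] := boolP (d \in Ld).
    by have [g gL fg] := LP d f dL Sf fd; exists g; rewrite // mem_cat gL orbT.
  by have [g gL fg] := d0 f d Sf dL fd; exists g; rewrite // mem_cat gL.
- exists (q :: Z); first by rewrite /=; lia.
  move=> z /prefix_rconsP[->|[d dz]] zP; rewrite inE ?eqxx //.
  have qp p : prefix (rcons q d) p -> prefix q p.
    by apply: prefix_trans; rewrite -cats1 prefix_prefix.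
  have [dL|dL] := boolP (d \in Ld).
    by rewrite (ZP d) ?orbT // => p /qp; apply: zP.
  by exfalso; apply: (zP (rcons q d)) (dD d dL) => //; apply/qp/prefix_refl.
- move=> f Sf fq; have [fI _ _] := S_branch Sf fq.
  have [d fd] := passes_some_direction fI; rewrite -curve_at_rcons in fd.
  apply: (@coef_boundW _ _ (B.+1 + B.+1)); first by lia.
  apply: (coef_bound_parent Sf fd).
  have [dL|dL] := boolP (d \in Ld).
    by have [_ _ H] := dB d dL; apply: coef_boundW (H f Sf fd).
  have [_ _ H] := bounded_over_desingularized (dD d dL).
  by apply: coef_boundW (H f Sf fd).
Qed.

Lemma roots_list (P : {poly K}) n : P != 0 -> (size P <= n.+1)%N ->
  exists2 s : seq K, (size s <= n)%N & forall c, P.[c] = 0 -> c \in s.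
Proof.
move=> P0 Pn; have [s sE] := closed_field_poly_normal P.
have sP : size P = (size s).+1.
  by rewrite {1}sE size_scale ?lead_coef_eq0 // size_prod_XsubC.
exists s; first by move: Pn; rewrite sP.
move=> c /eqP; rewrite -/(root P c) sE rootZ ?lead_coef_eq0 //.
by rewrite root_prod_XsubC.
Qed.

(** At a bad point both logarithmic coefficients vanish at the origin, so 1 is not in their
    ideal. *)
Lemma milnor_weight_gt0 w sx sy : bad w (is_inv sx) (is_inv sy) ->
  ~ milnor_weight_le w (is_inv sx) (is_inv sy) 0.
Proof.
move=> [[a0 b0] wb] /(_ 1%N) H; suff : log_codim_ge w (is_inv sx) (is_inv sy) 1.
  by move=> /H; case: (_ (+) _).
exists (fun=> 1) => // a [u [v E]] i; rewrite ord1.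
have := coef2_congr 0 0 E; rewrite coef_lincomb big_ord1 coef2_1 mulr1 => ->.
rewrite coef2D !coef2_00M.
have -> : log1 w (is_inv sy) 0%N 0%N = 0.
  by rewrite /log1; case: ifP => // yi; have [|//] := wb; rewrite yi orbT.
have -> : log2 w (is_inv sx) 0%N 0%N = 0.
  by rewrite /log2; case: ifP => // xi; have [|//] := wb; rewrite xi.
by rewrite !mulr0 addr0.
Qed.

Lemma prefix_of_rcons (s q : inpoint K) d : prefix s (rcons q d) -> s = rcons q d \/ prefix s q.
Proof.
move=> /prefixP[r]; case/lastP: r => [|r e] E; first by left; rewrite E cats0.
right; move: E; rewrite -rcons_cat => /rcons_inj[-> _]; exact: prefix_prefix.
Qed.

Lemma reach_rcons q d : reach q -> live q -> reach (rcons q d).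
Proof.
move=> rq lq p e /prefix_of_rcons[/rcons_inj[-> _] //|pq]; exact: rq pq.
Qed.

Lemma consistentW q sx sy t t' : (t <= t')%N -> consistent w0 q sx sy t -> consistent w0 q sx sy t'.
Proof.
move=> tt' [[wx wy] px py]; split=> //; split.
  by case: (sx) wx => //= -[j jt bj]; exists j => //; apply: leq_trans tt'.
by case: (sy) wy => //= -[j jt bj]; exists j => //; apply: leq_trans tt'.
Qed.

(** At weight at most k' + 1 the order n is at most k' + 2, hence t'. The special directions are
    [None] and the at most n + 1 roots of the cone or, in the dicritical case, [None], [Some 0] and
    the at most n roots of the leading part of b: at most k' + 4. The value t' + 3 serves the new
    points that are not bad, R the generic leaves of a dicritical line. *)
Fixpoint branch_bound k t : nat := if k is k'.+1 then
  let t' := maxn t k'.+2 in let B := maxn (branch_bound k' t') t'.+3 in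
  (R + k'.+4 * B + (B.+1 + B.+1))%N else 0%N.

Lemma bounded_over_bad k t q sx sy : reach q -> consistent w0 q sx sy t ->
  bad (foliation_at w0 q) (is_inv sx) (is_inv sy) ->
  milnor_weight_le (foliation_at w0 q) (is_inv sx) (is_inv sy) k ->
  bounded_over q (branch_bound k t).
Proof.
elim: k t q sx sy => [|k IH] t q sx sy rq cq wb wk; first by case: (milnor_weight_gt0 wb wk).
rewrite /=; set t' := maxn t k.+2; set B := maxn _ _.
have [lq|/(not_live_desingularized rq)/bounded_over_desingularized] := pselect (live q); last first.
  by apply: bounded_overW; lia.
have [ws px py] := cq; have wl := state_log_form ws.
have [n wn] := foliation_at_order q w0_neq0.
have nk := milnor_weight_order wn wl wb wk.
have child d : bounded_over (rcons q d) B.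
  have rd : reach (rcons q d) by apply: reach_rcons.
  have cd := child_consistent d wn cq.
  have {}cd := consistentW (_ : (maxn t n <= t')%N) cd.
  have {}cd := cd ltac:(by rewrite /t' geq_max !leq_max leqnn nk orbT).
  have [ld|/(not_live_desingularized rd)/bounded_over_desingularized] := pselect (live (rcons q d)); last first.
    by apply: bounded_overW; rewrite /B leq_max orbT.
  have d0 : rcons q d != [::] by rewrite -size_eq0 size_rcons.
  have [wd|wd] := pselect (singular (foliation_at w0 (rcons q d))); last first.
    by apply: bounded_overW (bounded_over_regular d0 cd wd); rewrite /B leq_max leqnn orbT.
  have [b|nb] := pselect (bad (foliation_at w0 (rcons q d))
      (is_inv (child_sx (foliation_at w0 q) n)) (is_inv (child_sy sx sy d))).
    apply: (@bounded_overW _ (branch_bound k t')); first by rewrite /B leq_max leqnn.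
    apply: (IH _ _ _ _ rd cd b); move: b; rewrite child_sxE child_syE foliation_at_rcons => b.
    exact: milnor_weight_child wn wl wb b wk.
  apply: bounded_overW (bounded_over_presimple rd ld d0 cd _); first by rewrite /B leq_max leqnn orbT.
  have [a01|a01] := eqVneq ((foliation_at w0 (rcons q d)).1 0%N 1%N) 0; last first.
    split=> //; last by left.
    by apply: contrapT => /negP/negPf e0; apply: nb; split; rewrite ?e0.
  have [b10|b10] := eqVneq ((foliation_at w0 (rcons q d)).2 1%N 0%N) 0; last first.
    split=> //; last by right.
    by apply: contrapT => /negP/negPf e0; apply: nb; split; rewrite ?e0.
  by case: nb.
have [c0|c0] := eqVneq (cone (foliation_at w0 q) n) 0.
  have [L0 LR L0P] := dicritical_branches rq lq wb.1 wn c0.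
  have b0 : hpart (foliation_at w0 q).2 n != 0.
    have [_ _ [a0|//]] := wn; apply: contraNneq a0 => b0.
    by move: c0; rewrite /cone b0 mulr0 addr0 => ->.
  have [rs rn rsP] := roots_list b0 (size_hom _ _).
  have good d : d \notin [:: None, Some 0 & map Some rs] -> exists c,
      [/\ d = Some c, c != 0 & (hpart (foliation_at w0 q).2 n).[c] != 0].
    case: d => // c; rewrite !inE /= => /norP[cn0 crs]; exists c; split=> //.
    apply: contra crs => /eqP/rsP crs; exact: map_f.
  have := @bounded_over_children q B [:: None, Some 0 & map Some rs] L0 (fun d _ => child d).
  move=> H; apply: bounded_overW (H _ _).
  - by rewrite leq_add2r leq_add // leq_mul //= size_map; lia.
  (* Here b does not vanish at the new point: the foliation is regular and transverse to the
     dicritical line. *)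
  - move=> d /good[c [-> cn0 bc]] f Sf fd.
    have b00 : (foliation_at w0 (rcons q (Some c))).2 0%N 0%N != 0.
      by rewrite foliation_at_rcons (child2_dicritical c wn) // coef0_shift.
    have lf g : S g -> passes (curve_at g (rcons q (Some c))) ->
        same_curve f g /\ curve_at f (rcons q (Some c)) 0%N 1%N != 0.
      move=> Sg gd; have [fg f1] := leaf_transverse b00 (S_branch Sf fd) (S_branch Sg gd).
      split=> //; have [[fI _ _] [gI _ _]] := (S_sep Sf, S_sep Sg).
      exact: curve_at_same fI gI fd gd fg.
    have [_ f1] := lf f Sf fd; split=> //.
    + by right.
    + by move=> g Sg gd; have [] := lf g Sg gd.
    + by rewrite ycomp_rcons (negPf cn0) andbF.
  - by move=> f d Sf /good[c [-> cn0 bc]]; apply: L0P.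
have [rs rn rsP] := roots_list c0 (size_cone _ _).
have good d : d \notin None :: map Some rs -> exists2 c, d = Some c & (cone (foliation_at w0 q) n).[c] != 0.
  case: d => // c; rewrite !inE /= => crs; exists c => //.
  apply: contra crs => /eqP/rsP crs; exact: map_f.
have noS f d : S f -> d \notin None :: map Some rs -> ~ passes (curve_at f (rcons q d)).
  move=> Sf /good[c -> cn0] fd; have [_ _ fw] := S_branch Sf fd.
  have [H1 H2 _ _] := nondicritical_some wn c0 c; rewrite foliation_at_rcons in fw.
  by apply: (no_branch_regular_x H1 _ fd (nzx_at _ _ (S_neq0 Sf)) fw); rewrite H2.
have := @bounded_over_children q B (None :: map Some rs) [::] (fun d _ => child d).
move=> H; apply: bounded_overW (H _ _).
- by rewrite leq_add2r add0n; apply: leq_trans (leq_addl _ _); rewrite leq_mul //= size_map; lia.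
- by move=> d dL; apply: desingularized_none => f Sf; apply: noS.
- by move=> f d Sf dL /(noS f d Sf dL).
Qed.

End Recursion.

(** * The exceptional divisor *)

Section Divisor.
Variable K : numClosedFieldType.
Implicit Types (f g : fps2 K) (c : K) (d e : direction K) (p q z : inpoint K).
Implicit Types (T : {fset inpoint K}) (S : set (fps2 K)).
Notation X := (fps2_x K).
Notation Y := (fps2_y K).

Lemma order_X : fps_order X 1.
Proof. by split=> [[|d] //|]; rewrite homX ?oner_eq0. Qed.
Lemma order_Y : fps_order Y 1.
Proof. by split=> [[|d] //|]; rewrite homY ?polyX_eq0. Qed.

Lemma strict_X_some c : strict_transform X (Some c) = 1.
Proof.
apply: (@mulXI _ 1); rewrite /= -(strict_bl c order_X) blX.
by rewrite expr1 mulr1.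
Qed.
Lemma strict_Y_some c : strict_transform Y (Some c) = Y + fps2_const c.
Proof.
by apply: (@mulXI _ 1); rewrite /= -(strict_bl c order_Y) blY expr1.
Qed.
Lemma strict_X_none : strict_transform X None = Y.
Proof. by rewrite strict_none swapX strict_Y_some const0 addr0. Qed.
Lemma strict_Y_none : strict_transform Y None = 1.
Proof. by rewrite strict_none swapY strict_X_some. Qed.

Lemma not_passes1 : ~ passes (1 : fps2 K).
Proof. by rewrite /passes coef2_1 /= => /eqP; rewrite oner_eq0. Qed.

Lemma X_neq0 : X <> 0.
Proof. by apply: (fps_order_nz order_X). Qed.

(** The directions that keep to an exceptional line x = 0: it is followed in direction [None], where
    it becomes y = 0, and from then on in direction [Some 0]. *)
Definition corner_tail (s : inpoint K) := exists k, s = None :: nseq k (Some 0).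

Lemma corner_tail_rcons s d : corner_tail (rcons s d) <->
  (s = [::] /\ d = None) \/ (corner_tail s /\ d = Some 0).
Proof.
split=> [[k]|[[-> ->]|[[k ->] ->]]].
- case: k => [|k]; first by case: s => [[->]|? []] //; left.
  rewrite -[k.+1]addn1 nseqD -cat_cons cats1 => /rcons_inj[-> ->].
  by right; split=> //; exists k.
- by exists 0%N.
- by exists k.+1; rewrite rcons_cons -cats1 -[[:: Some 0]]/(nseq 1 (Some 0)) -nseqD addn1.
Qed.

Lemma curve_at_X s : passes (curve_at X s) ->
  (s = [::] /\ curve_at X s = X) \/ (corner_tail s /\ curve_at X s = Y).
Proof.
elim/last_ind: s => [|s d IH] sp; first by left.
have [[sE E]|[st E]] := IH (curve_at_passes X_neq0 sp); rewrite curve_at_rcons E in sp *; right.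
  case: d sp => [c|] sp; first by move: sp; rewrite strict_X_some => /not_passes1.
  by rewrite sE strict_X_none; split=> //; exists 0%N.
case: d sp => [c|] sp; last by move: sp; rewrite strict_Y_none => /not_passes1.
move: sp; rewrite strict_Y_some /passes coef2D /= add0r => c0.
rewrite c0 const0 addr0; split=> //; apply/corner_tail_rcons; right.
by split=> //; rewrite c0.
Qed.

Lemma curve_at_corner_tail s : corner_tail s -> curve_at X s = Y.
Proof.
move=> [k ->]; elim: k => [|k IH]; first by rewrite /curve_at /= strict_X_none.
rewrite -[k.+1]addn1 nseqD -cat_cons cats1 curve_at_rcons IH strict_Y_some.
by rewrite const0 addr0.
Qed.

(* [yown p q]: the component D_p passes through q and is y = 0 there. *)
Definition yown p q := exists d s, corner_tail s /\ q = rcons p d ++ s.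

Lemma yown_none p q : yown p (rcons q None) <-> exists d, q = rcons p d.
Proof.
split=> [[d [s [st]]]|[d ->]]; last first.
  by exists d, [:: None]; split; [exists 0%N|rewrite cats1].
case/lastP: s st => [[k] //|s e]; rewrite -rcons_cat => /corner_tail_rcons[[-> ->]|[_ ->]] /rcons_inj[E] //.
by exists d; rewrite E cats0.
Qed.

Lemma yown_some p q c : yown p (rcons q (Some c)) <-> yown p q /\ c = 0.
Proof.
split=> [[d [s [st]]]|[[d [s [st ->]]] ->]]; last first.
  exists d, (rcons s (Some 0)); split; last by rewrite -rcons_cat.
  by apply/corner_tail_rcons; right.
case/lastP: s st => [[k] //|s e]; rewrite -rcons_cat => /corner_tail_rcons[[_ ->]|[st ->]] /rcons_inj[E] // => ->.
by split=> //; exists d, s.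
Qed.

Lemma yown_size p q : yown p q -> (size p + 2 <= size q)%N.
Proof. by move=> [d [s [[k ->] ->]]]; rewrite size_cat size_rcons /=; lia. Qed.

Lemma yown_prefix p q : yown p q -> exists d, prefix (rcons p d) q.
Proof. by move=> [d [s [_ ->]]]; exists d; rewrite prefix_prefix. Qed.

Lemma yown_unique p p' q : yown p q -> yown p' q -> p = p'.
Proof.
elim/last_ind: q => [|q [c|] IH].
- by move=> /yown_size; rewrite addn2.
- by move=> /yown_some[/IH H _] /yown_some[/H].
- by move=> /yown_none[d ->] /yown_none[d' /rcons_inj[]].
Qed.

Lemma ycomp_yown q : ycomp q <-> exists p, yown p q.
Proof.
elim/last_ind: q => [|q [c|] IH]; rewrite ?ycomp_rcons.
- by split=> // -[p /yown_size]; rewrite addn2.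
- split=> [/andP[/IH[p pq] /eqP c0]|[p /yown_some[pq ->]]]; first by exists p; apply/yown_some.
  by rewrite eqxx andbT; apply/IH; exists p.
- split=> [|[p /yown_none[d ->]]]; last by rewrite -size_eq0 size_rcons.
  by case/lastP: q {IH} => // q d _; exists q; apply/yown_none; exists d.
Qed.

Lemma prefix_proper p q : prefix p q -> p != q -> exists d s, q = rcons p d ++ s.
Proof.
move=> /prefixP[[|d s] ->]; first by rewrite cats0 eqxx.
by exists d, s; rewrite cat_rcons.
Qed.

Lemma component_at_cat p d s : component_at p (rcons p d ++ s) = curve_at X s.
Proof.
rewrite /component_at ifT; first by rewrite -(size_rcons p d) drop_size_cat.
rewrite cat_rcons prefix_prefix /=.
by apply/eqP => /(congr1 size); rewrite size_cat /=; lia.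
Qed.

Lemma component_passes p q : passes (component_at p q) ->
  (exists d, q = rcons p d) /\ component_at p q = X \/ yown p q /\ component_at p q = Y.
Proof.
have [/andP[pq pNq]|npq] := boolP (prefix p q && (p != q)); last first.
  by rewrite /component_at (negPf npq) => /not_passes1.
have [d [s qE]] := prefix_proper pq pNq; rewrite qE component_at_cat => sp.
have [[sE E]|[st E]] := curve_at_X sp.
  by left; split=> //; exists d; rewrite sE cats0.
by right; split=> //; exists d, s.
Qed.

Lemma component_rcons p d : component_at p (rcons p d) = X.
Proof. by rewrite -[rcons p d]cats0 component_at_cat. Qed.

Lemma component_yown p q : yown p q -> component_at p q = Y.
Proof. by move=> [d [s [st ->]]]; rewrite component_at_cat curve_at_corner_tail. Qed.

Lemma centers_prefix T p q : blowup_centers T -> prefix p q -> q \in T -> p \in T.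
Proof.
move=> TC /prefixP[s ->]; elim/last_ind: s => [|s d IH]; first by rewrite cats0.
by rewrite -rcons_cat => /TC.
Qed.

Lemma on_divisor_prefix T q p d : blowup_centers T -> on_divisor T q -> prefix (rcons p d) q -> p \in T.
Proof.
move=> TC [_ [->|[p' [e [-> p'T]]]]]; first by case: p.
move=> pq; apply: centers_prefix TC _ p'T.
have [/rcons_inj[-> _] |H] := prefix_of_rcons pq; first exact: prefix_refl.
by apply: prefix_trans H; rewrite -cats1 prefix_prefix.
Qed.

Lemma transverse_X f : transverse f X <-> f 0%N 1%N != 0.
Proof.
rewrite /transverse; have -> : wedge (differential f) X = - dy f.
  by rewrite /wedge dxX dyX mulr0 mulr1 sub0r.
by rewrite coef2N coef_dy mulr1n oppr_eq0.
Qed.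

Lemma passes_X : passes X. Proof. by []. Qed.
Lemma corner_ycomp T q : blowup_centers T -> on_divisor T q -> corner T q <-> ycomp q.
Proof.
move=> TC Tq; split.
  move=> [p [p' [_ _ pp' /component_passes cp /component_passes cp']]].
  apply/ycomp_yown; case: cp => [[[d qE] _]|[pq _]]; last by exists p.
  case: cp' => [[[d' qE'] _]|[pq _]]; last by exists p'.
  by case: pp'; move: qE'; rewrite qE => /rcons_inj[].
move=> yq; have [p pq] := (ycomp_yown q).1 yq.
case/lastP: q Tq yq pq => // q d Tq yq pq; exists q, p; split.
- by apply: (on_divisor_prefix TC Tq); apply: prefix_refl.
- by have [e] := yown_prefix pq; apply: on_divisor_prefix TC Tq.
- by move=> E; have := yown_size pq; rewrite E size_rcons; lia.
- by rewrite component_rcons.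
- by rewrite (component_yown pq).
Qed.

Lemma desingularized_atP T S q : blowup_centers T -> on_divisor T q ->
  desingularized_at T S q <-> desingularized S q.
Proof.
move=> TC Tq; split=> H f Sf fq.
  have [fs same tr nc] := H f Sf fq; split=> //; last first.
    by apply/negP => /(corner_ycomp TC Tq).
  case/lastP: q Tq fq tr {H same nc fs} => // q d Tq fq tr _; apply/transverse_X.
  rewrite -(component_rcons q d); apply: tr; last by rewrite component_rcons.
  by apply: (on_divisor_prefix TC Tq); apply: prefix_refl.
have [fs same tr nc] := H f Sf fq; split=> //; last first.
  by move=> /(corner_ycomp TC Tq); apply/negP.
move=> p pT /component_passes[[[d qE] ->]|[pq _]].
  by apply/transverse_X/tr; rewrite qE -size_eq0 size_rcons.
by case/negP: nc; apply/ycomp_yown; exists p.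
Qed.

(** The centers are the points reached without meeting a desingularized point. Another
    desingularization must contain them: a path to such a point that left its centers would do so at
    a point of its divisor, which is desingularized. *)
Lemma minimal_desingularization_of_list S (L : seq (inpoint K)) :
  (forall z, (forall p, prefix p z -> ~ desingularized S p) -> z \in L) ->
  exists T, minimal_desingularization S T /\ (#|` T| <= size L)%N.
Proof.
move=> LP; pose bad_at z := `[< forall p, prefix p z -> ~ desingularized S p >].
pose T := [fset z in L | bad_at z]%fset.
have TE z : z \in T <-> forall p, prefix p z -> ~ desingularized S p.
  rewrite !inE /=; split=> [/andP[_ /asboolP]//|zP]; apply/andP; split; first exact: LP.
  exact/asboolP.
have TC : blowup_centers T.
  move=> p d /TE pP; apply/TE => p' p'p; apply: pP.
  by apply: prefix_trans p'p _; rewrite -cats1 prefix_prefix.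
exists T; split; last first.
  apply: (uniq_leq_size (fset_uniq T)) => z zT.
  by have : z \in T := zT; rewrite !inE => /andP[].
split; first split=> // q Tq.
  apply/desingularized_atP => //; apply: contrapT => qN; case: (Tq) => /negP[]; apply/TE => p pq.
  have [->//|pNq] := eqVneq p q; have [d [s qE]] := prefix_proper pq pNq.
  have /TE : p \in T by apply: (on_divisor_prefix (d := d) TC Tq); rewrite qE prefix_prefix.
  by apply; apply: prefix_refl.
move=> T' [TC' T'P]; apply/fsubsetP => z /TE zP; apply: contrapT => /negP zN.
have [p [pz pT' T'p]] : exists p, [/\ prefix p z, p \notin T' & on_divisor T' p].
  elim/last_ind: z zN {zP} => [|z d IH] zN.
    by exists [::]; split=> //; split=> //; left.
  have [zT'|/IH[p [pz pT' T'p]]] := boolP (z \in T').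
    exists (rcons z d); split=> //; first exact: prefix_refl.
    by split=> //; right; exists z, d.
  by exists p; split=> //; apply: prefix_trans pz _; rewrite -cats1 prefix_prefix.
by apply: (zP p pz); apply/(desingularized_atP S TC' T'p)/T'P.
Qed.

Lemma distinct_curves (L : seq (fps2 K)) : exists s : seq (fps2 K),
  [/\ forall f, f \in s -> f \in L, forall f, f \in L -> exists2 g, g \in s & same_curve f g,
      (size s <= size L)%N & forall i j, (i < size s)%N -> (j < size s)%N ->
        same_curve s`_i s`_j -> i = j].
Proof.
elim: L => [|f L [s [sL Ls ss sP]]]; first by exists [::].
have [[g gs fg]|no] := pselect (exists2 g, g \in s & same_curve f g).
  exists s; split=> //.
  - by move=> h /sL hL; rewrite inE hL orbT.
  - by move=> h; rewrite inE => /predU1P[->|/Ls//]; exists g.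
  - exact: leqW.
exists (f :: s); split=> //.
- by move=> h; rewrite !inE => /predU1P[->|/sL ->]; rewrite ?eqxx ?orbT.
- move=> h; rewrite inE => /predU1P[->|/Ls[g gs hg]].
    by exists f; [rewrite inE eqxx|apply: same_curve_refl].
  by exists g => //; rewrite inE gs orbT.
- case=> [|i] [|j] //= si sj E.
  + by case: no; exists s`_j => //; apply: mem_nth.
  + by case: no; exists s`_i; [apply: mem_nth|apply: same_curve_sym].
  + by congr _.+1; apply: sP.
Qed.

Lemma mult0_prod (s : seq (fps2 K)) B :
  (forall f, f \in s -> exists i j, (i + j <= B)%N /\ f i j != 0) ->
  (mult0 (\prod_(f <- s) f)%R <= size s * B)%N.
Proof.
move=> sB; suff [m [mB sm]] : exists m, (m <= size s * B)%N /\ fps_order (\prod_(f <- s) f) m.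
  by rewrite (mult0_order sm).
elim: s sB => [|f s IH] sB.
  by exists 0%N; rewrite big_nil; split=> //; apply: fps_order0; rewrite coef2_1 oner_eq0.
have [|m [mB sm]] := IH; first by move=> g gs; apply: sB; rewrite inE gs orbT.
have [i [j [ij fij]]] := sB f (mem_head _ _).
have [k fk] : exists k, fps_order f k.
  by apply: fps_order_ex => f0; move: fij; rewrite f0 coef2_0 eqxx.
exists (k + m)%N; rewrite big_cons; split; last exact: fps_orderM.
rewrite mulSn leq_add //; apply: leq_trans ij; rewrite leqNgt; apply: contra fij => ijk.
by apply/eqP; have [/vanishP fv _] := fk; apply: fv.
Qed.

Lemma reduced_equation_of_list S (L : seq (fps2 K)) B :
  (forall f, S f -> exists2 g, g \in L & S g /\ same_curve f g) ->
  (forall f, S f -> exists i j, (i + j <= B)%N /\ f i j != 0) ->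
  exists h, reduced_equation S h /\ (mult0 h <= size L * B)%N.
Proof.
move=> LP SB; pose L' := [seq f <- L | `[< S f >]].
have [s [sL Ls ss sP]] := distinct_curves L'.
have sS f : f \in s -> S f by move=> /sL; rewrite mem_filter => /andP[/asboolP].
exists (\prod_(f <- s) f); split.
  exists s => //; split=> // f Sf; have [g gL [Sg fg]] := LP f Sf.
  have [|h hs gh] := Ls g; first by rewrite mem_filter gL andbT; apply/asboolP.
  by exists h => //; apply: same_curve_trans gh.
apply: leq_trans (mult0_prod (B := B) _) _; first by move=> f /sS/SB.
by rewrite leq_mul2r (leq_trans ss) ?orbT // size_filter count_size.
Qed.

End Divisor.

(** * The minimal reduction *)

Section Reduction.
Variable K : numClosedFieldType.
Variables (w0 : one_form K) (T : {fset inpoint K}) (S : set (fps2 K)) (r : nat).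
Implicit Types (f g : fps2 K) (c : K) (d e : direction K) (p q z : inpoint K) (sx sy : side) (w : one_form K).
Notation X := (fps2_x K).
Let sep : set (fps2 K) := [set f | separatrix w0 f].

Hypothesis w0_neq0 : w0.1 <> 0 \/ w0.2 <> 0.
Hypothesis T_reduction : reduction w0 T.
Hypothesis T_minimal : forall T', reduction w0 T' -> (T `<=` T')%fset.
Hypothesis S_selected : selected_separatrices r w0 T S.

Let T_centers : blowup_centers T. Proof. by case: T_reduction => -[]. Qed.

Let S_sep f : S f -> separatrix w0 f. Proof. by case: S_selected => H _ _; apply: H. Qed.

Lemma sep_neq0 f : separatrix w0 f -> f <> 0.
Proof. by move=> [fI _ _]; apply: irreducible_neq0. Qed.

Lemma desingularized_sub (S' : set (fps2 K)) q : (forall f, S' f -> separatrix w0 f) ->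
  desingularized sep q -> desingularized S' q.
Proof.
move=> S'sep H f /S'sep fs fq; have [h1 h2 h3 h4] := H f fs fq; split=> // g /S'sep; exact: h2.
Qed.

Lemma on_divisor_reach q : (forall p d, prefix (rcons p d) q -> p \in T) -> q \notin T -> on_divisor T q.
Proof.
move=> qr qT; split=> //; case/lastP: q qr {qT} => [|q d] qr; first by left.
by right; exists q, d; split=> //; apply: qr (prefix_refl _).
Qed.

Lemma desingularized_off q : (forall p d, prefix (rcons p d) q -> p \in T) -> q \notin T ->
  desingularized sep q.
Proof.
move=> qr qT; have Tq := on_divisor_reach qr qT.
by apply/(desingularized_atP _ T_centers Tq); have [[_ TD] _] := T_reduction; apply: TD.
Qed.

(** Otherwise q and all centers over it could be discarded, and what remains would still be a
    reduction, against minimality. *)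
Lemma not_center q : desingularized sep q -> ~ singular (foliation_at w0 q) -> q \notin T.
Proof.
move=> qD qs; apply/negP => qT.
pose T' := [fset z in T | ~~ prefix q z]%fset.
have T'E z : (z \in T') = (z \in T) && ~~ prefix q z by rewrite !inE.
have T'C : blowup_centers T'.
  move=> p d; rewrite !T'E => /andP[/T_centers -> /=]; apply: contra => qp.
  by apply: prefix_trans qp _; rewrite -cats1 prefix_prefix.
have T'q z : on_divisor T' z -> z = q \/ on_divisor T z.
  move=> [zT' zE]; have [qz|nqz] := boolP (prefix q z).
    left; case: zE => [zE|[p [d [zE]]]]; first by move: qz; rewrite zE prefixs0 => /eqP.
    rewrite T'E => /andP[_ nqp]; rewrite zE in qz *.
    by have [//|qp] := prefix_of_rcons qz; rewrite qp in nqp.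
  right; split; first by move: zT'; rewrite T'E nqz andbT.
  by case: zE => [|[p [d [zE]]]]; [left|rewrite T'E => /andP[pT _]; right; exists p, d].
have [[_ TD] Tsing] := T_reduction.
have : reduction w0 T'.
  split; first split=> // z T'z.
    apply/(desingularized_atP _ T'C T'z); have [->//|Tz] := T'q z T'z.
    exact/(desingularized_atP _ T_centers Tz)/TD.
  by move=> z /T'q[->|] //; apply: Tsing.
move=> /T_minimal /fsubsetP /(_ q qT); rewrite T'E => /andP[_].
by rewrite prefix_refl.
Qed.

Lemma sep_at f q : separatrix w0 f -> passes (curve_at f q) -> branch (foliation_at w0 q) (curve_at f q).
Proof. exact: separatrix_at. Qed.

Lemma transverse_point f g q : (foliation_at w0 q).2 0%N 0%N != 0 ->
  separatrix w0 f -> separatrix w0 g -> passes (curve_at f q) -> passes (curve_at g q) ->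
  same_curve f g /\ curve_at f q 0%N 1%N != 0.
Proof.
move=> b0 fs gs fq gq; have [fg f1] := leaf_transverse b0 (sep_at fs fq) (sep_at gs gq).
by split=> //; apply: curve_at_same fg => //; [case: fs|case: gs].
Qed.

Lemma transverse_desingularized q : (foliation_at w0 q).2 0%N 0%N != 0 -> ~~ ycomp q ->
  desingularized sep q.
Proof.
move=> b0 yq f fs fq; have [_ f1] := transverse_point b0 fs fs fq fq; split=> //.
  by right.
by move=> g gs gq; have [] := transverse_point b0 fs gs fq gq.
Qed.

Lemma transverse_not_center q : (foliation_at w0 q).2 0%N 0%N != 0 -> ~~ ycomp q -> q \notin T.
Proof.
move=> b0 yq; apply: not_center; first exact: transverse_desingularized.
by move=> [_ b00]; rewrite b00 eqxx in b0.
Qed.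

Lemma no_branch_not_center q : (forall f, separatrix w0 f -> ~ passes (curve_at f q)) ->
  ~ singular (foliation_at w0 q) -> q \notin T.
Proof. by move=> noS; apply: not_center => f fs /noS; case. Qed.

Lemma exists_off_center q : exists c, rcons q (Some c) \notin T.
Proof.
apply: contrapT => /forallNP H.
have inj : injective (fun n : nat => rcons q (Some (n%:R : K))).
  by move=> m n /rcons_inj[/eqP]; rewrite eqr_nat => /eqP.
have U : uniq (map (fun n : nat => rcons q (Some (n%:R : K))) (iota 0 (size T).+1)).
  by rewrite map_inj_uniq // iota_uniq.
have := uniq_leq_size U (s2 := T); rewrite size_map size_iota ltnn => C.
by have : false by apply: C => z /mapP[n _ ->]; apply/negPn/negP; apply: H.
Qed.

Lemma dicritical_lead w n : form_order w n -> cone w n = 0 -> hpart w.2 n != 0.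
Proof.
move=> [_ _ [a0|//]] c0; apply: contraNneq a0 => b0.
by move: c0; rewrite /cone b0 mulr0 addr0 => ->.
Qed.

(** Invariance is tested at points of the final divisor, so a point of D_q that is never blown up
    has to be found; T is finite and the field infinite. *)
Lemma dicritical_center q n : q \in T -> form_order (foliation_at w0 q) n ->
  cone (foliation_at w0 q) n = 0 -> dicritical w0 T q.
Proof.
move=> qT wn c0; split=> // inv; have [c cT] := exists_off_center q.
have qr : on_divisor T (rcons q (Some c)) by split=> //; right; exists q, (Some c).
have := inv _ qr; rewrite component_rcons => /(_ (passes_X K)).
have b0 := dicritical_lead wn c0.
have [|j bj] := @poly_neq0_coef _ (hpart (foliation_at w0 q).2 n \Po ('X + c%:P)).
  by rewrite comp_poly_shift_eq0.
move=> /divX_divides/(_ j).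
have -> : wedge (foliation_at w0 (rcons q (Some c))) X = - (foliation_at w0 (rcons q (Some c))).2.
  by rewrite /wedge dyX dxX mulr0 mulr1 sub0r.
rewrite coef2N foliation_at_rcons (child2_dicritical c wn) // add0n => /eqP.
by rewrite oppr_eq0 (negPf bj).
Qed.

(** At a generic point of the line the foliation is transverse to it and there is no corner, so by
    minimality the point is not a center. Its branches are thus attached to D_q, and 0, 1 or r of
    them are selected. *)
Lemma dicritical_branches_list q n : q \in T -> form_order (foliation_at w0 q) n ->
  cone (foliation_at w0 q) n = 0 ->
  exists2 L : seq (fps2 K), (size L <= maxn 1 r)%N & forall f c, S f -> c != 0 ->
    (hpart (foliation_at w0 q).2 n).[c] != 0 -> passes (curve_at f (rcons q (Some c))) ->
    exists2 g, g \in L & S g /\ same_curve f g.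
Proof.
move=> qT wn c0; have [_ _ Snb] := S_selected.
have [s [sS Ss _] sE] := Snb q (dicritical_center qT wn c0).
exists s; first by rewrite sE; case: ifP => _; [|case: ifP => _]; rewrite leq_max ?leqnn ?orbT.
move=> f c Sf cn0 bc fq.
have [|g gs fg] := Ss f; last by exists g => //; split=> //; have [] := sS g gs.
split=> //; exists (rcons q (Some c)); rewrite component_rcons; split=> //.
split; last by right; exists q, (Some c).
apply: transverse_not_center; last by rewrite ycomp_rcons (negPf cn0) andbF.
by rewrite foliation_at_rcons (child2_dicritical c wn) // coef0_shift.
Qed.

Lemma presimple_order w sx sy : presimple w sx sy -> form_order w 1.
Proof. by move=> [[a0 b0] _]; apply: linear_coefs. Qed.

(** In direction [Some c], if both new coefficients vanished, [w.1 0 1] and [w.2 1 0] would equal -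
    b01 c, with b01 = [w.2 0 1]; an invariant axis and the singularity of the new point give b01 c =
    0, a contradiction. *)
Lemma presimple_child w sx sy d : log_form w (is_inv sx) (is_inv sy) -> presimple w sx sy ->
  cone w 1 != 0 -> (foliation_transform w d).1 0%N 0%N = 0 ->
  presimple (foliation_transform w d) Invariant (child_sy sx sy d).
Proof.
move=> [wx wy] ws c0; have wn := presimple_order ws; have [[a0 b0] e0 ab] := ws.
case: d => [c|] s.
  have [H1 H2 H3 H4] := nondicritical_some wn c0 c; split=> //.
  rewrite H3 H4; have [P'|] := eqVneq (cone w 1)^`().[c] 0; last by left.
  have [Q|] := eqVneq (hpart w.2 1).[c] 0; last by right.
  exfalso; move: P' Q; rewrite H2 in s; rewrite dcone1E hpart1E => P' Q.
  have b10 : w.2 1%N 0%N = - (w.2 0%N 1%N * c) by apply/eqP; rewrite -addr_eq0 Q.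
  have a01 : w.1 0%N 1%N = - (w.2 0%N 1%N * c).
    by apply/eqP; rewrite -addr_eq0; apply/eqP; rewrite -[RHS]P' b10; ring.
  have bc : w.2 0%N 1%N * c = 0.
    move: e0; case xi: (is_inv sx) wx => wx /= yi; first by rewrite (wx isT) mul0r.
    move: s; rewrite cone1E (wy yi) a01 b10 => /eqP.
    have -> : 0 + (- (w.2 0%N 1%N * c) - w.2 0%N 1%N * c) * c + w.2 0%N 1%N * c ^+ 2 = - (w.2 0%N 1%N * c * c) by ring.
    by rewrite oppr_eq0 mulf_eq0 => /orP[/eqP//|/eqP ->]; rewrite mulr0.
  by case: ab; rewrite ?a01 ?b10 bc oppr0 eqxx.
have [H1 H2 H3 H4] := nondicritical_none wn c0; split=> //.
rewrite H3 H4 coef_cone /= subSS subnn /=.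
have [a01|] := eqVneq (w.1 0%N 1%N) 0; last by right.
by left; rewrite a01 add0r; case: ab => //; rewrite a01 eqxx.
Qed.

Lemma no_branch_at_x q : q != [::] -> x_invariant (foliation_at w0 q) ->
  (foliation_at w0 q).1 0%N 0%N != 0 -> forall f, separatrix w0 f -> ~ passes (curve_at f q).
Proof.
move=> q0 wx a0 f fs fq; have [_ _ fw] := sep_at fs fq.
exact: no_branch_regular_x wx a0 fq (nzx_at' (sep_neq0 fs) q0) fw.
Qed.

Lemma no_branch_at_y q : ycomp q -> y_invariant (foliation_at w0 q) ->
  (foliation_at w0 q).2 0%N 0%N != 0 -> forall f, separatrix w0 f -> ~ passes (curve_at f q).
Proof.
move=> yq wy b0 f fs fq; have [_ _ fw] := sep_at fs fq.
exact: no_branch_regular_y wy b0 fq (nzy_at (sep_neq0 fs) yq) fw.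
Qed.

(** * Radial points and the valence of their dicritical component *)

Section RadialPoint.
Variables (q : inpoint K) (sx sy : side) (t : nat).
Let w := foliation_at w0 q.
Hypothesis q_reach : forall p d, prefix (rcons p d) q -> p \in T.
Hypothesis qT : q \in T.
Hypothesis q_consistent : consistent w0 q sx sy t.
Hypothesis w_presimple : presimple w sx sy.
Hypothesis w_radial : cone w 1 = 0.

Let wn : form_order w 1 := presimple_order w_presimple.

(** The linear part is a nonzero multiple of x dy - y dx, so one blow-up makes the foliation regular
    and transverse to the whole exceptional line. *)
Lemma radial_child d : (foliation_at w0 (rcons q d)).2 0%N 0%N != 0.
Proof.
have E j : (cone w 1)`_j = 0 by rewrite w_radial coef0.
have b01 : w.2 0%N 1%N = 0 by have := E 2%N; rewrite coef_cone /= add0r.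
have ab : w.1 0%N 1%N + w.2 1%N 0%N = 0 by have := E 1%N; rewrite coef_cone.
have [_ _ w1] := w_presimple.
have b10 : w.2 1%N 0%N != 0.
  by case: w1 => //; apply: contraNneq => b10; rewrite -ab b10 addr0.
have a01 : w.1 0%N 1%N != 0.
  by apply: contraNneq b10 => a01; rewrite -ab a01 add0r.
rewrite foliation_at_rcons -/w; case: d => [c|].
  by rewrite (child2_dicritical c wn) // coef0_shift hpart1E b01 mul0r addr0.
have c0 : cone (swap_form w) 1 = 0 by apply/eqP; rewrite cone_swap_eq0; apply/eqP.
rewrite foliation_none (child2_dicritical 0 (swap_form_order wn)) // coef0_shift hpart1E.
by rewrite mulr0 addr0.
Qed.

Let child_consistent' d := child_consistent d wn q_consistent.

Lemma radial_invariant d : is_inv (child_sy sx sy d) ->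
  forall f, separatrix w0 f -> ~ passes (curve_at f (rcons q d)).
Proof.
have [[_ wy] _ py] := child_consistent' d; case: (child_sy sx sy d) wy py => // wy /esym yq _.
exact: no_branch_at_y yq wy (radial_child d).
Qed.

(** Without a second component the point is regular and desingularized, and on an invariant one no
    separatrix passes; minimality leaves only the crossings with dicritical components. *)
Lemma radial_center d : rcons q d \in T -> child_sy sx sy d = Dicritical.
Proof.
have [_ _ py] := child_consistent' d; have inv := @radial_invariant d.
have b0 := radial_child d; case: (child_sy sx sy d) py inv => //= py inv dT; exfalso; move: dT; apply/negP.
  by apply: transverse_not_center b0 _; rewrite -py.
apply: (no_branch_not_center (inv isT)) => -[_ b00].
by rewrite b00 eqxx in b0.
Qed.

(** Blowing up a regular point creates a single singular point, in the direction of the leaf; the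
    leaf is transverse to D_q, whose direction is [None]. *)
Lemma radial_corner d : rcons (rcons q d) None \notin T.
Proof.
have b0 := radial_child d; set w' := foliation_at w0 (rcons q d) in b0.
have w'n : form_order w' 0 by split=> //; right; rewrite hom00 polyC_eq0.
have c0 : cone w' 0 != 0.
  apply: contraNneq b0 => E; have := congr1 (fun P : {poly K} => P`_1) E.
  by rewrite coef_cone coef0 /= add0r => ->.
have [H1 H2 _ _] := nondicritical_none w'n c0.
rewrite -(foliation_at_rcons w0) in H1 H2.
have a0 : (foliation_at w0 (rcons (rcons q d) None)).1 0%N 0%N != 0 by rewrite H2.
apply: no_branch_not_center; last by move=> [a00]; rewrite a00 eqxx in a0.
by apply: no_branch_at_x H1 a0; rewrite -size_eq0 size_rcons.
Qed.

Lemma radial_meets p : Defs.meets T q p -> p <> q -> exists d,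
  (rcons q d \in T /\ p = rcons q d) \/ (rcons q d \notin T /\ yown p (rcons q d)).
Proof.
move=> [z [Tz /component_passes qz /component_passes pz]] pq.
case: qz => [[[d zE] _]|[qz _]].
  exists d; right; split; first by rewrite -zE; case: Tz.
  by case: pz => [[[e]]|[pz _]]; [rewrite zE => /rcons_inj[qp _]; case: pq|rewrite -zE].
have [d [s [[k sE] zE]]] := qz; exists d; left.
have dT : rcons q d \in T.
  by apply: (on_divisor_prefix (d := None) T_centers Tz); rewrite zE sE -cat_rcons prefix_prefix.
split=> //; have zE' : z = rcons (rcons q d) None.
  case: k sE => [|k] sE; first by rewrite zE sE cats1.
  have : rcons (rcons q d) None \in T.
    by apply: (on_divisor_prefix (d := Some 0) T_centers Tz); rewrite zE sE -cat_rcons -cat_rcons prefix_prefix.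
  by rewrite (negPf (radial_corner d)).
case: pz => [[[e]]|[]]; first by rewrite zE' => /rcons_inj[].
by rewrite zE' => /yown_none[e /rcons_inj[qp _]]; case: pq.
Qed.

Lemma radial_meets_above d : rcons q d \in T -> Defs.meets T q (rcons q d).
Proof.
move=> dT; exists (rcons (rcons q d) None); split.
- by split; [apply: radial_corner|right; exists (rcons q d), None].
- by rewrite component_yown //; apply/yown_none; exists d.
- by rewrite component_rcons.
Qed.

Lemma radial_meets_below d p : rcons q d \notin T -> yown p (rcons q d) -> Defs.meets T q p.
Proof.
move=> dT pd; exists (rcons q d); split.
- by split=> //; right; exists q, d.
- by rewrite component_rcons.
- by rewrite component_yown.
Qed.

Let nonroot : exists p e, q = rcons p e.
Proof.
have [_ px py] := q_consistent; have [_ e0 _] := w_presimple.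
suff : q != [::] by case/lastP: (q) => // p e _; exists p, e.
case: sx px e0 => //= _ sye; apply: contraTneq sye => qE.
by rewrite qE in py; case: sy py.
Qed.

Lemma valence_le (L : seq (inpoint K)) : (forall p, Defs.meets T q p -> p <> q -> p \in L) ->
  (valence T q <= size L)%N.
Proof.
move=> H; apply: (uniq_leq_size (fset_uniq _)) => p pV.
have : p \in [fset p' in T | (p' != q) && `[< Defs.meets T q p' >]]%fset := pV.
by rewrite !inE => /and3P[_ /eqP pq /asboolP pm]; apply: H.
Qed.

(** The only component through q is the invariant one created by its parent. Hence no point of D_q
    is a center, and that component is the only possible neighbour. *)
Lemma radial_valence1 : ~~ ycomp q -> (valence T q <= 1)%N.
Proof.
move=> yq; have [_ _ py] := q_consistent; have [_ e0 _] := w_presimple.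
have syE : sy = Absent by move: py; rewrite (negPf yq); case: (sy).
have sxE : sx = Invariant by move: e0; rewrite syE orbF; case: (sx).
have [p0 [e qE]] := nonroot.
apply: (@valence_le [:: p0]) => p pm pq; rewrite inE; apply/eqP.
have [d [[dT _]|[_ pd]]] := radial_meets pm pq.
  by have := radial_center dT; rewrite sxE syE; case: (d) => [c|] //=; case: ifP.
case: d pd => [c /yown_some[pq' _]|/yown_none[e' E]].
  by case/negP: yq; apply/ycomp_yown; exists p.
by move: E; rewrite qE => /rcons_inj[].
Qed.

(** Each of the two components through q gives one neighbour of D_q, called [nb]: the component
    itself, or the line separating it from D_q if their crossing is blown up. *)
Lemma radial_valence2 : ycomp q -> valence T q = 2%N.
Proof.
move=> yq; have [p0 [e qE]] := nonroot.
have [p1 p1q] := (ycomp_yown q).1 yq.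
have pn : yown p0 (rcons q None) by apply/yown_none; exists e.
have ps : yown p1 (rcons q (Some 0)) by apply/yown_some.
pose nb d p := if rcons q d \in T then rcons q d else p.
have nbP d p : yown p (rcons q d) -> p <> q -> p \in T ->
    [/\ nb d p \in T, nb d p != q & Defs.meets T q (nb d p)].
  move=> pd pq pT; rewrite /nb; case: ifP => [dT|/negbT dT]; split=> //.
  - by apply/eqP => /(congr1 size); rewrite size_rcons; lia.
  - exact: radial_meets_above.
  - exact/eqP.
  - exact: radial_meets_below pd.
have sp0 : size q = (size p0).+1 by rewrite qE size_rcons.
have sp1 := yown_size p1q.
have [n0T n0q n0m] := nbP None p0 pn ltac:(by move=> E; rewrite E in sp0; lia)
  ltac:(by apply: (q_reach (d := e)); rewrite qE prefix_refl).
have [n1T n1q n1m] := nbP (Some 0) p1 ps ltac:(by move=> E; rewrite E in sp1; lia)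
  ltac:(by have [d] := yown_prefix p1q; apply: q_reach).
have size_neq (x y : inpoint K) : size x <> size y -> x <> y by move=> + E; rewrite E.
have nn : nb None p0 != nb (Some 0) p1.
  rewrite /nb; do 2 case: ifP => _; apply/eqP.
  - by move=> /rcons_inj[].
  - by apply: size_neq; rewrite size_rcons; lia.
  - by apply: size_neq; rewrite size_rcons; lia.
  - by apply: size_neq; lia.
apply/eqP; rewrite eqn_leq; apply/andP; split.
  apply: (@valence_le [:: nb None p0; nb (Some 0) p1]) => p pm pq; rewrite !inE.
  have [d [[dT ->]|[dT pd]]] := radial_meets pm pq.
    have := radial_center dT; case: d dT => [c|] dT /=; last by rewrite /nb dT eqxx.
    case: (c =P 0) dT => // -> dT _; by rewrite /nb dT eqxx orbT.
  case: d dT pd => [c dT /yown_some[pq' c0]|dT /yown_none[e' E]].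
    by rewrite c0 in dT; rewrite /nb (negPf dT) (yown_unique pq' p1q) eqxx orbT.
  rewrite /nb (negPf dT); move: E; rewrite [in X in X -> _]qE => /rcons_inj[-> _].
  by rewrite eqxx.
have : uniq [:: nb None p0; nb (Some 0) p1] by rewrite /= inE nn.
move=> /uniq_leq_size; apply => p; rewrite !inE => /orP[]/eqP ->; apply/and3P; split=> //; exact/asboolP.
Qed.

(** At a corner nothing is selected on D_q, of valence two, so a branch of S must pass through a
    later center on D_q. That center lies on a dicritical component, and there is at most one since
    another component is invariant. Off the corners no point of D_q is a center, and at most one
    branch is selected on it. *)
Lemma radial_branch : one_transverse_branch S q sx sy.
Proof.
have [_ px py] := q_consistent; have [_ e0 _] := w_presimple.
have [p0 [e qE]] := nonroot.
have qD := dicritical_center qT wn w_radial; have [_ _ /(_ q qD) nbS] := S_selected.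
have att f d : S f -> passes (curve_at f (rcons q d)) -> rcons q d \notin T -> attached T q f.
  move=> Sf fd dT; exists (rcons q d); split=> //; last by rewrite component_rcons.
  by split=> //; right; exists q, d.
have yatt f : ycomp q -> S f -> ~ attached T q f.
  move=> yq Sf fa; move: nbS; rewrite (radial_valence2 yq) /= => -[s [_ sP _] s0].
  by have [//|g] := sP f; rewrite (size0nil s0).
have dirP f : S f -> passes (curve_at f q) -> exists d, [/\ passes (curve_at f (rcons q d)),
    curve_at f (rcons q d) 0%N 1%N != 0, fps_order (curve_at f q) 1, pure_cone d (curve_at f q) 1
    & child_sy sx sy d <> Invariant].
  move=> Sf fq; have fs := S_sep Sf; have [fI _ _] := sep_at fs fq.
  have [d fd] := passes_some_direction fI; exists d; rewrite -curve_at_rcons in fd.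
  have [_ f1] := transverse_point (radial_child d) fs fs fd fd.
  have [fo fp] : fps_order (curve_at f q) 1 /\ pure_cone d (curve_at f q) 1.
    by apply: transverse_strict; rewrite -?curve_at_rcons.
  by split=> // inv; apply: (radial_invariant _ fs fd); rewrite inv.
have ydir f d : ycomp q -> S f -> passes (curve_at f (rcons q d)) -> child_sy sx sy d = Dicritical.
  move=> yq Sf fd; apply: radial_center; apply: contrapT => /negP dT.
  by apply: (yatt f yq Sf); apply: att fd dT.
have smooth1 f : fps_order (curve_at f q) 1 -> smooth (curve_at f q).
  move=> fo; have [i [j [ij fij]]] := fps_order_coef fo.
  by case: i j ij fij => [|[|i]] [|[|j]] // _; [right|left].
split.
  move=> /andP[xi yi] f Sf fq.
  have yq : ycomp q by rewrite -py; case: (sy) yi.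
  have [d [fd _ _ _ fi]] := dirP f Sf fq; have := ydir f d yq Sf fd.
  case: (d) fi => [c|] /=; last by case: (sx) xi.
  by case: ifP => // _; case: (sy) yi.
move=> f g Sf Sg fq gq.
have [d [fd f1 fo fp fi]] := dirP f Sf fq; have [d' [gd g1 go gp gi]] := dirP g Sg gq.
have [fx fy] := pure_coefs fo fp.
split.
- have [yq|yq] := boolP (ycomp q).
    have dd : d' = d.
      have := ydir f d yq Sf fd; have := ydir g d' yq Sg gd.
      case: d' d {fx fy fd f1 fp gd g1 gp fi gi} => [c'|] [c|] //=; case: sx px e0 => //=; case: sy py => //=.
      all: try (by case: ifP); try (by case: (c' =P 0); case: (c =P 0) => // -> ->).
    rewrite dd in gd; have [] := transverse_point (radial_child d) (S_sep Sf) (S_sep Sg) fd gd => //.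
  have dT x h : S h -> passes (curve_at h (rcons q x)) -> rcons q x \notin T.
    move=> Sh hx; apply/negP => /radial_center; have syE : sy = Absent by move: py; rewrite (negPf yq); case: (sy).
    have sxE : sx = Invariant by move: e0; rewrite syE orbF; case: (sx).
    by rewrite syE sxE; case: (x) => [c|] //=; case: ifP.
  have [s [sS sP sD] sE] := nbS.
  have [|f' f's ff'] := sP f; first by split=> //; apply: att fd (dT _ _ Sf fd).
  have [|g' g's gg'] := sP g; first by split=> //; apply: att gd (dT _ _ Sg gd).
  have s1 : (size s <= 1)%N.
    rewrite sE; have := radial_valence1 yq; case: ifP => // _; by case: (valence T q) => [|[|[|]]].
  have f'g' : f' = g'.
    have sub1 a (x : fps2 K) : x \in [:: a] -> x = a by rewrite inE => /eqP.
    by case: s s1 f's g's {sS sP sD sE} => [|a [|]] // _ /sub1 -> /sub1 ->.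
  by apply: same_curve_trans ff' _; rewrite f'g'; apply: same_curve_sym.
- exact: smooth1.
- move=> xi; apply: fx => dN; apply: fi; rewrite dN /=; by case: (sx) xi.
- move=> yi; apply: fy => d0; apply: fi; rewrite d0 /= eqxx; by case: (sy) yi.
Qed.

End RadialPoint.

Lemma presimple_nonroot q sx sy t : consistent w0 q sx sy t -> is_inv sx || is_inv sy -> q != [::].
Proof.
move=> [_ px py] e0; apply: contraTneq e0 => qE; rewrite qE in px py.
by case: sx sy px py => [] // [].
Qed.

Lemma off_center_branch q sx sy t : (forall p d, prefix (rcons p d) q -> p \in T) -> q \notin T ->
  consistent w0 q sx sy t -> is_inv sx || is_inv sy -> one_transverse_branch S q sx sy.
Proof.
move=> qr qT cq e0; have q0 := presimple_nonroot cq e0; have [_ px py] := cq.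
have qD : desingularized S q := desingularized_sub S_sep (desingularized_off qr qT).
have yN f : S f -> passes (curve_at f q) -> ~~ is_inv sy.
  by move=> Sf fq; have [_ _ _] := qD f Sf fq; apply: contra; rewrite -py; case: (sy).
split=> [/andP[_ yi] f Sf fq|f g Sf Sg fq gq]; first by have := yN f Sf fq; rewrite yi.
have [fs same fx _] := qD f Sf fq; split=> //.
- exact: same.
- by move=> _; apply: fx.
- by rewrite (negPf (yN f Sf fq)).
Qed.

(** Induction on the distance to the largest size of a center. Unless q is radial, a branch
    continues through a singular, again presimple, point of the new invariant line; by induction it
    is transverse to that line and avoids crossings of invariant components. *)
Lemma presimple_one_branch q sx sy t : (forall p d, prefix (rcons p d) q -> p \in T) ->
  consistent w0 q sx sy t -> presimple (foliation_at w0 q) sx sy ->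
  one_transverse_branch S q sx sy.
Proof.
have [N NP] : exists N, forall z, z \in T -> (size z < N)%N.
  exists (\max_(z <- enum_fset T) size z)%N.+1 => z zT; rewrite ltnS.
  exact: (leq_bigmax_seq (F := fun z : inpoint K => size z)).
have [k kN] : exists k, (N - size q <= k)%N by exists (N - size q)%N.
elim: k q sx sy t kN => [|k IH] q sx sy t.
  move=> qN qr cq [_ e0 _]; apply: off_center_branch cq e0 => //.
  by apply/negP => /NP; lia.
move=> qN qr cq wp; have [ws e0 _] := wp.
have [qT|qT] := boolP (q \in T); last exact: off_center_branch cq e0.
have wn := presimple_order wp; have [c0|c0] := eqVneq (cone (foliation_at w0 q) 1) 0.
  exact: radial_branch qr qT cq wp c0.
have wl := state_log_form (let: And3 h _ _ := cq in h).
have [wx wy] := wl.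
have branchP f : S f -> passes (curve_at f q) -> exists d, [/\ passes (curve_at f (rcons q d)),
    (foliation_at w0 (rcons q d)).1 0%N 0%N = 0, one_transverse_branch S (rcons q d) Invariant (child_sy sx sy d),
    fps_order (curve_at f q) 1 & pure_cone d (curve_at f q) 1].
  move=> Sf fq; have fs := S_sep Sf; have [fI _ _] := sep_at fs fq.
  have [d fd] := passes_some_direction fI; exists d; rewrite -curve_at_rcons in fd.
  have cd := child_consistent d wn cq; rewrite /child_sx (negPf c0) in cd.
  have d0 : rcons q d != [::] by rewrite -size_eq0 size_rcons.
  have [[wx' _] _ _] := cd.
  have s0 : (foliation_at w0 (rcons q d)).1 0%N 0%N = 0.
    apply/eqP; apply: contrapT => /negP a0.
    exact: (no_branch_at_x d0 wx' a0 fs fd).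
  have PS : one_transverse_branch S (rcons q d) Invariant (child_sy sx sy d).
    apply: (IH _ _ _ _ _ _ cd).
    - by rewrite size_rcons; lia.
    - by move=> p e /prefix_of_rcons[/rcons_inj[-> _] //|]; apply: qr.
    - rewrite foliation_at_rcons in s0 *; exact: presimple_child wl wp c0 s0.
  have [_ _ /(_ isT) f1 _] := PS.2 f f Sf Sf fd fd.
  have [fo fp] : fps_order (curve_at f q) 1 /\ pure_cone d (curve_at f q) 1.
    by apply: transverse_strict; rewrite -?curve_at_rcons.
  by split.
have notinv f d : S f -> passes (curve_at f (rcons q d)) ->
    one_transverse_branch S (rcons q d) Invariant (child_sy sx sy d) -> ~~ is_inv (child_sy sx sy d).
  by move=> Sf fd [none _]; apply/negP => inv; apply: (none inv f Sf fd).
have a00 c : (foliation_at w0 (rcons q (Some c))).1 0%N 0%N = (cone (foliation_at w0 q) 1).[c].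
  by rewrite foliation_at_rcons; case: (nondicritical_some wn c0 c).
have a0N : (foliation_at w0 (rcons q None)).1 0%N 0%N = (foliation_at w0 q).2 0%N 1%N.
  by rewrite foliation_at_rcons; case: (nondicritical_none wn c0).
set w := foliation_at w0 q in wn c0 wl wx wy a00 a0N *.
have cone_neq0 : w.1 1%N 0%N = 0 -> w.2 0%N 1%N = 0 -> w.1 0%N 1%N + w.2 1%N 0%N != 0.
  move=> a10 b01; apply: contraNneq c0 => ab; apply/eqP/polyP => j; rewrite coef_cone coef0.
  by case: j => [|[|[|j]]] //=; rewrite ?a10 ?b01 ?addr0.
split.
  move=> /andP[xi yi] f Sf fq; have [d [fd s0 PS _ _]] := branchP f Sf fq.
  have := notinv f d Sf fd PS; case: d fd s0 {PS} => [c|] fd s0 /=; last by rewrite xi.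
  case: (c =P 0) => [_|/eqP cn0]; first by rewrite yi.
  move=> _; have := cone_neq0 (wy yi 1%N) (wx xi 1%N); rewrite a00 cone1E (wx xi) (wy yi) in s0.
  move: s0 => /eqP; rewrite mul0r add0r addr0 mulf_eq0 (negPf cn0) orbF => /eqP ->.
  by rewrite eqxx.
move=> f g Sf Sg fq gq.
have [d [fd sd PSd fo fp]] := branchP f Sf fq; have [d' [gd sd' PSd' go gp]] := branchP g Sg gq.
have fi := notinv f d Sf fd PSd; have gi := notinv g d' Sg gd PSd'.
(* The cone is a10 + (a01 + b10) X + b01 X^2. An invariant axis kills b01 or a10, and its own
   direction is excluded by [notinv], so a single direction remains. *)
have dd : d' = d.
  case/orP: e0 => [xi|yi].
    case: d fi sd {fd PSd fp} => [c|] fi sd; last by rewrite /= xi in fi.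
    case: d' gi sd' {gd PSd' gp} => [c'|] gi sd'; last by rewrite /= xi in gi.
    move: sd sd'; rewrite !a00 !cone1E (wx xi) !mul0r !addr0 => sd sd'.
    have [ab|ab] := eqVneq (w.1 0%N 1%N + w.2 1%N 0%N) 0.
      have := cone_neq0 _ (wx xi 1%N); rewrite ab eqxx; rewrite ab mul0r addr0 in sd.
      by move=> /(_ sd).
    by congr Some; apply: (mulfI ab); apply: (addrI (w.1 1%N 0%N)); rewrite sd'.
  have cN c : ~~ is_inv (child_sy sx sy (Some c)) -> c != 0.
    by move=> /=; apply: contraNneq => ->; rewrite eqxx.
  have root c : c != 0 -> (cone w 1).[c] = 0 -> w.1 0%N 1%N + w.2 1%N 0%N = - (w.2 0%N 1%N * c).
    move=> cn0; rewrite cone1E (wy yi) add0r expr2 mulrA -mulrDl => /eqP.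
    by rewrite mulf_eq0 (negPf cn0) orbF addr_eq0 => /eqP.
  case: d fi sd {fd PSd fp} => [c|] fi sd; case: d' gi sd' {gd PSd' gp} => [c'|] gi sd' //.
  - rewrite !a00 in sd sd'; have r1 := root c (cN c fi) sd; have r2 := root c' (cN c' gi) sd'.
    have b01 : w.2 0%N 1%N != 0.
      apply/negP => /eqP b01; have := cone_neq0 (wy yi 1%N) b01.
      by rewrite r1 b01 mul0r oppr0 eqxx.
    by congr Some; apply: (mulfI b01); apply: oppr_inj; rewrite -r1 r2.
  - rewrite a00 in sd; rewrite a0N in sd'; have r1 := root c (cN c fi) sd.
    by have := cone_neq0 (wy yi 1%N) sd'; rewrite r1 sd' mul0r oppr0 eqxx.
  - rewrite a00 in sd'; rewrite a0N in sd; have r1 := root c' (cN c' gi) sd'.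
    by have := cone_neq0 (wy yi 1%N) sd; rewrite r1 sd mul0r oppr0 eqxx.
have [fx fy] := pure_coefs fo fp.
split.
- by rewrite dd in gd; have [] := PSd.2 f g Sf Sg fd gd.
- have [i [j [ij fij]]] := fps_order_coef fo.
  by case: i j ij fij => [|[|i]] [|[|j]] // _; [right|left].
- by move=> xi; apply: fx => dN; move: fi; rewrite dN /= xi.
- by move=> yi; apply: fy => dE; move: fi; rewrite dE /= eqxx yi.
Qed.

End Reduction.

(** * Reduced singularities *)

Section ReducedPoint.
Variable K : numClosedFieldType.
Implicit Types (f g u v : fps2 K) (c s t : K) (d : direction K) (w : one_form K).

Lemma coef2_10M f g : (f * g) 1%N 0%N = f 0%N 0%N * g 1%N 0%N + f 1%N 0%N * g 0%N 0%N.
Proof. by rewrite coef2M big_ord_recl !big_ord1. Qed.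

Lemma coef2_01M f g : (f * g) 0%N 1%N = f 0%N 0%N * g 0%N 1%N + f 0%N 1%N * g 0%N 0%N.
Proof. by rewrite coef2M big_ord1 big_ord_recl !big_ord1. Qed.

Lemma subst_00 f u v : subst f u v 0%N 0%N = f 0%N 0%N.
Proof. by rewrite substE !big_ord1 mulr1 coef2_1 mulr1. Qed.

Lemma subst_10 f u v : passes u -> passes v ->
  subst f u v 1%N 0%N = f 1%N 0%N * u 1%N 0%N + f 0%N 1%N * v 1%N 0%N.
Proof.
move=> u0 v0; rewrite substE !big_ord_recl !big_ord0 /= !expr0 !expr1 !mul1r !mulr1.
have -> : bump 0 0 = 1%N by []. rewrite coef2_1 coef2_10M u0 v0 /=; ring.
Qed.

Lemma subst_01 f u v : passes u -> passes v ->
  subst f u v 0%N 1%N = f 1%N 0%N * u 0%N 1%N + f 0%N 1%N * v 0%N 1%N.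
Proof.
move=> u0 v0; rewrite substE !big_ord_recl !big_ord0 /= !expr0 !expr1 !mul1r !mulr1.
have -> : bump 0 0 = 1%N by []. rewrite coef2_1 coef2_01M u0 v0 /=; ring.
Qed.

(* Up to sign, the trace and the determinant of the linear part of the vector
   field b d/dx - a d/dy. *)
Definition lin_trace w := w.2 1%N 0%N - w.1 0%N 1%N.
Definition lin_det w := w.1 1%N 0%N * w.2 0%N 1%N - w.1 0%N 1%N * w.2 1%N 0%N.

Lemma lin_pullback w u v : singular w -> passes u -> passes v ->
  let D := u 1%N 0%N * v 0%N 1%N - u 0%N 1%N * v 1%N 0%N in
  lin_trace (pullback u v w) = D * lin_trace w /\ lin_det (pullback u v w) = D ^+ 2 * lin_det w.
Proof.
move=> [a0 b0] u0 v0; rewrite /lin_trace /lin_det /pullback /=.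
rewrite !coef2_10M !coef2_01M !subst_00 a0 b0 !subst_10 // !subst_01 // /=.
by split; ring.
Qed.

(* Trace and determinant are multiplied by D and D^2 under a change of
   coordinates; equality would mean that m/n is a ratio of eigenvalues. *)
Lemma reduced_ratio w m n : singular w -> reduced_singularity w -> (0 < m)%N -> (0 < n)%N ->
  (m * n)%:R * lin_trace w ^+ 2 != (m + n)%:R ^+ 2 * lin_det w.
Proof.
move=> ws [u [v [[u0 v0 uv] red]]] m0 n0; have [tE dE] := lin_pullback ws u0 v0.
have D0 : u 1%N 0%N * v 0%N 1%N - u 0%N 1%N * v 1%N 0%N != 0.
  by move: uv; rewrite /transverse /wedge /= !coef2_00M /= !mulr1n.
set D := (X in X != 0) in D0 tE dE.
rewrite -(inj_eq (mulfI (expf_neq0 2 D0))) [X in X != _]mulrCA [X in _ != X]mulrCA -exprMn -tE -dE.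
case: red => [[l [l0 lQ [_ [a10 a01 b10 b01]]]]|[_ [a10 a01 b10 b01]]];
  rewrite /lin_trace /lin_det a10 a01 b10 b01; last first.
  rewrite mul0r mul0r subr0 subr0 mulr0 expr1n mulr1 pnatr_eq0 -lt0n; lia.
rewrite -subr_eq0 natrM natrD.
have -> : m%:R * n%:R * (- l - 1) ^+ 2 - (m%:R + n%:R) ^+ 2 * (0 * 0 - 1 * - l) =
  (m%:R * l - n%:R) * (n%:R * l - m%:R) :> K by ring.
have E p q : (0 < p)%N -> (0 < q)%N -> p%:R * l - q%:R != 0 :> K.
  move=> p0 q0; rewrite subr_eq0; apply/eqP => pl; apply: (lQ (q%:R / p%:R)).
    by rewrite divr_gt0 ?ltr0n.
  by rewrite rmorph_div /= ?unitfE ?pnatr_eq0 -?lt0n // !ratr_nat -pl mulrAC divff ?mul1r // pnatr_eq0 -lt0n.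
by rewrite mulf_neq0 ?E.
Qed.

(** With s and - t as eigenvalues, the resonance makes their ratio n : (m + n), and the conclusion
    is the relation between trace and determinant that [reduced_ratio] forbids. *)
Lemma resonant_ratio s t m n : (0 < n)%N -> s *+ m + (s + t) *+ n = 0 ->
  ((m + n) * n)%:R * (s - t) ^+ 2 = (m + n + n)%:R ^+ 2 * - (s * t).
Proof.
rewrite -[s *+ m]mulr_natr -[(s + t) *+ n]mulr_natr natrM !natrD -(@ltr0n K) lt0r => /andP[].
move: (m%:R) (n%:R) => {}m {}n n0 _ E.
have nt : t * n = - ((m + n) * s).
  by apply/eqP; rewrite -subr_eq0 -E; apply/eqP; ring.
apply: (mulfI n0).
have -> : n * ((m + n) * n * (s - t) ^+ 2) = (m + n) * (s * n - t * n) ^+ 2 by ring.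
have -> : n * ((m + n + n) ^+ 2 * - (s * t)) = - ((m + n + n) ^+ 2 * (s * (t * n))) by ring.
rewrite nt; ring.
Qed.

Lemma reduced_order w : w.1 <> 0 \/ w.2 <> 0 -> singular w -> reduced_singularity w ->
  form_order w 1 /\ cone w 1 != 0.
Proof.
move=> w0 ws red; have R11 := @reduced_ratio w 1 1 ws red isT isT.
have lin : ~ [/\ w.1 1%N 0%N = 0, w.2 0%N 1%N = 0 & w.1 0%N 1%N + w.2 1%N 0%N = 0].
  move=> [a10 b01 /eqP]; rewrite addrC addr_eq0 => /eqP b10; case/eqP: R11.
  by rewrite /lin_trace /lin_det a10 b01 b10; ring.
have c0 : cone w 1 != 0.
  apply/eqP => E; apply: lin; split.
  - by have := coef_cone w 1 0; rewrite E coef0 /= addr0.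
  - by have := coef_cone w 1 2; rewrite E coef0 /= add0r.
  - by have := coef_cone w 1 1; rewrite E coef0.
split=> //; have [a0 b0] := ws; split.
- by case=> // _; rewrite hom00 a0.
- by case=> // _; rewrite hom00 b0.
- apply/orP; rewrite -negb_and; apply: contra c0 => /andP[/eqP ha /eqP hb].
  by rewrite /cone ha hb mulr0 addr0.
Qed.

(** At a singular direction, trace and determinant of w take the form s - t and - s t, with s and t
    read off from the new linear coefficients. A resonance upstairs would be a positive rational
    ratio of eigenvalues of w. *)
Lemma reduced_child w d : w.1 <> 0 \/ w.2 <> 0 -> singular w -> reduced_singularity w ->
  let w' := foliation_transform w d in
  x_invariant w' /\ (w'.1 0%N 0%N = 0 -> simple_x w').
Proof.
move=> w0 ws red; have [wn c0] := reduced_order w0 ws red.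
have ratio m n := @reduced_ratio w (m + n) n ws red.
case: d => [c|] /=.
  have [wx a00 a01 b10] := nondicritical_some wn c0 c; split=> // s0; split=> // m n m0 n0.
  rewrite a01 b10 dcone1E hpart1E; rewrite a00 cone1E in s0.
  apply: contraTneq (ratio m n _ n0) => [E|]; last by rewrite addn_gt0 m0.
  set s := w.2 1%N 0%N + w.2 0%N 1%N * c; set t := w.1 0%N 1%N + w.2 0%N 1%N * c.
  rewrite negbK; apply/eqP; have -> : lin_trace w = s - t by rewrite /lin_trace /s /t; ring.
  have -> : lin_det w = - (s * t); last first.
    by apply: resonant_ratio => //; rewrite -E; congr (_ + _ *+ _); rewrite /s /t; ring.
  apply/eqP; rewrite -subr_eq0; apply/eqP.
  rewrite -[RHS](mul0r (w.2 0%N 1%N)) -s0 /lin_det /s /t; ring.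
have [wx a00 a01 b10] := nondicritical_none wn c0; split=> // s0; split=> // m n m0 n0.
rewrite a01 b10 coef_cone /=; rewrite a00 in s0.
apply: contraTneq (ratio m n _ n0) => [E|]; last by rewrite addn_gt0 m0.
by rewrite negbK /lin_trace /lin_det s0 mulr0 sub0r -sqrrN opprB (resonant_ratio n0 E).
Qed.

End ReducedPoint.

(** * The bound for the selected separatrices *)

Section Selection.
Variable K : numClosedFieldType.
Implicit Types (f g : fps2 K) (w : one_form K) (p q z : inpoint K).

Lemma consistent_root w : consistent w [::] Absent Absent 0.
Proof. by []. Qed.

Lemma form_order_inj w m n : form_order w m -> form_order w n -> m = n.
Proof.
move=> [am bm cm] [an bn cn]; case: (ltngtP m n) => // lt.
  by case: cm => /eqP[]; [apply: an|apply: bn].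
by case: cn => /eqP[]; [apply: am|apply: bm].
Qed.

(** A point of the first exceptional line that carries a separatrix is simple, and a simple point
    has only one branch besides that line, transverse to it. *)
Lemma reduced_desingularized w (S : set (fps2 K)) d : w.1 <> 0 \/ w.2 <> 0 -> singular w ->
  reduced_singularity w -> (forall f, S f -> separatrix w f) -> desingularized S [:: d].
Proof.
move=> w0 ws red S_sep f Sf fd; have [wx child] := reduced_child d w0 ws red.
have d0 : [:: d] != [::] by [].
have wd : simple_x (foliation_at w [:: d]).
  apply: child; apply: contrapT => /eqP a0.
  exact: (no_branch_at_x w0 d0 wx a0 (S_sep f Sf) fd).
have ok g : S g -> passes (curve_at g [:: d]) ->
    branch (foliation_at w [:: d]) (curve_at g [:: d]) /\ nzx (curve_at g [:: d]).
  move=> Sg gd; split; first exact: separatrix_at (S_sep g Sg) gd.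
  have [gI _ _] := S_sep g Sg; exact: nzx_at' (irreducible_neq0 gI) d0.
have [fb fx] := ok f Sf fd.
have fg g : S g -> passes (curve_at g [:: d]) ->
    same_curve (curve_at f [:: d]) (curve_at g [:: d]) /\ curve_at f [:: d] 0%N 1%N != 0.
  by move=> Sg /(ok g Sg)[gb gx]; apply: simple_branches wd fb fx gb gx.
have [_ f1] := fg f Sf fd; split=> //; [by right| |by case: (d) => [c|] //].
move=> g Sg gd; have [[fI _ _] [gI _ _]] := (S_sep f Sf, S_sep g Sg).
by apply: (curve_at_same fI gI fd gd); have [] := fg g Sg gd.
Qed.

Lemma selection_bounded_over r w T (S : set (fps2 K)) k : w.1 <> 0 \/ w.2 <> 0 -> singular w ->
  milnor_weight_le w false false k -> minimal_reduction w T -> selected_separatrices r w T S ->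
  bounded_over S [::] (branch_bound (maxn 1 r) k 0).
Proof.
move=> w0 ws wk [T0 Tmin] Ssel; have [S_sep _ _] := Ssel.
have root live : reach live ([::] : inpoint K) by move=> p d; rewrite prefixs0 -size_eq0 size_rcons.
have wb : bad (foliation_at w [::]) (is_inv Absent) (is_inv Absent) by split.
have [red|nred] := pselect (reduced_singularity w); last first.
  have [Tred Tle] := Tmin nred.
  apply: (@bounded_over_bad _ w S (fun q => q \in T)) (consistent_root w) wb wk => //.
  - by move=> q qr /negP qT; apply: desingularized_sub S_sep (desingularized_off Tred qr qT).
  - move=> q sx sy t qr _; apply: (presimple_one_branch w0 Tred Tle Ssel) => //.
  - by move=> q n _ qT _; apply: (dicritical_branches_list w0 Tred Tle Ssel).
(* Here T is empty and says nothing about the branches. Only 0 is taken as live, and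
   [reduced_desingularized] settles all points after one blow-up. *)
have [wn c0] := reduced_order w0 ws red.
apply: (@bounded_over_bad _ w S (fun q => q = [::])) (consistent_root w) wb wk => //.
- move=> q qr q0; case/lastP: q => [//|q d] in qr q0 *.
  by rewrite (qr q d) ?prefix_refl //; apply: reduced_desingularized w0 ws red S_sep.
- by move=> q sx sy t _ -> [_ px py] [_ e0 _]; case: sx sy px py e0 => [] // [].
- move=> q n _ -> _ wn' c'0; move: c0; rewrite (form_order_inj wn wn') c'0 eqxx //.
Qed.

Lemma ideal2_zero n : ~ in_ideal2 0 0 (fps2_x K ^+ n).
Proof.
move=> [u [v /(coef2_congr n 0)]]; rewrite !mulr0 addr0 coef2_0 -[_ ^+ _]mulr1 coef2XnM leqnn subnn coef2_1 /=.
by move/eqP; rewrite oner_eq0.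
Qed.

(** B bounds the number of branches, the multiplicity of each and the number of centers; hence the
    square for the multiplicity of S and B for its length. *)
Definition selection_bound r mu := let B := branch_bound (maxn 1 r) mu.*2 0 in maxn (B * B) B.

Theorem selection_bounded r w mu T (S : set (fps2 K)) : w.1 <> 0 \/ w.2 <> 0 -> singular w ->
  milnor_weight_le w false false mu.*2 -> minimal_reduction w T -> selected_separatrices r w T S ->
  (exists h, reduced_equation S h /\ (mult0 h <= selection_bound r mu)%N) /\
  (exists T' : {fset inpoint K}, minimal_desingularization S T' /\
     (#|` T'| <= selection_bound r mu)%N).
Proof.
move=> w0 ws wk Tmin Ssel; have [S_sep _ _] := Ssel.
have [[L LB LP] [M MB MP] cP] := selection_bounded_over w0 ws wk Tmin Ssel.
have root f : S f -> passes (curve_at f [::]) by move=> /S_sep[].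
rewrite /selection_bound; split.
- have [f Sf|f Sf|h [hE hB]] := @reduced_equation_of_list _ S L (branch_bound (maxn 1 r) mu.*2 0).
  + exact: LP (root f Sf).
  + by have [] := cP f Sf (root f Sf).
  + exists h; split=> //; apply: leq_trans hB _.
    by apply: leq_trans (leq_maxl _ _); rewrite leq_mul2r LB orbT.
- have [z zP|T' [T'E T'B]] := @minimal_desingularization_of_list _ S M.
  + by apply: MP (prefix0s z) _ => p _; apply: zP.
  + exists T'; split=> //; apply: leq_trans T'B _; apply: leq_trans MB _; exact: leq_maxr.
Qed.

End Selection.

Lemma milnor_weight (R : realType) (w : one_form R[i]) mu : milnor_number w mu ->
  milnor_weight_le w false false mu.*2.
Proof.
by move=> wmu k wk; rewrite addn0 leq_double; apply: codim_le_milnor wmu wk.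
Qed.

Lemma milnor_neq0 (R : realType) (w : one_form R[i]) mu : milnor_number w mu ->
  w.1 <> 0 \/ w.2 <> 0.
Proof.
move=> wmu; apply: contrapT => /not_orP[/contrapT a0 /contrapT b0].
have [xw _] := milnor_powers wmu; rewrite a0 b0 in xw.
exact: ideal2_zero xw.
Qed.

Theorem theorem4 (R : realType) (r : nat) :
  exists psi : nat -> nat,
  forall (w : one_form R[i]) (mu : nat) (T : {fset (inpoint R[i])})
         (S : set (fps2 R[i])),
    analytic_foliation w -> singular w -> milnor_number w mu ->
    minimal_reduction w T -> selected_separatrices r w T S ->
    (exists h : fps2 R[i], reduced_equation S h /\ (mult0 h <= psi mu)%N) /\
    (exists T' : {fset (inpoint R[i])},
       minimal_desingularization S T' /\ (#|` T'| <= psi mu)%N).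
Proof.
exists (selection_bound r) => w mu T S _ ws wmu.
exact: (selection_bounded (milnor_neq0 wmu) ws (milnor_weight wmu)).
Qed.
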